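(* Let $0<p<1$ and let $\mathcal{G}=(\mathcal{V},\mathcal{E})$ be the random graph on the open vertices of $\mathbb{Z}^d$ with parameter $p$ defined in the context. For $d=2$ and $d=3$, $\mathcal{G}$ consists of one single tree $\mathbb{P}$-almost surely, while for $d\geq 4$, $\mathcal{G}$ is a forest consisting of infinitely many disjoint trees $\mathbb{P}$-almost surely.
   Context: Write $u=(u(1),\ldots,u(d))$ for $u\in\mathbb{Z}^d$. Let $\Omega=\{0,1\}^{\mathbb{Z}^d}$ with the product $\sigma$-algebra $\mathcal{F}$ and the product measure $P_p$ under which the coordinates $\omega(u)$, $u\in\mathbb{Z}^d$, are independent with $P_p(\omega(u)=1)=p=1-P_p(\omega(u)=0)$. Let $\{U_{u,v}: u,v\in\mathbb{Z}^d,\ v(d)=u(d)-1\}$ be i.i.d. uniform $(0,1]$ random variables on a probability space $(\Xi,\mathcal{S},\mu)$, and work on $(\Omega\times\Xi,\mathcal{F}\times\mathcal{S},\mathbb{P}:=P_p\times\mu)$. A vertex $u$ is open if $\omega(u)=1$; $\mathcal{V}=\{u\in\mathbb{Z}^d:\omega(u)=1\}$ is the set of open vertices. For every $u\in\mathbb{Z}^d$ (open or not) let $N_u$ be the set of those $v\in\mathcal{V}$ with $v(d)=u(d)-1$ that minimize $\sum_{i=1}^d|w(i)-u(i)|$ among all $w\in\mathcal{V}$ with $w(d)=u(d)-1$. For $p>0$, $N_u$ is almost surely nonempty; let $h(u)\in N_u$ be the (almost surely unique) element with $U_{u,h(u)}=\min\{U_{u,v}:v\in N_u\}$. Let $\mathcal{E}=\{\langle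 u,h(u)\rangle:u\in\mathcal{V}\}$ (undirected edges) and $\mathcal{G}=(\mathcal{V},\mathcal{E})$. The trees of $\mathcal{G}$ are its connected components. *)

(* Defs.v *)
From HB Require Import structures.
From mathcomp Require Import all_boot all_order all_algebra.
From mathcomp Require Import all_classical all_reals all_analysis.
Set Implicit Arguments.
Unset Strict Implicit.
Unset Printing Implicit Defensive.
Import Order.TTheory GRing.Theory Num.Theory.

Local Open Scope classical_set_scope.
Local Open Scope ring_scope.

Section families_of_random_variables.
Context {d d' : measure_display} {T : measurableType d}
  {T' : measurableType d'} {R : realType} {I : eqType}.
Implicit Types (P : probability T R) (D : set I) (X : I -> T -> T').

Definition mutually_independent P D X : Prop :=
  forall (s : seq I) (A : I -> set T'),
    uniq s -> [set` s] `<=` D -> (forall i, measurable (A i)) ->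
    P (\bigcap_(i in [set` s]) X i @^-1` A i)
      = (\prod_(i <- s) P (X i @^-1` A i))%E.

Definition iid P D X (law : set T' -> \bar R) : Prop :=
  [/\ forall i, D i -> measurable_fun setT (X i),
      forall i, D i -> forall A, measurable A -> P (X i @^-1` A) = law A
    & mutually_independent P D X].

End families_of_random_variables.

(* An undirected graph is a vertex set [V] with a symmetric relation [e] *)
(* (true only between elements of [V]).                                  *)
Section graphs.
Context {T : eqType}.
Implicit Types (V : set T) (e : rel T).

Definition component e (x : T) : set T :=
  [set y | exists2 c : seq T, path e x c & last x c = y].

Definition components V e : set (set T) := [set component e x | x in V].

(* Cycles of size 2 are excluded: [:: x; y] only traverses one undirected *)
(* edge back and forth.                                                   *)
Definition forest e : Prop :=
  irreflexive e /\ forall c : seq T, ucycle e c -> (size c <= 2)%N.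

Definition single_tree V e : Prop :=
  forest e /\ exists C : set T, components V e = [set C].

Definition infinitely_many_trees V e : Prop :=
  forest e /\ infinite_set (components V e).

End graphs.

Definition site (d : nat) := {ffun 'I_d -> int}.

(* [below u v] says that v(d) = u(d) - 1: the last coordinate of a site is *)
(* the one of index i with i.+1 = d, since ['I_d] counts from 0.           *)
Definition below (d : nat) (u v : site d) : Prop :=
  forall i : 'I_d, i.+1 = d -> v i = u i - 1.

Definition dist1 (d : nat) (u v : site d) : int := \sum_(i < d) `|u i - v i|.

Definition cylinders (d : nat) : set (set (site d -> bool)) :=
  \bigcup_(u in [set: site d])
    preimage_set_system setT (fun w : site d -> bool => w u) measurable.

Definition config (d : nat) := g_sigma_algebraType (@cylinders d).

Definition bernoulli_config (R : realType) (d : nat) (p : R)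
    (P : probability (config d) R) : Prop :=
  iid P setT (fun (u : site d) (w : config d) => w u) (bernoulli_prob p).

(* Only the variables [U (u, v)] with [below u v] play a role. As a law on *)
(* the reals, the library's uniform law on the closed interval from 0 to 1 *)
(* is the uniform law on the half-open one, 0 excluded.                    *)
Definition uniform_labels (R : realType) (d : nat) (dX : measure_display)
    (Xi : measurableType dX) (mu : probability Xi R)
    (U : site d * site d -> Xi -> R) : Prop :=
  iid mu [set uv | below uv.1 uv.2] U (uniform_prob (@ltr01 R)).

Section random_graph.
Context {R : realType} {d : nat}.
(* One realization of the environment and of the labels. *)
Variables (w : config d) (U : site d * site d -> R).

Definition open_sites : set (site d) := [set u | w u].

Definition nearest (u : site d) : set (site d) :=
  [set v | [/\ open_sites v, below u v &
    forall z, open_sites z -> below u z -> dist1 v u <= dist1 z u]].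

(* The default value [u] and the choice among ties only matter on a null *)
(* event.                                                                *)
Definition h (u : site d) : site d :=
  xget u [set v | nearest u v /\
    forall z, nearest u z -> U (u, v) <= U (u, z)].

Definition edge : rel (site d) := fun x y =>
  `[< open_sites x /\ y = h x \/ open_sites y /\ x = h y >].

End random_graph.

(* Main.v *)
(* Identify the hyperplane of height t with Z^k, k = d - 1. Each hyperplane *)
(* is resampled independently, so the descending path from a vertex is a    *)
(* random walk, and the difference of two of them is a Markov chain on Z^k, *)
(* absorbed at 0, that far from 0 behaves like a centred walk with a        *)
(* covariance close to a multiple of the identity: truncated at half the    *)
(* distance, one jump can be reflected without moving the other. Hence,     *)
(* outside a ball, ln (1 + ln (1 + |x|^2)) is a supermartingale if k <= 2   *)
(* and 1 / (1 + ln (1 + |x|^2)) is one if k >= 3. In the first case, since  *)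
(* two walks inside a ball merge at once with positive probability, all     *)
(* walks meet; in the second, two walks starting far apart are unlikely to  *)
(* meet, so that any number of walks started far enough from each other     *)
(* stay disjoint with probability close to 1.                               *)
Require Import Defs.
From HB Require Import structures.
From mathcomp Require Import all_boot all_order all_algebra all_fingroup.
From mathcomp Require Import all_classical all_reals all_analysis.
From mathcomp Require Import measurable_realfun zify ring lra.
Set Implicit Arguments.
Unset Strict Implicit.
Unset Printing Implicit Defensive.
Import Order.TTheory GRing.Theory Num.Theory.

Local Open Scope classical_set_scope.
Local Open Scope ring_scope.

(** * Families of independent variables *)

(** Each vertex has exactly one neighbour below it, so a highest vertex of a cycle would need two:
    the graph is a forest ([level_graph_forest]), and two of its vertices lie in one tree exactly
    when their descending paths merge. The states and labels are coded as one family of independent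
    real keys, and the question becomes whether two walks ([walk]) on Z^k, k = d - 1, driven by the
    same keys, ever meet.

    Resampling all keys of one level ([resample]) gives the Markov property ([first_step]). Jumps
    have geometric tails ([jump_tail]), hence bounded sixth moments ([jump_moments]). Flipping or
    swapping coordinates around the starting point preserves the law, so a jump is centred with a
    scalar covariance matrix, and jumps from two sites at distance D have correlations of order 1/D
    ([expect_coord_cross]). Hence the increment of the difference w of two walks has a covariance
    tau times the identity, up to an error of order 1/|w| ([spread_moments]). In the Taylor
    expansion of a function of ln (1 + |w|^2), the trace k tau of this covariance competes with
    twice its radial part, 2 tau. If k <= 2 the leading terms do not push outwards, and the
    concavity of the outer logarithm beats errors of order |w|^-3 ([lnln_drift]); if k >= 3 the
    leading term itself decides ([invln_drift]).

    For k <= 2, a maximum principle for the probability of never meeting ([apart_null]) combines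
    [lnln], which tends to infinity, with the chance to merge in one step in a bounded region
    ([coalescence_lb]). For k >= 3, [invln] controls the probability of ever meeting ([meet_bound]),
    so that widely spaced walks stay disjoint ([ae_apart]). Finally [env_law_drainage] and [hE]
    identify the random graph with these walks. *)

Section families.
Context {R : realType} {I : choiceType}.

Definition coord_preimages : set (set (I -> measurableTypeR R)) :=
  \bigcup_(i in [set: I])
    preimage_set_system setT (fun f : I -> measurableTypeR R => f i) measurable.

Definition realfam := g_sigma_algebraType coord_preimages.

Definition box (s : seq I) (A : I -> set R) : set realfam :=
  [set f | forall i, i \in s -> A i (f i)].

Definition boxes : set (set realfam) :=
  [set B | exists s A, (forall i, measurable (A i)) /\ B = box s A].

Lemma measurable_coord i : measurable_fun setT (fun f : realfam => f i).
Proof.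
move=> _ A mA; rewrite setTI; apply: sub_sigma_algebra; exists i => //.
by exists A => //; rewrite setTI.
Qed.

Lemma measurable_coord_preimage i (A : set R) : measurable A ->
  measurable [set f : realfam | A (f i)].
Proof.
by move=> mA; have := @measurable_coord i measurableT _ mA; rewrite setTI.
Qed.

Lemma measurable_to_realfam d (T : measurableType d) (F : T -> realfam) :
  (forall i, measurable_fun setT (fun x => F x i)) -> measurable_fun setT F.
Proof.
move=> mF; apply: (@measurability _ _ T realfam setT F coord_preimages) => //.
move=> _ [_ [i _ [A mA <-]] <-]; rewrite !setTI.
by have := mF i measurableT A mA; rewrite setTI.
Qed.

Lemma boxE s A : box s A = \bigcap_(i in [set` s]) [set f :
  realfam | A i (f i)].
Proof. by apply/seteqP; split=> f; apply. Qed.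

Lemma measurable_box s A : (forall i, measurable (A i)) -> measurable (box s A).
Proof.
move=> mA; rewrite boxE; apply: fin_bigcap_measurable => // i _.
exact: measurable_coord_preimage.
Qed.

Lemma boxes_setI : setI_closed boxes.
Proof.
move=> _ _ [s [A [mA ->]]] [t [B [mB ->]]].
exists (s ++ t), (fun i => (if i \in s then A i else setT) `&`
   (if i \in t then B i else setT)); split.
  by move=> i; apply: measurableI; case: ifP.
apply/seteqP; split=> f /=.
  by move=> [fA fB] i _; split; case: ifPn => // si; [exact: fA|exact: fB].
move=> fAB; split=> i si; have := fAB i; rewrite mem_cat si ?orbT => /(_ isT)[];
  by case: ifP.
Qed.

Lemma measurable_realfamE : @measurable _ realfam = <<s boxes >>.
Proof.
apply/seteqP; split; last first.
  apply: smallest_sub; first exact: sigma_algebra_measurable.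
  by move=> _ [s [A [mA ->]]]; exact: measurable_box.
apply: smallest_sub; first exact: smallest_sigma_algebra.
move=> _ [i _ [A mA <-]]; apply: sub_gen_smallest.
exists [:: i], (fun=> A); split => //; apply/seteqP; split=> f /=.
  by move=> [_ fA] j; rewrite inE => /eqP ->.
by move=> /(_ i); rewrite inE eqxx => /(_ isT).
Qed.

Lemma box_undup s A : box (undup s) A = box s A.
Proof. by apply/seteqP; split=> f fA i; have := fA i; rewrite mem_undup. Qed.

(** Boxes form a generating family stable under intersection, and any box can be written with a
    duplicate-free list of keys. *)
Lemma realfam_measure_unique (m1 m2 : probability realfam R) :
  (forall s A, uniq s -> (forall i, measurable (A i)) ->
     m1 (box s A) = m2 (box s A)) ->
  forall A, measurable A -> m1 A = m2 A.
Proof.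
move=> m12; apply: (@measure_unique _ _ _ boxes (fun=> setT)).
- exact: measurable_realfamE.
- exact: boxes_setI.
- by move=> _; exists [::], (fun=> setT); split => //; apply/seteqP; split.
- by apply/seteqP; split=> // x _; exists 0%N.
- move=> _ [s [A [mA ->]]]; rewrite -box_undup; apply: m12 => //.
  exact: undup_uniq.
- by move=> k; apply: (@le_lt_trans _ _ 1%E);
  [exact: probability_le1|exact: ltry].
Qed.

Variable nu : probability realfam R.

Definition marginal i (A : set R) :=
  nu [set f : realfam | A (f i)].

Definition independent_coords := forall s A, uniq s ->
  (forall i, measurable (A i)) ->
  nu (box s A) = (\prod_(i <- s) marginal i (A i))%E.

Hypothesis ind : independent_coords.

Definition relabel (r : I -> I) (f : realfam) : realfam := fun i => f (r i).

Lemma measurable_relabel (r : I -> I) : measurable_fun setT (relabel r).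
Proof.
by apply: measurable_to_realfam => i /=; exact: measurable_coord.
Qed.

(** The preimage of a box is the box over the images of its keys, and independence leaves only
    marginals to compare. All symmetries of the jumps come from here. *)
Lemma relabel_measure (r : I -> I) : injective r ->
  (forall i A, measurable A -> marginal (r i) A = marginal i A) ->
  forall A, measurable A -> nu (relabel r @^-1` A) = nu A.
Proof.
move=> rI rM A mA.
pose X : {mfun realfam >-> realfam} :=
  HB.pack (relabel r)
    (isMeasurableFun.Build _ _ _ _ _ (measurable_relabel r)).
apply: (@realfam_measure_unique (distribution nu X) nu) => // s B us mB.
rewrite /distribution /pushforward ind//.
(* By injectivity at most one [i] is involved; a key outside the range of [r] gets the whole
   line. *)
pose C j := \bigcap_(i in [set i | r i = j]) B i.
have CE i : C (r i) = B i.
  apply/seteqP; split=> x; first by apply.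
  by move=> Bx j /rI ->.
have mC j : measurable (C j).
  have [[i <-]|nj] := pselect (exists i, r i = j); first by rewrite CE.
  rewrite (_ : C j = setT)//; apply/seteqP; split=> // x _ i ij.
  by case: nj; exists i.
transitivity (nu (box (map r s) C)).
  congr (nu _); apply/seteqP; split=> f /= fB i.
    by move=> /mapP[j sj ->]; rewrite CE; exact: fB.
  by move=> si; have := fB (r i); rewrite CE map_f//; exact.
rewrite ind ?map_inj_uniq// big_map; apply: eq_bigr => i _.
by rewrite CE rM.
Qed.

Definition mix (J : {pred I}) (f g : realfam) : realfam :=
  fun i => if i \in J then f i else g i.

Lemma measurable_mix (J : {pred I}) :
  measurable_fun setT (fun fg : realfam * realfam => mix J fg.1 fg.2).
Proof.
apply: measurable_to_realfam => i; rewrite /mix/=.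
by case: (i \in J); apply: (measurableT_comp (measurable_coord i)).
Qed.

(** Pasting the keys in [J] of one copy onto an independent copy gives back the law [nu], as boxes
    show; Fubini then integrates out the rest first. With [J] one level this is the Markov property,
    with [J] one label it excludes ties. *)
Lemma resample (J : {pred I}) A : measurable A ->
  nu A = (\int[nu]_f nu [set g | A (mix J f g)])%E.
Proof.
move=> mA.
pose phi (fg : realfam * realfam) := mix J fg.1 fg.2.
pose X : {mfun (realfam * realfam)%type >-> realfam} :=
  HB.pack phi (isMeasurableFun.Build _ _ _ _ _ (measurable_mix J)).
have -> : (\int[nu]_f nu [set g | A (mix J f g)])%E =
    distribution (nu \x nu)%E X A.
  rewrite /distribution /pushforward /product_measure1/=.
  apply: eq_integral => f _ /=; congr (nu _).
  by apply/seteqP; split=> g; rewrite /xsection/= inE.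
apply: (@realfam_measure_unique nu (distribution (nu \x nu)%E X)) =>
  // s B us mB.
pose B1 i := if i \in J then B i else setT.
pose B2 i := if i \in J then setT else B i.
transitivity ((nu \x nu)%E (box s B1 `*` box s B2)); last first.
  congr ((nu \x nu)%E _).
  apply/seteqP; split=> -[f g] /=.
    move=> [fB1 gB2] i si; have := fB1 i si; have := gB2 i si.
    by rewrite /phi /mix /B1 /B2/=; case: ifP.
  move=> fB; split=> i si; have := fB i si;
    by rewrite /phi /mix /B1 /B2/=; case: ifP.
rewrite product_measure1E; first last.
- by apply: measurable_box => i; rewrite /B2; case: ifP.
- by apply: measurable_box => i; rewrite /B1; case: ifP.
have m1 i : marginal i setT = 1%E.
  by rewrite /marginal (_ : [set _ | _] = setT) ?probability_setT.
have mB1 i : measurable (B1 i) by rewrite /B1; case: ifP.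
have mB2 i : measurable (B2 i) by rewrite /B2; case: ifP.
rewrite (ind us mB) [X in (X * _)%E](ind us mB1) [X in (_ * X)%E](ind us mB2).
rewrite -big_split; apply: eq_bigr => i _ /=.
by rewrite /B1 /B2; case: ifP => _; rewrite m1 ?mul1e ?mule1.
Qed.

End families.

(** * The one-step map and its measurability *)

Lemma measurable_const {d} {T : measurableType d} (P : Prop) :
  measurable [set _ : T | P].
Proof.
have [p|np] := pselect P.
  by rewrite (_ : [set _ | _] = setT)//; apply/seteqP; split.
by rewrite (_ : [set _ | _] = set0)//; apply/seteqP; split.
Qed.

Section countable_measurability.
Context {d} {T : measurableType d} {K : countType}.

Lemma measurable_exists (F : K -> set T) :
  (forall k, measurable (F k)) -> measurable [set x | exists k, F k x].
Proof.
move=> mF; rewrite (_ : [set _ | _] = \bigcup_k F k).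
  by apply: countable_bigcupT_measurable => //; exact: countableP.
by apply/seteqP; split=> x [k]; [exists k|exists k].
Qed.

Lemma measurable_forall (F : K -> set T) :
  (forall k, measurable (F k)) -> measurable [set x | forall k, F k x].
Proof.
move=> mF; rewrite (_ : [set _ | _] = ~` [set x | exists k, (~` F k) x]).
  by apply: measurableC; apply: measurable_exists => k; exact: measurableC.
apply/seteqP; split=> x /=; first by move=> Fx [k]; apply; exact: Fx.
by move=> Fx k; apply: contrapT => nF; apply: Fx; exists k.
Qed.

Lemma measurable_imply (F G : set T) :
  measurable F -> measurable G -> measurable [set x | F x -> G x].
Proof.
move=> mF mG; rewrite (_ : [set _ | _] = ~` F `|` G).
  by apply: measurableU => //; exact: measurableC.
apply/seteqP; split=> x /=; last by move=> [].
by move=> FG; have [/FG|] := pselect (F x); [right|left].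
Qed.

(** Measurability of a map with countably many values, stated on its fibres so that [K] carries no
    sigma-algebra. *)
Definition discrete (X : T -> K) := forall k, measurable [set x | X x = k].

Lemma discrete_bind (X : T -> K) (F : K -> set T) : discrete X ->
  (forall k, measurable (F k)) -> measurable [set x | F (X x) x].
Proof.
move=> dX mF; rewrite (_ : [set _ | _] =
    [set x | exists k, ([set x | X x = k] `&` F k) x]).
  by apply: measurable_exists => k; exact: measurableI.
apply/seteqP; split=> x /=; first by exists (X x).
by move=> [k [<-]].
Qed.

Lemma discrete_pred (X : T -> K) (P : set K) :
  discrete X -> measurable [set x | P (X x)].
Proof.
move=> dX; apply: (@discrete_bind X (fun k => [set x | P k])) => // k.
exact: measurable_const.
Qed.

Lemma discrete_measurable_fun d' (T' : measurableType d') (X : T -> K)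
  (f : K -> T') : discrete X -> measurable_fun setT (f \o X).
Proof.
by move=> dX _ A mA; rewrite setTI; exact: (@discrete_pred X (f @^-1` A)).
Qed.

End countable_measurability.

Lemma discrete_pair {d} {T : measurableType d} {K K' : countType}
    (X : T -> K) (Y : T -> K') :
  discrete X -> discrete Y -> discrete (fun x => (X x, Y x)).
Proof.
move=> dX dY [k k'].
rewrite (_ : [set _ | _] = [set x | X x = k] `&` [set x | Y x = k']).
  exact: measurableI.
by apply/seteqP; split=> x /=; [move=> [-> ->]|move=> [-> ->]].
Qed.

Section l1_norm.
Context {k : nat}.
Implicit Types x y z : site k.

Lemma siteB x y i : (x - y) i = x i - y i.
Proof. by rewrite !ffunE. Qed.

Definition l1 x : nat := (\sum_(i < k) `|x i|)%N.

Arguments l1 _%_R.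

Lemma l1_0 : l1 0 = 0%N.
Proof. by rewrite /l1 big1// => i _; rewrite ffunE. Qed.

Lemma l1_eq0 x : l1 x = 0%N -> x = 0.
Proof.
move=> /eqP; rewrite sum_nat_eq0 => /forallP x0; apply/ffunP => i.
by rewrite ffunE; apply/eqP; have := x0 i; rewrite absz_eq0.
Qed.

Lemma l1N x : l1 (- x) = l1 x.
Proof. by apply: eq_bigr => i _; rewrite ffunE abszN. Qed.

Lemma l1B x y : l1 (x - y) = l1 (y - x).
Proof. by rewrite -l1N opprB. Qed.

Lemma l1_triangle x y z : (l1 (x - z) <= l1 (x - y) + l1 (y - z))%N.
Proof.
rewrite /l1 -big_split/=; apply: leq_sum => i _; rewrite !siteB; lia.
Qed.

Lemma l1D x y : (l1 (x + y) <= l1 x + l1 y)%N.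
Proof. by have := l1_triangle x 0 (- y); rewrite opprK subr0 add0r. Qed.

Lemma leq_coord_l1 x i : (`|x i| <= l1 x)%N.
Proof. by rewrite /l1 (bigD1 i)//= leq_addr. Qed.

(** In fact the cube of side [2 * r + 1], which contains the ball of radius [r]: a finite superset
    is enough. *)
Definition l1_ball (r : nat) : seq (site k) :=
  undup [seq [ffun i => (f i : nat)%:Z - r%:Z] | f : {ffun 'I_k ->
    'I_(r.*2.+1)}].

Lemma mem_l1_ball r x : (l1 x <= r)%N -> x \in l1_ball r.
Proof.
move=> xr; rewrite mem_undup; apply/mapP.
exists [ffun i => inord (absz (x i + r%:Z))]; first by rewrite mem_enum.
apply/ffunP => i; rewrite !ffunE; have := leq_coord_l1 x i.
set v : int := x i => xi; rewrite inordK; lia.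
Qed.

Definition axis (i0 : 'I_k) (n : nat) : site k :=
  [ffun i => if i == i0 then n%:Z else 0].

Lemma l1_axis i0 n : l1 (axis i0 n) = n.
Proof.
rewrite /l1 (bigD1 i0)//= big1 => [|i /negPf i0i]; rewrite ffunE ?eqxx ?i0i//.
by rewrite addn0.
Qed.

Lemma axis_inj i0 : injective (axis i0).
Proof. by move=> m n mn; rewrite -(l1_axis i0 m) mn l1_axis. Qed.

End l1_norm.

Arguments l1 {k} _%_R.

(* An environment is a real function of keys: [(t, inl z)] stands for the   *)
(* state, 1 or 0, of the vertex [z] at height [t - 1], and [(t, inr (x, z))] *)
(* for the label of the pair made of [x] at height [t] and that vertex.      *)
(* Thus a step from height [t] reads exactly the keys whose head is [t].     *)
Definition key (k : nat) : Type := (int * (site k + site k * site k))%type.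

HB.instance Definition _ k := Countable.on (key k).

Section one_step.
Context {R : realType} {k : nat}.
Notation env := (@realfam R (key k)).
Implicit Types (e : env) (t : int) (x y z : site k).

Definition openat e t z := e (t, inl z) = 1.

Definition beats e t x y z :=
  (l1 (y - x) < l1 (z - x))%N \/
  l1 (y - x) = l1 (z - x) /\ e (t, inr (x, y)) < e (t, inr (x, z)).

Definition wins e t x y :=
  openat e t y /\ forall z, z <> y -> openat e t z -> beats e t x y z.

(** The default [x] is taken only if nobody wins, a null event by [ae_wins]. *)
Definition hop e t x := xget x [set y | wins e t x y].

Lemma beats_asym e t x y z : beats e t x y z -> ~ beats e t x z y.
Proof.
move=> [yz|[yz lab]] [zy|[zy lab']]; [lia|lia|lia|].
by have := lt_trans lab lab'; rewrite ltxx.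
Qed.

Lemma wins_inj e t x y z : wins e t x y -> wins e t x z -> y = z.
Proof.
move=> [oy wy] [oz wz]; apply: contrapT => yz.
by apply: (@beats_asym e t x y z); [apply: wy|apply: wz] => // /esym.
Qed.

Lemma wins_hop e t x y : wins e t x y -> hop e t x = y.
Proof.
by move=> wy; apply: xget_unique => // z wz; exact: (wins_inj wz wy).
Qed.

Variant hop_spec e t x : site k -> Prop :=
  | HopWins y of wins e t x y : hop_spec e t x y
  | HopNone of (forall y, ~ wins e t x y) : hop_spec e t x x.

Lemma hopP e t x : hop_spec e t x (hop e t x).
Proof.
rewrite /hop; case: xgetP => [y _ wy|nw]; first exact: HopWins.
exact: HopNone.
Qed.

Lemma measurable_openat t z : measurable [set e | openat e t z].
Proof.
exact: (@measurable_coord_preimage R _ (t, inl z) [set 1]).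
Qed.

Lemma measurable_label t x y z :
  measurable [set e : env | e (t, inr (x, y)) < e (t, inr (x, z))].
Proof.
rewrite -[X in measurable X]setTI.
apply: (@measurable_fun_ltr _ _ _ setT _ _ (@measurable_coord R _ (t, inr (x,
  y)))
  (@measurable_coord R _ (t, inr (x, z))) _ [set true]) => //;
    exact: measurableT.
Qed.

Lemma measurable_beats t x y z : measurable [set e | beats e t x y z].
Proof.
apply: measurableU; first exact: measurable_const.
by apply: measurableI; [exact: measurable_const|exact: measurable_label].
Qed.

Lemma measurable_wins t x y : measurable [set e | wins e t x y].
Proof.
apply: measurableI; first exact: measurable_openat.
apply: measurable_forall => z.
apply: (@measurable_imply _ _ [set e | z <> y]); first exact: measurable_const.
apply: (@measurable_imply _ _ [set e | openat e t z]).
  exact: measurable_openat.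
exact: measurable_beats.
Qed.

Lemma discrete_hop t x : discrete (fun e => hop e t x).
Proof.
move=> y; rewrite (_ : [set _ | _] = [set e | wins e t x y] `|`
   ([set e | x = y] `&` [set e | forall z, (~` [set e | wins e t x z]) e])).
  apply: measurableU; first exact: measurable_wins.
  apply: measurableI; first exact: measurable_const.
  by apply: measurable_forall => z; apply: measurableC; exact: measurable_wins.
apply/seteqP; split=> e /=.
  by case: hopP => [z wz <-|nw <-]; [left|right].
move=> [/wins_hop//|[<- nw]].
by case: hopP => // z /nw [].
Qed.

(** Whether [y] wins is decided by the states and labels of the sites no farther than [y], since a
    farther one loses by distance alone. An isometry that matches the two environments there carries
    winners to winners. *)
Lemma wins_transport e e' t t' x x' y (rho : site k -> site k) :
  bijective rho -> (forall z, l1 (rho z - x') = l1 (z - x)) ->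
  (forall z, (l1 (z - x) <= l1 (y - x))%N ->
     e' (t', inl z) = e (t, inl (rho z)) /\
     e' (t', inr (x, z)) = e (t, inr (x', rho z))) ->
  wins e' t' x y <-> wins e t x' (rho y).
Proof.
move=> [rhoV rhoK rhoVK] iso ee'; have [oy ly] := ee' y (leqnn _).
split=> -[oey wy].
  split; first by rewrite /openat -oy.
  move=> w wy' ow; rewrite /beats iso.
  have [z wz] : exists z, w = rho z by exists (rhoV w).
  rewrite wz iso; case: (ltnP (l1 (y - x)) (l1 (z - x))) => zy; first by left.
  have [oz lz] := ee' z zy.
  have : beats e' t' x y z.
    by apply: wy; [move=> zy'; apply: wy';
      rewrite wz zy'|rewrite /openat oz -wz].
  by rewrite /beats ly lz ltnNge zy.
split=> [|z zy oz]; first by rewrite /openat oy.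
rewrite /beats ly.
case: (ltnP (l1 (y - x)) (l1 (z - x))) => zy'; first by left.
have [oz' lz] := ee' z zy'.
have : beats e t x' (rho y) (rho z).
  by apply: wy; [move=> /(can_inj rhoK)|rewrite /openat -oz'].
by rewrite /beats !iso lz ltnNge zy'.
Qed.

Lemma hop_isolated e t x y : openat e t y ->
  (forall z, (l1 (z - x) <= l1 (y - x))%N -> z <> y -> ~ openat e t z) ->
  hop e t x = y.
Proof.
move=> oy cz; apply: wins_hop; split=> // z zy oz; left.
by rewrite ltnNge; apply/negP => /cz; exact.
Qed.

(** The default value of [hop] gives a jump of length 0, so the bound survives when nobody wins. *)
Lemma hop_far e t x z : openat e t z -> (l1 (hop e t x - x) <= l1 (z - x))%N.
Proof.
move=> oz; case: hopP => [y [_ wy]|_]; last by rewrite subrr l1_0.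
have [->//|zy] := pselect (z = y); have [|[->]//] := wy _ zy oz.
exact: ltnW.
Qed.

End one_step.

(** * Law and tails of a jump *)

Section expectations.
Context {d} {T : measurableType d} {R : realType} (P : probability T R).
Implicit Types f g : T -> R.

Definition intg f := P.-integrable setT (EFin \o f).
Definition expect f : R := \int[P]_x f x.

Lemma intg_le f g : measurable_fun setT f -> (forall x, `|f x| <= g x) ->
  intg g -> intg f.
Proof.
move=> mf fg intg; apply: (le_integrable measurableT _ _ intg).
  exact/measurable_EFinP.
by move=> x _ /=; rewrite lee_fin (le_trans (fg x))// ler_norm.
Qed.

Lemma intg_cst c : intg (fun=> c).
Proof. exact: finite_measure_integrable_cst. Qed.

Lemma intgD f g : intg f -> intg g -> intg (fun x => f x + g x).
Proof. exact: integrableD. Qed.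

Lemma intgZ c f : intg f -> intg (fun x => c * f x).
Proof. exact: integrableZl. Qed.

Lemma intg_sum (I : Type) (s : seq I) (f : I -> T -> R) :
  (forall i, intg (f i)) -> intg (fun x => \sum_(i <- s) f i x).
Proof.
move=> intf; elim: s => [|i s IH].
  by under eq_fun do rewrite big_nil; exact: intg_cst.
by under eq_fun do rewrite big_cons; exact: intgD.
Qed.

Lemma eq_expect f g : f =1 g -> expect f = expect g.
Proof. by move=> /funext ->. Qed.

Lemma expect_cst c : expect (fun=> c) = c.
Proof.
by rewrite /expect Rintegral_cst// [X in fine X]probability_setT mulr1.
Qed.

Lemma expectD f g : intg f -> intg g ->
  expect (fun x => f x + g x) = expect f + expect g.
Proof. by move=> intf intg; exact: RintegralD. Qed.

Lemma expectZ c f : intg f -> expect (fun x => c * f x) = c * expect f.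
Proof. by move=> intf; exact: RintegralZl. Qed.

Lemma expect_sum (I : Type) (s : seq I) (f : I -> T -> R) :
  (forall i, intg (f i)) ->
  expect (fun x => \sum_(i <- s) f i x) = \sum_(i <- s) expect (f i).
Proof.
move=> intf; elim: s => [|i s IH].
  by under eq_fun do rewrite big_nil; rewrite big_nil expect_cst.
under eq_fun do rewrite big_cons.
by rewrite big_cons -IH expectD//; exact: intg_sum.
Qed.

Lemma expect_le f g : intg f -> intg g -> (forall x, f x <= g x) ->
  expect f <= expect g.
Proof. by move=> intf intg fg; apply: le_Rintegral. Qed.

Lemma expect_abs f g : intg f -> intg g -> (forall x, `|f x| <= g x) ->
  `|expect f| <= expect g.
Proof.
move=> intf intgg fg.
have intNg : intg (fun x => -1 * g x) by exact: intgZ.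
rewrite ler_norml -mulN1r -expectZ//; apply/andP; split;
  apply: expect_le => // x.
  by rewrite mulN1r; have := fg x; rewrite ler_norml => /andP[].
by have := fg x; rewrite ler_norml => /andP[].
Qed.

Lemma intg_indic A : measurable A -> intg (\1_A).
Proof. exact: integrable_indic. Qed.

Lemma expect_indic A : measurable A -> expect (\1_A) = fine (P A).
Proof. by move=> mA; rewrite /expect /Rintegral integral_indic// setIT. Qed.

Lemma intg_bounded f c : measurable_fun setT f -> (forall x, `|f x| <= c) ->
  intg f.
Proof. by move=> mf fc; apply: (intg_le mf fc); exact: intg_cst. Qed.

End expectations.

Section drainage_law.
Context {R : realType} {k : nat}.
Notation env := (@realfam R (key k)).
Implicit Types (e : env) (t : int) (x y z : site k).

(** The interface between the walks and the probability space of the theorem, supplied by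
    [env_law_drainage]. Equal marginals make mirror relabellings preserve the law; the absence of
    atoms rules out ties. *)
Record drainage_law (p : R) (nu : probability env R) : Prop := DrainageLaw {
  law_gt0 : 0 < p;
  law_lt1 : p < 1;
  law_ind : independent_coords nu;
  law_open : forall t z, marginal nu (t, inl z) [set 1] = p%:E;
  law_site : forall t z t' z' A, measurable A ->
    marginal nu (t, inl z) A = marginal nu (t', inl z') A;
  law_label : forall t q t' q' A, measurable A ->
    marginal nu (t, inr q) A = marginal nu (t', inr q') A;
  law_atomless : forall t q a, marginal nu (t, inr q) [set a] = 0%E }.

Context {p : R} {nu : probability env R}.
Hypothesis law : drainage_law p nu.

Let mset1 : measurable [set 1 : R].
Proof. exact: measurable_set1. Qed.

Lemma law_closed t z : marginal nu (t, inl z) (~` [set 1]) = (1 - p)%:E.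
Proof.
rewrite EFinB -(law_open law t z) -[1%E](probability_setT nu).
rewrite /marginal -[X in nu X](setTD [set e : env | [set 1] (e (t, inl z))]).
rewrite measureD//; [by rewrite setTI|exact: measurable_coord_preimage|].
by rewrite [X in (X < _)%E]probability_setT ltry.
Qed.

Lemma closed_prob t (s : seq (site k)) : uniq s ->
  nu [set e | forall z, z \in s -> ~ openat e t z] = ((1 - p) ^+ size s)%:E.
Proof.
move=> us.
rewrite (_ : [set _ | _] = box [seq (t, inl z) : key k | z <- s]
    (fun=> ~` [set 1])); last first.
  apply/seteqP; split=> e /= eP; first by move=> q /mapP[z zs ->]; exact: eP.
  by move=> z zs; have := eP (t, inl z); rewrite map_f//; exact.
rewrite (law_ind law); last 2 first.
- by rewrite map_inj_uniq// => z z' [].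
- by move=> _; exact: measurableC.
rewrite big_map (eq_bigr (fun=> (1 - p)%:E)); last by move=> z _;
  exact: law_closed.
elim: s {us} => [|z s IH]; first by rewrite big_nil.
by rewrite big_cons IH -EFinM exprS.
Qed.

Lemma open_closed_prob t y (s : seq (site k)) : y \notin s -> uniq s ->
  nu [set e | openat e t y /\ forall z, z \in s -> ~ openat e t z] =
  (p * (1 - p) ^+ size s)%:E.
Proof.
move=> ys us; pose A (i : key k) : set R :=
  if i == (t, inl y) then [set 1] else ~` [set 1].
have Az z : z \in s -> A (t, inl z) = ~` [set 1].
  rewrite /A => zs; case: eqP => // -[zy]; by move: ys; rewrite -zy zs.
rewrite (_ : [set _ | _] = box [seq (t, inl z) : key k | z <- y :: s] A);
  last first.
  apply/seteqP; split=> e /=.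
    move=> [oy ce] q; rewrite inE => /orP[/eqP ->|/mapP[z zs ->]].
      by rewrite /A eqxx.
    by rewrite Az//; exact: ce.
  move=> eA; split=> [|z zs].
    by have := eA (t, inl y); rewrite inE eqxx /A eqxx; exact.
  by have := eA (t, inl z); rewrite inE (map_f (fun z =>
    (t, inl z)))// orbT Az//; exact.
rewrite (law_ind law); last 2 first.
- by rewrite map_inj_uniq//= ?ys// => z z' [].
- by move=> i; rewrite /A; case: ifP => // _; exact: measurableC.
rewrite big_map big_cons {1}/A eqxx EFinM; congr (_ * _)%E;
  first exact: law_open.
rewrite -(closed_prob t us) (_ : [set _ | _] =
    box [seq (t, inl z) : key k | z <- s] (fun=> ~` [set 1])); last first.
  apply/seteqP; split=> e /= eP; first by move=> q /mapP[z zs ->]; exact: eP.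
  by move=> z zs; have := eP (t, inl z); rewrite map_f//; exact.
rewrite (law_ind law); last 2 first.
- by rewrite map_inj_uniq// => z z' [].
- by move=> _; exact: measurableC.
by rewrite big_map big_seq [RHS]big_seq; apply: eq_bigr => z zs; rewrite Az.
Qed.

Definition jump t x e : site k := hop e t x - x.

Lemma discrete_jump t x : discrete (jump t x).
Proof.
move=> v; rewrite (_ : [set _ | _] = [set e | hop e t x = v + x]).
  exact: discrete_hop.
apply/seteqP; split=> e /=; first by rewrite /jump => <-; rewrite subrK.
by rewrite /jump => ->; rewrite addrK.
Qed.

(** A jump of length at least [j] forces [j] sites of an axis through [x], at distances 0 to
    [j - 1], to be closed. *)
Lemma jump_tail (i0 : 'I_k) t x (j : nat) :
  (nu [set e | (j <= l1 (jump t x e))%N] <= ((1 - p) ^+ j)%:E)%E.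
Proof.
pose s := [seq x + axis i0 i | i <- iota 0 j].
have us : uniq s by rewrite map_inj_uniq ?iota_uniq// => a b /addrI/axis_inj.
have -> : ((1 - p) ^+ j)%:E = nu [set e | forall z, z \in s -> ~ openat e t z].
  by rewrite closed_prob// size_map size_iota.
apply: le_measure; rewrite ?inE.
- exact: (@discrete_pred _ _ _ _ [set v | (j <= l1 v)%N] (@discrete_jump t x)).
- apply: measurable_forall => z.
  apply: (@measurable_imply _ _ [set e | z \in s] (~` [set e | openat e t z])).
    exact: measurable_const.
  by apply: measurableC; exact: measurable_openat.
- move=> e /= je z /mapP[i]; rewrite mem_iota add0n => /andP[_ ij] -> oz.
  have := hop_far x oz; rewrite addrAC subrr add0r l1_axis.
  by move: je; rewrite /jump; lia.
Qed.

(** If [y] is the only open site of a cube around [x], both [x] and [y] step to [y]. This bounds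
    from below the probability of a given jump and that of a merger. *)
Lemma hop_eq_prob t x y r : (l1 (y - x) <= r)%N ->
  ((p * (1 - p) ^+ size (@l1_ball k r))%:E <=
   nu [set e | hop e t x = y /\ hop e t y = y])%E.
Proof.
move=> yr; pose s := rem y [seq x + z | z <- l1_ball r].
have ub : uniq [seq x + z | z <- l1_ball r].
  by rewrite map_inj_uniq ?undup_uniq// => a b /addrI.
have us : uniq s by exact: rem_uniq.
have ys : y \notin s by rewrite /s mem_rem_uniqF.
apply: (@le_trans _ _ (nu [set e | openat e t y /\ forall z, z \in s ->
  ~ openat e t z])).
  rewrite open_closed_prob// lee_fin ler_wpM2l//; first exact/ltW/(law_gt0 law).
  have p1 := law_lt1 law; have p0 := law_gt0 law.
  apply: ler_wiXn2l; rewrite ?subr_ge0 ?(ltW p1)//; first by rewrite gerBl ltW.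
  by rewrite (leq_trans (size_subseq (rem_subseq _ _)))// size_map.
apply: le_measure; rewrite ?inE.
- apply: measurableI; first exact: measurable_openat.
  apply: measurable_forall => z.
  apply: (@measurable_imply _ _ [set e | z \in s] (~` [set e | openat e t z])).
    exact: measurable_const.
  by apply: measurableC; exact: measurable_openat.
- by apply: measurableI; exact: discrete_hop.
- move=> e /= [oy cs]; split; apply: hop_isolated => // z zy zny; last first.
    by move: zy; rewrite subrr l1_0 leqn0 => /eqP/l1_eq0/subr0_eq.
  apply: cs; rewrite mem_rem_uniq// inE; apply/andP; split; first exact/eqP.
  apply/mapP; exists (z - x); last by rewrite addrC subrK.
  by apply: mem_l1_ball; exact: leq_trans yr.
Qed.

End drainage_law.

(** * Mirror symmetries *)

Lemma expect_relabel {R : realType} {I : choiceType}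
    (nu : probability (@realfam R I) R) (r : I -> I) (f : realfam -> R) :
  independent_coords nu -> injective r ->
  (forall i A, measurable A -> marginal nu (r i) A = marginal nu i A) ->
  measurable_fun setT f -> intg nu (f \o relabel r) ->
  expect nu (f \o relabel r) = expect nu f.
Proof.
move=> ind rI rM mf intf; rewrite /expect /Rintegral; congr fine.
have mr := @measurable_relabel R I r.
transitivity (\int[pushforward nu (relabel r)]_e (f e)%:E)%E.
  by rewrite integral_pushforward//; exact/measurable_EFinP.
apply: eq_measure_integral => A mA _;
  rewrite -[RHS](relabel_measure ind rI rM mA).
by [].
Qed.

(** Bernoulli's inequality, weakened by [b <= 1] to a multiple of [1 + n]. *)
Lemma bernoulli_ge (R : realFieldType) (b : R) n : 0 <= b <= 1 ->
  b * (1 + n%:R) <= (1 + b) ^+ n.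
Proof.
move=> /andP[b0 b1].
suff : 1 + b * n%:R <= (1 + b) ^+ n by move=> ?; nra.
elim: n => [|n IH]; first by rewrite mulr0 addr0 expr0.
have n0 : 0 <= n%:R :> R by [].
by rewrite exprS -natr1; nra.
Qed.

(** * Moments of a jump, truncated jumps and their mirror images *)

Section jumps.
Context {R : realType} {k : nat}.
Notation env := (@realfam R (key k)).
Context {p : R} {nu : probability env R}.
Hypothesis law : drainage_law p nu.
Implicit Types (e : env) (t : int) (x y z v : site k).

Definition moment6 t x e : R := (1 + (l1 (jump t x e))%:R) ^+ 6.

Lemma measurable_jump t x (f : site k -> R) :
  measurable_fun setT (fun e : env => f (jump t x e)).
Proof. exact: (discrete_measurable_fun f (@discrete_jump _ _ t x)). Qed.

Lemma measurable_jumps t x x' (f : site k -> site k -> R) :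
  measurable_fun setT (fun e : env => f (jump t x e) (jump t x' e)).
Proof.
have dd := discrete_pair (@discrete_jump R _ t x) (@discrete_jump R _ t x').
exact: (discrete_measurable_fun (fun v : site k * site k => f v.1 v.2) dd).
Qed.

Lemma jump_moments (i0 : 'I_k) :
  exists2 C : R, 1 <= C &
    forall t x, intg nu (moment6 t x) /\ expect nu (moment6 t x) <= C.
Proof.
have p0 := law_gt0 law; have p1 := law_lt1 law.
(* By convexity [(1 + b) ^+ 6 <= 1 + 63 * b] on [0, 1], whence [r <= (1 + p) * (1 - p) < 1]: the
   tail of the jump beats the growth of [beta ^+ j]. *)
pose b := p / 63; pose beta := (1 + b) ^+ 6; pose r := beta * (1 - p).
have b0 : 0 < b by rewrite divr_gt0.
have b1 : b <= 1 by rewrite /b; lra.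
have beta_le : beta <= 1 + p.
  have -> : p = 63 * b by rewrite /b; field.
  rewrite /beta (_ : (1 + b) ^+ 6 = ((1 + b) ^+ 2) ^+ 2 * (1 + b) ^+ 2);
    last by ring.
  have h2 : (1 + b) ^+ 2 <= 1 + 3 * b by nra.
  have h20 : 0 <= (1 + b) ^+ 2 by exact: sqr_ge0.
  have h4 : ((1 + b) ^+ 2) ^+ 2 <= 1 + 15 * b by nra.
  have h40 : 0 <= ((1 + b) ^+ 2) ^+ 2 by exact: sqr_ge0.
  by nra.
have beta0 : 0 < beta by rewrite exprn_gt0// addr_gt0.
have q0 : 0 < 1 - p by rewrite subr_gt0.
have r0 : 0 <= r by apply: mulr_ge0; exact: ltW.
have r1 : r < 1 by rewrite /r; nra.
pose c := b^-1 ^+ 6.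
have c0 : 0 <= c by rewrite exprn_ge0// invr_ge0 ltW.
have bound t x : (\int[nu]_e (moment6 t x e)%:E <= (c / (1 - r))%:E)%E.
  pose A j : set env := [set e | (j <= l1 (jump t x e))%N].
  have mA j : measurable (A j).
    exact: (@discrete_pred _ _ _ _ [set v | (j <= l1 v)%N] (@discrete_jump _ _
      t x)).
  (* By [bernoulli_ge], [moment6] is at most the term of this series whose index is the length of
     the jump; the integral of the series is at most a geometric sum of ratio [r]. *)
  pose g j e : \bar R := (c * beta ^+ j * \1_(A j) e)%:E.
  have g0 j e : (0 <= g j e)%E.
    by rewrite lee_fin mulr_ge0// mulr_ge0// exprn_ge0// ltW.
  have mg j : measurable_fun setT (g j).
    by apply/measurable_EFinP; apply: measurable_funM => //;
      exact: measurable_indic.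
  apply: (@le_trans _ _ (\int[nu]_e \sum_(j <oo) g j e)%E).
    apply: ge0_le_integral => //.
    - by move=> e _; rewrite lee_fin exprn_ge0// addr_ge0.
    - apply/measurable_EFinP.
      exact: (measurable_jump t x (fun v => (1 + (l1 v)%:R) ^+ 6)).
    - by apply: ge0_emeasurable_sum.
    - move=> e _; apply: le_trans (nneseries_lim_ge (l1 (jump t x e)).+1 _);
      last by [].
      rewrite big_nat_recr//= -[X in (X <= _)%E]add0e; apply: leeD.
        by apply: sume_ge0 => j _.
      rewrite /g lee_fin indicE mem_set; last by rewrite /A/=.
      rewrite mulr1 /moment6 /c /beta exprVn.
      rewrite mulrC ler_pdivlMr ?exprn_gt0// -exprM mulnC exprM -exprMn.
      have b10 : 0 <= 1 + b by rewrite addr_ge0// ltW.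
      have bern := bernoulli_ge (l1 (jump t x e)) (introT andP (conj (ltW b0)
        b1)).
      rewrite mulrC in bern; apply: lerXn2r bern; rewrite nnegrE ?exprn_ge0//.
      by rewrite mulr_ge0// ltW.
  rewrite integral_nneseries//.
  apply: lime_le.
    by apply: is_cvg_nneseries => n _ _; exact: integral_ge0.
  apply: nearW => n.
  apply: (@le_trans _ _ (\sum_(0 <= j < n) (c * r ^+ j)%:E)%E).
    apply: lee_sum => j _; rewrite /g.
    under eq_integral do rewrite EFinM.
    rewrite ge0_integralZl//; last 2 first.
    - by apply/measurable_EFinP; exact: measurable_indic.
    - by rewrite lee_fin mulr_ge0// exprn_ge0// ltW.
    have -> : (c * r ^+ j)%:E = ((c * beta ^+ j)%:E * ((1 - p) ^+ j)%:E)%E.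
      by rewrite -EFinM /r [(beta * _) ^+ j]exprMn mulrA.
    rewrite integral_indic// setIT.
    apply: lee_wpmul2l; first by rewrite lee_fin mulr_ge0// exprn_ge0// ltW.
    exact: jump_tail.
  rewrite sumEFin lee_fin -mulr_sumr ler_wpM2l//.
  have := @geometric_seriesE R 1 r;
    rewrite lt_eqF// => /(_ isT)/(congr1 (fun f => f n)).
  rewrite /series/= big_mkord => E.
  rewrite big_mkord (eq_bigr (fun j : 'I_n => 1 * r ^+ j)); last by move=> j _;
    rewrite mul1r.
  rewrite E mul1r ler_pdivrMr ?subr_gt0// mulVf ?subr_eq0 1?eq_sym ?lt_eqF//.
  by rewrite gerBl exprn_ge0.
exists (1 + c / (1 - r)).
  by rewrite lerDl divr_ge0// subr_ge0 ltW.
move=> t x.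
have mm : measurable_fun setT (moment6 t x).
  exact: (measurable_jump t x (fun v => (1 + (l1 v)%:R) ^+ 6)).
have int6 : intg nu (moment6 t x).
  apply/integrableP; split; first exact/measurable_EFinP.
  apply: le_lt_trans (ltry (c / (1 - r))); apply: le_trans (bound t x).
  rewrite le_eqVlt; apply/orP; left; apply/eqP; apply: eq_integral => e _.
  by rewrite /= ger0_norm// exprn_ge0// addr_ge0.
split => //; rewrite /expect /Rintegral.
rewrite -[X in _ <= X]/(fine (1 + c / (1 - r))%:E); apply: fine_le => //.
  exact: integrable_fin_num.
by apply: le_trans (bound t x) _; rewrite lee_fin lerDr.
Qed.

Lemma intg_jumps (i0 : 'I_k) t x x' (f : site k -> site k -> R) (c : R) :
  (forall v v', `|f v v'| <= c * ((1 + (l1 v)%:R) ^+ 6 + (1 + (l1 v')%:R) ^+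
    6)) ->
  intg nu (fun e => f (jump t x e) (jump t x' e)).
Proof.
have [C _ mom] := jump_moments i0.
move=> fc; apply: (intg_le (g := fun e =>
  c * (moment6 t x e + moment6 t x' e))).
- exact: measurable_jumps.
- by move=> e; exact: fc.
- by apply: intgZ; apply: intgD; [case: (mom t x)|case: (mom t x')].
Qed.

Lemma jump_prob_lb t x v r : (l1 v <= r)%N ->
  ((p * (1 - p) ^+ size (@l1_ball k r))%:E <= nu [set e | jump t x e = v])%E.
Proof.
move=> vr; have h := @hop_eq_prob _ _ _ _ law t x (x + v) r.
apply: le_trans (h _) _; first by rewrite addrAC subrr add0r.
apply: le_measure; rewrite ?inE.
- by apply: measurableI; exact: discrete_hop.
- exact: discrete_jump.
- by move=> e /= [hx _]; rewrite /jump hx addrAC subrr add0r.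
Qed.

(* Unlike [jump t x], it only depends on the environment at distances from *)
(* [x] allowed by [P].                                                     *)
Definition near_jump (P : pred nat) t x e : site k :=
  if P (l1 (jump t x e)) then jump t x e else 0.

Lemma near_jump_wins (P : pred nat) e t x y : wins e t x y -> P (l1 (y - x)) ->
  near_jump P t x e = y - x.
Proof. by move=> wy Py; rewrite /near_jump /jump (wins_hop wy) Py. Qed.

Lemma near_jump_none (P : pred nat) e t x :
  (forall y, P (l1 (y - x)) -> ~ wins e t x y) -> near_jump P t x e = 0.
Proof.
move=> nw; rewrite /near_jump /jump; case: hopP => [y wy|_].
  by case: ifP => // /nw.
by rewrite subrr if_same.
Qed.

(** As [P] is closed downwards and [sg] preserves the norm, [wins_transport] matches the winners
    allowed by [P] in the two environments; if there is none, both truncated jumps vanish. *)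
Lemma near_jump_transport (P : pred nat) (sg : site k -> site k) e e' t x :
  (forall m n, (m <= n)%N -> P n -> P m) ->
  involutive sg -> (forall v, l1 (sg v) = l1 v) ->
  (forall z, P (l1 (z - x)) ->
     e' (t, inl z) = e (t, inl (x + sg (z - x))) /\
     e' (t, inr (x, z)) = e (t, inr (x, x + sg (z - x)))) ->
  near_jump P t x e' = sg (near_jump P t x e).
Proof.
move=> Pd sgK sgl ee'.
pose rho z := x + sg (z - x).
have rhoB z : rho z - x = sg (z - x) by rewrite /rho addrAC subrr add0r.
have rhoK : involutive rho.
  by move=> z; rewrite /rho -/(rho z) rhoB sgK addrC subrK.
have tr y : P (l1 (y - x)) -> wins e' t x y <-> wins e t x (rho y).
  move=> Py; apply: wins_transport; first by exists rho.
  - by move=> z; rewrite rhoB sgl.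
  - by move=> z zy; apply: ee'; exact: Pd Py.
have [[y [wy Py]]|nw] := pselect (exists y, wins e t x y /\ P (l1 (y - x))).
  rewrite (near_jump_wins wy Py) -rhoB; apply: near_jump_wins.
    by apply/tr; rewrite ?rhoB ?sgl// rhoK.
  by rewrite rhoB sgl.
rewrite !near_jump_none//.
- by apply/esym/l1_eq0; rewrite sgl l1_0.
- by move=> y Py wy; apply: nw; exists y.
- move=> y Py /(tr _ Py) wy; apply: nw; exists (rho y); split=> //.
  by rewrite rhoB sgl.
Qed.

(** Applies [sg] around [x] to exactly the keys read by the truncated jump of [x]: the states near
    [x] at this level and the labels of [x] towards them. Labels of other starting points stay in
    place. *)
Definition mirror (sg : site k ->
  site k) (P : pred nat) t x (q : key k) : key k :=
  match q with
  | (t', inl z) =>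
      if (t' == t) && P (l1 (z - x)) then (t', inl (x + sg (z - x))) else q
  | (t', inr (y, z)) =>
      if [&& t' == t, y == x & P (l1 (z - x))]
      then (t', inr (y, x + sg (z - x))) else q
  end.

Section mirror.
Variables (sg : site k -> site k) (P : pred nat).
Hypotheses (Pd : forall m n, (m <= n)%N -> P n -> P m) (sgK : involutive sg)
  (sgl : forall v, l1 (sg v) = l1 v).

Lemma mirrorK t x : involutive (mirror sg P t x).
Proof.
have rhoB z : x + sg (z - x) - x = sg (z - x) by rewrite addrAC subrr add0r.
move=> [t' [z|[y z]]] /=.
  case: ifP => [tP|/= ->//]; rewrite /= rhoB sgl tP sgK.
  by rewrite addrC subrK.
case: ifP => [tP|/= ->//]; rewrite /= rhoB sgl tP sgK.
by rewrite addrC subrK.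
Qed.

Lemma near_jump_mirror t x e :
  near_jump P t x (relabel (mirror sg P t x) e) = sg (near_jump P t x e).
Proof.
by apply: near_jump_transport => // z Pz; rewrite /relabel /= !eqxx Pz.
Qed.

Lemma expect_mirror t x f : measurable_fun setT f ->
  intg nu (f \o relabel (mirror sg P t x)) ->
  expect nu (f \o relabel (mirror sg P t x)) = expect nu f.
Proof.
apply: expect_relabel; [exact: law_ind law|exact: can_inj (mirrorK t x)|].
move=> [t' [z|[y z]]] A mA /=; case: ifP => _ //.
  exact: law_site law _ _ _ _ _ mA.
exact: law_label law _ _ _ _ _ mA.
Qed.

End mirror.

End jumps.

Section isometries.
Context {k : nat}.
Implicit Types v : site k.

Definition flip (i : 'I_k) v : site k := [ffun m =>
  if m == i then - v m else v m].

Lemma flipK i : involutive (flip i).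
Proof.
by move=> v; apply/ffunP => m; rewrite !ffunE; case: (m == i) => //;
  rewrite opprK.
Qed.

Lemma l1_flip i v : l1 (flip i v) = l1 v.
Proof. by apply: eq_bigr => m _; rewrite ffunE; case: ifP => //;
  rewrite abszN. Qed.

Definition swap_coords (i j : 'I_k) v : site k := [ffun m => v (tperm i j m)].

Lemma swap_coordsK i j : involutive (swap_coords i j).
Proof. by move=> v; apply/ffunP => m; rewrite !ffunE tpermK. Qed.

Lemma l1_swap_coords i j v : l1 (swap_coords i j v) = l1 v.
Proof.
rewrite /l1 [RHS](reindex_inj (@perm_inj _ (tperm i j)))/=.
by apply: eq_bigr => m _; rewrite ffunE.
Qed.

End isometries.

Lemma le_pow6 (R : realFieldType) (u : R) n : 0 <= u -> (n <= 6)%N ->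
  u ^+ n <= (1 + u) ^+ 6.
Proof.
move=> u0 n6; apply: (@le_trans _ _ ((1 + u) ^+ n)).
  by apply: lerXn2r; rewrite ?nnegrE ?lerDr// addr_ge0.
by apply: ler_weXn2l => //; rewrite lerDl.
Qed.

Lemma mul_le_pow6 (R : realFieldType) (a b c d : R) :
  0 <= c -> 0 <= d -> c <= a -> d <= b -> c * d <= (1 + a) ^+ 6 + (1 + b) ^+ 6.
Proof.
move=> c0 d0 ca db.
have a2 : a ^+ 2 <= (1 + a) ^+ 6 by apply: le_pow6 => //; lra.
have b2 : b ^+ 2 <= (1 + b) ^+ 6 by apply: le_pow6 => //; lra.
have : c * d <= a * b by apply: ler_pM.
have := sqr_ge0 (a - b).
by move: a2 b2; rewrite !expr2; move: ((1 + a) ^+ 6) ((1 + b) ^+ 6) => A B; nra.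
Qed.

Lemma mul_sqr_le_pow6 (R : realFieldType) (a b : R) : 0 <= a -> 0 <= b ->
  a ^+ 2 * b + a * b ^+ 2 <= 2 * ((1 + a) ^+ 6 + (1 + b) ^+ 6).
Proof.
move=> a0 b0.
have ha : a ^+ 3 <= (1 + a) ^+ 6 by exact: le_pow6.
have hb : b ^+ 3 <= (1 + b) ^+ 6 by exact: le_pow6.
have a3 : 0 <= a ^+ 3 by rewrite exprn_ge0.
have b3 : 0 <= b ^+ 3 by rewrite exprn_ge0.
have : 0 <= (a + b) * (a - b) ^+ 2 by rewrite mulr_ge0 ?sqr_ge0 ?addr_ge0.
have -> : (a + b) * (a - b) ^+ 2 = a ^+ 3 + b ^+ 3 - (a ^+ 2 * b + a * b ^+ 2)
  by ring.
by move: ((1 + a) ^+ 6) ((1 + b) ^+ 6) ha hb => A B ha hb; lra.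
Qed.

(** * Covariances of one jump and of two distant jumps *)

Section covariances.
Context {R : realType} {k : nat}.
Notation env := (@realfam R (key k)).
Context {p : R} {nu : probability env R}.
Hypothesis law : drainage_law p nu.
Implicit Types (e : env) (t : int) (x y z v : site k) (i j : 'I_k).

Definition coord i v : R := (v i)%:~R.

Lemma coord_le i v : `|coord i v| <= (l1 v)%:R.
Proof.
by rewrite /coord -intr_norm -abszE -pmulrn ler_nat leq_coord_l1.
Qed.

Lemma coordB i v v' : coord i (v - v') = coord i v - coord i v'.
Proof. by rewrite /coord siteB intrB. Qed.

Lemma coord0 i : coord i 0 = 0.
Proof. by rewrite /coord ffunE. Qed.

Lemma coord_flip i v : coord i (flip i v) = - coord i v.
Proof. by rewrite /coord ffunE eqxx intrN. Qed.

Lemma coord_flip_neq i j v : i != j -> coord j (flip i v) = coord j v.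
Proof. by rewrite /coord ffunE eq_sym => /negPf ->. Qed.

Lemma coord_swap i j v : coord i (swap_coords i j v) = coord j v.
Proof. by rewrite /coord ffunE tpermL. Qed.

Definition trunc (P : pred nat) v : site k := if P (l1 v) then v else 0.

Lemma l1_trunc P v : (l1 (trunc P v) <= l1 v)%N.
Proof. by rewrite /trunc; case: ifP => // _; rewrite l1_0. Qed.

Lemma near_jumpT t x : near_jump predT t x =1 @jump R k t x.
Proof. by []. Qed.

Lemma coord_mul_le i j v v' :
  `|coord i v * coord j v'| <= 1 * ((1 + (l1 v)%:R) ^+ 6 + (1 + (l1 v')%:R) ^+
    6).
Proof.
by rewrite mul1r normrM; apply: mul_le_pow6; rewrite // coord_le.
Qed.

Section truncated_mirror.
Variables (sg : site k -> site k) (P : pred nat).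
Hypotheses (Pd : forall m n, (m <= n)%N -> P n -> P m) (sgK : involutive sg)
  (sgl : forall v, l1 (sg v) = l1 v).

(** No site is close to both [x] and [x'], so the mirror around [x] fixes every key that the
    truncated jump of [x'] reads. *)
Lemma expect_near_mirror i j t x x' :
  (forall z, P (l1 (z - x)) -> P (l1 (z - x')) -> False) ->
  expect nu (fun e => coord i (sg (near_jump P t x e)) * coord j (near_jump P t
    x' e)) =
  expect nu (fun e => coord i (near_jump P t x e) * coord j (near_jump P t x'
    e)).
Proof.
move=> xx'; pose f e := coord i (near_jump P t x e) * coord j (near_jump P t x'
  e).
have stable e : near_jump P t x' (relabel (mirror sg P t x) e) = near_jump P t
  x' e.
  apply: (@near_jump_transport _ _ P id) => // z Pz; rewrite /relabel/=.
  have nP : P (l1 (z - x)) = false by apply/negP => /xx'/(_ Pz).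
  rewrite nP andbF [x' + _]addrC subrK; split => //; case: eqP => // xE.
  by rewrite andbF.
have -> : (fun e => coord i (sg (near_jump P t x e)) * coord j (near_jump P t
  x' e)) =
    f \o relabel (mirror sg P t x).
  by apply/funext => e /=; rewrite /f stable near_jump_mirror.
apply: (expect_mirror law) => //.
  exact: (measurable_jumps t x x' (fun v v' =>
    coord i (trunc P v) * coord j (trunc P v'))).
rewrite (_ : f \o _ = fun e => coord i (sg (trunc P (jump t x e))) *
    coord j (trunc P (jump t x' e))).
  apply: (@intg_jumps _ _ _ _ law i t x x'
    (fun v v' => coord i (sg (trunc P v)) * coord j (trunc P v')) 1) => v v'.
  apply: le_trans (coord_mul_le _ _ _ _) _; rewrite !mul1r sgl.
  by apply: lerD; apply: lerXn2r;
    rewrite ?nnegrE ?addr_ge0// lerD2l ler_nat l1_trunc.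
by apply/funext => e /=; rewrite /f stable near_jump_mirror.
Qed.

End truncated_mirror.

Lemma intg_coord i t x : intg nu (fun e => coord i (jump t x e)).
Proof.
apply: (@intg_jumps _ _ _ _ law i t x x (fun v v' => coord i v) 1) => v v'.
rewrite mul1r (le_trans (coord_le _ _))//.
apply: (@le_trans _ _ ((1 + (l1 v)%:R) ^+ 6)); first exact: (@le_pow6 _ _ 1).
by rewrite lerDl exprn_ge0// addr_ge0.
Qed.

Lemma intg_coord_mul i j t x x' :
  intg nu (fun e => coord i (jump t x e) * coord j (jump t x' e)).
Proof.
apply: (@intg_jumps _ _ _ _ law i t x x' (fun v v' =>
  coord i v * coord j v') 1).
by move=> v v'; exact: coord_mul_le.
Qed.

(** With [predT] nothing is truncated and the mirror acts on the whole jump. *)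
Lemma expect_mirror_jump (sg : site k -> site k) t x (f : site k ->
  R) (c : R) (i0 : 'I_k) :
  involutive sg -> (forall v, l1 (sg v) = l1 v) ->
  (forall v, `|f v| <= c * (1 + (l1 v)%:R) ^+ 6) ->
  expect nu (fun e => f (sg (jump t x e))) = expect nu (fun e =>
    f (jump t x e)).
Proof.
move=> sgK sgl fc.
have c0 : 0 <= c.
  have := fc 0; rewrite l1_0 addr0 expr1n mulr1; exact: le_trans.
have H e : f (sg (jump t x e)) = f (jump t x (relabel (mirror sg predT t x) e)).
  by rewrite -!near_jumpT near_jump_mirror.
have -> : (fun e => f (sg (jump t x e))) =
    (fun e => f (jump t x e)) \o relabel (mirror sg predT t x).
  by apply/funext => e /=; rewrite H.
apply: (expect_mirror law) => //; first exact: (measurable_jump t x f).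
rewrite (_ : _ \o _ = fun e => f (sg (jump t x e))); last first.
  by apply/funext => e /=; rewrite H.
apply: (@intg_jumps _ _ _ _ law i0 t x x (fun v v' => f (sg v)) c) => v v'.
by apply: (le_trans (fc _)); rewrite sgl ler_wpM2l// lerDl exprn_ge0.
Qed.

Lemma coord_mul_le1 i j v :
  `|coord i v * coord j v| <= 2 * (1 + (l1 v)%:R) ^+ 6.
Proof. by apply: le_trans (coord_mul_le _ _ _ _) _;
  rewrite mul1r mulr2n mulrDl !mul1r. Qed.

(** Flipping coordinate [i] keeps the law and changes the sign. The same flip kills the mixed
    moments below, and a swap of coordinates equates the variances. *)
Lemma expect_coord i t x : expect nu (fun e => coord i (jump t x e)) = 0.
Proof.
have := @expect_mirror_jump (flip i) t x (coord i) 1 i (@flipK _ i) (@l1_flip _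
  i).
have b v : `|coord i v| <= 1 * (1 + (l1 v)%:R) ^+ 6.
  apply: le_trans (coord_le _ _) _; rewrite mul1r.
  exact: (@le_pow6 _ _ 1).
move=> /(_ b); under eq_expect do rewrite coord_flip -mulN1r.
by rewrite expectZ; [lra|exact: intg_coord].
Qed.

Lemma expect_coord_mul i j t x : i != j ->
  expect nu (fun e => coord i (jump t x e) * coord j (jump t x e)) = 0.
Proof.
move=> ij; have := @expect_mirror_jump (flip i) t x (fun v =>
  coord i v * coord j v)
  2 i (@flipK _ i) (@l1_flip _ i) (@coord_mul_le1 i j).
under eq_expect do rewrite coord_flip coord_flip_neq// mulNr -mulN1r.
by rewrite expectZ; [lra|exact: intg_coord_mul].
Qed.

Lemma expect_coord_sqr i j t x :
  expect nu (fun e => coord i (jump t x e) * coord i (jump t x e)) =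
  expect nu (fun e => coord j (jump t x e) * coord j (jump t x e)).
Proof.
have := @expect_mirror_jump (swap_coords i j) t x (fun v =>
  coord i v * coord i v)
  2 i (@swap_coordsK _ i j) (@l1_swap_coords _ i j) (@coord_mul_le1 i i).
by under eq_expect do rewrite coord_swap.
Qed.

(** The unit jump along axis [i] alone contributes this much. The bound is uniform in the site. *)
Lemma expect_coord_sqr_lb i t x :
  p * (1 - p) ^+ size (@l1_ball k 1) <=
  expect nu (fun e => coord i (jump t x e) * coord i (jump t x e)).
Proof.
pose v := axis i 1.
have mA : measurable [set e : env | jump t x e = v] by exact: discrete_jump.
apply: (@le_trans _ _ (expect nu (\1_[set e | jump t x e = v]))).
  rewrite expect_indic// -lee_fin fineK ?fin_num_measure//.
  by apply: jump_prob_lb; rewrite // l1_axis.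
apply: expect_le; [exact: intg_indic|exact: intg_coord_mul|].
move=> e; rewrite indicE; case: (boolP (e \in _)) => [|_].
  by rewrite inE/= => ->; rewrite /coord ffunE eqxx mulr1.
by rewrite -expr2 sqr_ge0.
Qed.

Lemma expect_coord_sqr_ub : exists C : R, forall i t x,
  expect nu (fun e => coord i (jump t x e) * coord i (jump t x e)) <= C.
Proof.
have [[i0 _]|nok] := pselect (exists i : 'I_k, True); last first.
  by exists 0 => i; case: nok; exists i.
have [C C1 mom] := jump_moments law i0.
exists (2 * C) => i t x; have [int6 e6] := mom t x.
apply: (@le_trans _ _ (expect nu (fun e => 2 * moment6 t x e))).
  apply: expect_le; [exact: intg_coord_mul|exact: intgZ|].
  by move=> e; apply: le_trans (ler_norm _) (coord_mul_le1 _ _ _).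
by rewrite expectZ// ler_wpM2l.
Qed.

(* Jumps from distant sites are nearly uncorrelated: cut off at half the *)
(* distance, one of them can be mirrored without moving the other.       *)
Lemma expect_coord_cross : exists C : R, forall i j t x x', x <> x' ->
  `|expect nu (fun e => coord i (jump t x e) * coord j (jump t x' e))| <=
  C / (l1 (x - x'))%:R.
Proof.
have [[i0 _]|nok] := pselect (exists i : 'I_k, True); last first.
  by exists 0 => i; case: nok; exists i.
have [C C1 mom] := jump_moments law i0.
exists (8 * C) => i j t x x' xx'.
pose D := l1 (x - x'); pose P : pred nat := fun n => (n.*2 < D)%N.
have D0 : (0 < D)%N by rewrite lt0n; apply/eqP => /l1_eq0/subr0_eq.
have DR0 : 0 < D%:R :> R by rewrite ltr0n.
have Pd m n : (m <= n)%N -> P n -> P m by rewrite /P; lia.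
have disj z : P (l1 (z - x)) -> P (l1 (z - x')) -> False.
  rewrite /P /D => h h'; have := l1_triangle x z x'; rewrite [l1 (x - z)]l1B;
    lia.
pose psi y v v' := coord i (trunc P v) * coord j (trunc P v').
pose f e := coord i (jump t x e) * coord j (jump t x' e).
pose g e := coord i (trunc P (jump t x e)) * coord j (trunc P (jump t x' e)).
have intf : intg nu f by exact: intg_coord_mul.
have intg_g : intg nu g.
  apply: (@intg_jumps _ _ _ _ law i t x x'
    (fun v v' => coord i (trunc P v) * coord j (trunc P v')) 1) => v v'.
  apply: le_trans (coord_mul_le _ _ _ _) _; rewrite !mul1r.
  by apply: lerD; apply: lerXn2r;
    rewrite ?nnegrE ?addr_ge0// lerD2l ler_nat l1_trunc.
(* Mirroring the truncated jump of [x] by a flip changes the sign of [g], so its mean is its own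
   opposite. *)
have Eg : expect nu g = 0.
  have := @expect_near_mirror (flip i) P Pd (@flipK _ i) (@l1_flip _ i) i j t x
    x' disj.
  rewrite -[X in _ = X]/(expect nu g).
  under eq_expect do rewrite coord_flip mulNr -mulN1r.
  by rewrite -[X in expect nu X]/(fun e => -1 * g e) expectZ//; lra.
have -> : expect nu f = expect nu (fun e => f e + -1 * g e).
  by rewrite expectD//; [rewrite expectZ// Eg mulr0 addr0|exact: intgZ].
have [int6 e6] := mom t x; have [int6' e6'] := mom t x'.
apply: (@le_trans _ _ (expect nu (fun e =>
  (4 / D%:R) * (moment6 t x e + moment6 t x' e)))).
  apply: expect_abs; [by apply: intgD => //; exact: intgZ| |].
    by apply: intgZ; exact: intgD.
  move=> e; rewrite /f /g mulN1r /moment6.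
  move: (jump t x e) (jump t x' e) => v v'.
  (* A jump is cut only if [D <= 2 * l1 w], and then [l1 w] is at most [2 / D] times its square. *)
  have tr m w : `|coord m w - coord m (trunc P w)| <= (2 / D%:R) * (l1 w)%:R ^+
    2.
    rewrite /trunc; case: ifPn => [_|];
      first by rewrite subrr normr0 mulr_ge0// divr_ge0.
    rewrite /P -leqNgt coord0 subr0 => Dw; apply: le_trans (coord_le _ _) _.
    rewrite mulrAC ler_pdivlMr// expr2 mulrA [X in X <= _]mulrC ler_wpM2r//.
    by rewrite -natrM ler_nat mul2n.
  have -> : coord i v * coord j v' - coord i (trunc P v) * coord j (trunc P v')
    =
      (coord i v - coord i (trunc P v)) * coord j v' +
      coord i (trunc P v) * (coord j v' - coord j (trunc P v')) by ring.
  apply: (le_trans (ler_normD _ _)); rewrite !normrM.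
  have h1 := tr i v; have h2 := tr j v'; have h3 := coord_le j v'.
  have h4 : `|coord i (trunc P v)| <= (l1 v)%:R.
    by apply: le_trans (coord_le _ _) _; rewrite ler_nat l1_trunc.
  have a0 : 0 <= (l1 v)%:R :> R by [].
  have b0 : 0 <= (l1 v')%:R :> R by [].
  apply: (@le_trans _ _ ((2 / D%:R) * ((l1 v)%:R ^+ 2 * (l1 v')%:R) +
    (2 / D%:R) * ((l1 v)%:R * (l1 v')%:R ^+ 2))).
    apply: lerD; first by rewrite mulrA; apply: ler_pM.
    by rewrite mulrCA; apply: ler_pM.
  rewrite -mulrDr (_ : 4 / D%:R = (2 / D%:R) * 2); last by field;
    rewrite gt_eqF.
  rewrite -[X in _ <= X]mulrA ler_wpM2l ?divr_ge0//.
  exact: mul_sqr_le_pow6.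
rewrite expectZ; last exact: intgD.
rewrite expectD// [X in X <= _]mulrAC ler_pM2r ?invr_gt0//; lra.
Qed.

End covariances.

(** * Logarithmic estimates *)

Section logarithm_derivative.
Import numFieldNormedType.Exports.
Context {R : realType}.
Implicit Types (x a b c : R).

(** Up to a constant, this is [ln] minus its Taylor polynomial of order 2 at 1, minus a cubic term.
    The sign of the derivative is that of [x^-1 - 3 * a]: [a = 0] bounds the remainder on one side,
    [a = 2 / 3] on the other for [x >= 1 / 2]. *)
Lemma is_derive_ln_taylor2 a x : 0 < x ->
  is_derive x 1 (fun u : R => ln u - 2 * u + u ^+ 2 / 2 - a * (u - 1) ^+ 3)
    ((x - 1) ^+ 2 * (x^-1 - 3 * a)).
Proof.
move=> x0; have dln := is_derive1_ln x0.
apply: is_derive_eq; rewrite /GRing.scale/=.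
by field; rewrite gt_eqF.
Qed.

Lemma ln_taylor2_mvt a b c : 0 < b -> b <= c ->
  exists2 x, b <= x <= c &
    ln c - ln b = 2 * (c - b) - (c ^+ 2 - b ^+ 2) / 2 +
      a * ((c - 1) ^+ 3 - (b - 1) ^+ 3) +
      (x - 1) ^+ 2 * (x^-1 - 3 * a) * (c - b).
Proof.
move=> b0 bc; pose f := fun u : R =>
  ln u - 2 * u + u ^+ 2 / 2 - a * (u - 1) ^+ 3.
have [||x] := @MVT_segment R f (fun x => (x - 1) ^+ 2 * (x^-1 - 3 * a)) b c bc.
- move=> x; rewrite in_itv/= => /andP[bx _]; apply: is_derive_ln_taylor2.
  exact: lt_trans bx.
- apply: derivable_within_continuous => x; rewrite in_itv/= => /andP[bx _].
  by have [] := is_derive_ln_taylor2 a (lt_le_trans b0 bx).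
rewrite in_itv/= /f/= => xbc E; exists x => //; rewrite -E; ring.
Qed.

End logarithm_derivative.

Section logarithm_estimates.
Context {R : realType}.
Implicit Types (x y a L : R).

Lemma ln1D_ge y : 0 <= y -> y - y ^+ 2 / 2 <= ln (1 + y).
Proof.
move=> y0; have [||x /andP[x1 _]] := @ln_taylor2_mvt R 0 1 (1 + y); [lra|lra|].
have x0 : 0 < x by lra.
rewrite ln1 => E.
have xV : 0 <= x^-1 - 3 * 0 by rewrite mulr0 subr0 invr_ge0 ltW.
have : 0 <= (x - 1) ^+ 2 * (x^-1 - 3 * 0) * (1 + y - 1).
  by apply: mulr_ge0; [apply: mulr_ge0 => //; exact: sqr_ge0|lra].
by rewrite subr0 in E; lra.
Qed.

Lemma ln1D_le y : -1 < y -> y <= 0 -> ln (1 + y) <= y - y ^+ 2 / 2.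
Proof.
move=> y1 y0; have [||x /andP[x1 _]] := @ln_taylor2_mvt R 0 (1 + y) 1;
  [lra|lra|].
have x0 : 0 < x by lra.
rewrite ln1 => E.
have xV : 0 <= x^-1 - 3 * 0 by rewrite mulr0 subr0 invr_ge0 ltW.
have : 0 <= (x - 1) ^+ 2 * (x^-1 - 3 * 0) * (1 - (1 + y)).
  by apply: mulr_ge0; [apply: mulr_ge0 => //; exact: sqr_ge0|lra].
lra.
Qed.

Lemma ln1D_taylor2 y : -1 / 2 <= y ->
  `|ln (1 + y) - (y - y ^+ 2 / 2)| <= `|y| ^+ 3.
Proof.
move=> y2; have [y0|/ltW y0] := leP 0 y.
  rewrite (ger0_norm y0) ger0_norm; last by have := ln1D_ge y0; lra.
  have [||x /andP[x1 _]] := @ln_taylor2_mvt R (2 / 3) 1 (1 + y); [lra|lra|].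
  have xV : x^-1 <= 1 by rewrite invf_le1//; lra.
  rewrite ln1 => E.
  have : 0 <= (x - 1) ^+ 2 * (3 * (2 / 3) - x^-1) * (1 + y - 1).
    by apply: mulr_ge0; [apply: mulr_ge0; [exact: sqr_ge0|lra]|lra].
  have y3 : 0 <= y ^+ 3 by rewrite exprn_ge0.
  lra.
have y1 : -1 < y by lra.
rewrite (ler0_norm y0) ler0_norm; last by have := ln1D_le y1 y0; lra.
have [||x /andP[x1 xb]] := @ln_taylor2_mvt R (2 / 3) (1 + y) 1; [lra|lra|].
have xV : x^-1 <= 2 by rewrite -[leRHS]invrK lef_pV2 ?posrE; lra.
rewrite ln1 => E.
have : 0 <= (x - 1) ^+ 2 * (3 * (2 / 3) - x^-1) * (1 - (1 + y)).
  by apply: mulr_ge0; [apply: mulr_ge0; [exact: sqr_ge0|lra]|lra].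
have y3 : 0 <= (- y) ^+ 3 by rewrite exprn_ge0//; lra.
lra.
Qed.

Lemma ln1D_upper y : -1 < y -> ln (1 + y) <= y - y ^+ 2 / 2 + `|y| ^+ 3.
Proof.
move=> y1; have [y0|/ltW y0] := leP 0 y.
  by have := @ln1D_taylor2 y; rewrite ler_norml => /(_ _)/andP[|_]; lra.
have := ln1D_le y1 y0; have : 0 <= `|y| ^+ 3 by rewrite exprn_ge0.
lra.
Qed.

(* [L] is the logarithm of [1 + s], and [y] is the relative increment of *)
(* [1 + s]: the new logarithm [L + ln (1 + y)] is still nonnegative.      *)
Lemma ln1D_abs L y : 0 <= L -> -1 < y -> 0 <= L + ln (1 + y) ->
  `|ln (1 + y)| <= 2 * `|y| * (1 + L).
Proof.
move=> L0 y1.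
have ly : ln (1 + y) <= y by exact: le_ln1Dx.
have tl : -1 / 2 <= y -> - `|y| ^+ 3 <= ln (1 + y) - (y - y ^+ 2 / 2).
  by move=> /ln1D_taylor2; rewrite ler_norml => /andP[].
have l0 : 0 <= y -> 0 <= ln (1 + y) by move=> y0; rewrite ln_ge0//; lra.
rewrite ler_norml.
move: (ln _) ly tl l0 => l ly tl l0 Ll.
have yy := ler_norm y; have yN := ler_norm (- y); rewrite normrN in yN.
have a0 : 0 <= `|y| by [].
have aE : y <= 0 -> `|y| = - y by move=> y0; rewrite ler0_norm.
move: (`|y| : R) yy yN a0 aE tl => a yy yN a0 aE tl.
have yL : 0 <= a * L by rewrite mulr_ge0.
apply/andP; split; last by nra.
have [y2|y2] := leP (-1 / 2) y; last by nra.
have [y0|/ltW y0] := leP 0 y; first by have := l0 y0; nra.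
have := tl y2; rewrite aE//; rewrite aE// in yL.
have -> : (- y) ^+ 3 = (- y) * (y * y) by ring.
rewrite expr2; nra.
Qed.

Lemma abs_ge_half y : y < -1 / 2 -> 1 <= 8 * `|y| ^+ 3.
Proof.
move=> y2; rewrite ltr0_norm; last by lra.
have -> : 8 * (- y) ^+ 3 = (2 * - y) ^+ 3 by ring.
by apply: exprn_ege1; lra.
Qed.

(** For [y >= -1 / 2] this is Taylor's bound. Below, the logarithm is only known to be at least
    [- L], and [1 <= 8 * |y| ^ 3] absorbs it: hence the factor [1 + L]. *)
Lemma ln1D_expand1 L y : 0 <= L -> -1 < y -> 0 <= L + ln (1 + y) ->
  `|ln (1 + y) - (y - y ^+ 2 / 2)| <= 8 * (1 + L) * `|y| ^+ 3.
Proof.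
move=> L0 y1.
have := @abs_ge_half y; have := @ln1D_taylor2 y; have := ln1D_le y1.
have : 0 <= `|y| ^+ 3 by rewrite exprn_ge0.
move: (ln _) (`|y| ^+ 3 : R) => l c c0 ly t2 c8 Ll.
have Lc : 0 <= L * c by rewrite mulr_ge0.
have [y2|y2] := leP (-1 / 2) y; first by have := t2 y2; lra.
have {}c8 := c8 y2; have {}ly : l <= y - y ^+ 2 / 2 by apply: ly; lra.
rewrite ler0_norm; last by lra.
have : L * 1 <= L * (8 * c) by rewrite ler_wpM2l.
have : y - y ^+ 2 / 2 <= 0 by rewrite expr2; nra.
lra.
Qed.

Lemma ln1D_expand2 L y : 0 <= L -> -1 < y -> 0 <= L + ln (1 + y) ->
  `|ln (1 + y) ^+ 2 - y ^+ 2| <= 8 * (1 + L) ^+ 2 * `|y| ^+ 3.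
Proof.
move=> L0 y1.
have t2 := @ln1D_taylor2 y; have lle := ln1D_le y1; have lge := @ln1D_ge y.
have c8 := @abs_ge_half y; have ly : ln (1 + y) <= y by exact: le_ln1Dx.
have l0 : 0 <= y -> 0 <= ln (1 + y) by move=> y0; rewrite ln_ge0//; lra.
have c0 : 0 <= `|y| ^+ 3 by rewrite exprn_ge0.
have cp : 0 <= y -> `|y| ^+ 3 = y * y ^+ 2.
  by move=> y0; rewrite ger0_norm//; ring.
have cn : y <= 0 -> `|y| ^+ 3 = - y * y ^+ 2.
  by move=> y0; rewrite ler0_norm//; ring.
move: (ln _) (`|y| ^+ 3 : R) t2 lle lge c8 ly l0 c0 cp cn.
move=> l c t2 lle lge c8 ly l0 c0 cp cn Ll.
have Lc : 0 <= L * c by rewrite mulr_ge0.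
have L2c : 0 <= L ^+ 2 * c by rewrite mulr_ge0// sqr_ge0.
have y20 := sqr_ge0 y.
have [y2|y2] := leP (-1 / 2) y; last first.
  have {}c8 := c8 y2.
  have lL : `|l| <= L by rewrite ler0_norm; lra.
  have l2 : l ^+ 2 <= L ^+ 2 by rewrite -real_normK ?num_real// lerXn2r ?nnegrE.
  have ly2 : y ^+ 2 <= l ^+ 2 by rewrite !expr2; nra.
  rewrite ger0_norm; last by lra.
  have : L ^+ 2 * 1 <= L ^+ 2 * (8 * c) by rewrite ler_wpM2l// sqr_ge0.
  have -> : 8 * (1 + L) ^+ 2 * c = 8 * c + 16 * (L * c) + L ^+ 2 * (8 * c) by
    ring.
  lra.
suff : `|l ^+ 2 - y ^+ 2| <= 8 * c.
  have -> : 8 * (1 + L) ^+ 2 * c = 8 * c + 16 * (L * c) + 8 * (L ^+ 2 * c) by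
    ring.
  lra.
have -> : l ^+ 2 - y ^+ 2 = (l - y) * (l + y) by ring.
rewrite normrM.
have [y0|/ltW y0] := leP 0 y.
  have {}l0 := l0 y0; have {}lge := lge y0; have {}cp := cp y0.
  rewrite ler0_norm; last by lra.
  rewrite ger0_norm; last by lra.
  apply: (@le_trans _ _ (y ^+ 2 / 2 * (2 * y))); first by apply: ler_pM; lra.
  by rewrite cp; have : 0 <= y * y ^+ 2 by [rewrite mulr_ge0]; lra.
have {}cn := cn y0; have c_le : c <= y ^+ 2 / 2 by rewrite cn; nra.
have := t2 y2; rewrite ler_norml => /andP[t3 t3'].
rewrite ler0_norm; last by lra.
rewrite ler0_norm; last by lra.
apply: (@le_trans _ _ (y ^+ 2 * (4 * - y))).
  apply: ler_pM; [lra|lra|lra|].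
  by rewrite expr2 in t3 c_le; nra.
by rewrite cn; have : 0 <= - y * y ^+ 2 by [rewrite mulr_ge0//; lra]; lra.
Qed.

Section log_ratio.
Variables L y : R.
Hypotheses (L0 : 0 <= L) (y1 : -1 < y) (Ly : 0 <= L + ln (1 + y)).
(** The relative increment of [1 + L] (see [ratioE]). Dividing by [1 + L] cancels the factors of the
    previous bounds, so the errors below do not depend on [L]. *)
Let q := ln (1 + y) / (1 + L).

Let L1 : 0 < 1 + L. Proof. by rewrite ltr_pwDl. Qed.

Lemma ratio_abs : `|q| ^+ 3 <= 8 * `|y| ^+ 3.
Proof.
have -> : 8 * `|y| ^+ 3 = (2 * `|y|) ^+ 3 by ring.
apply: lerXn2r; rewrite ?nnegrE ?mulr_ge0//.
by rewrite /q normrM normfV (gtr0_norm L1) ler_pdivrMr// ln1D_abs.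
Qed.

Lemma ratio_expand1 : `|q - (y - y ^+ 2 / 2) / (1 + L)| <= 8 * `|y| ^+ 3.
Proof.
rewrite /q -mulrBl normrM normfV (gtr0_norm L1) ler_pdivrMr//.
by rewrite [leRHS]mulrAC; exact: ln1D_expand1.
Qed.

Lemma ratio_expand2 : `|q ^+ 2 - y ^+ 2 / (1 + L) ^+ 2| <= 8 * `|y| ^+ 3.
Proof.
have L2 : 0 < (1 + L) ^+ 2 by rewrite exprn_gt0.
rewrite /q exprMn exprVn -mulrBl normrM normfV (gtr0_norm L2) ler_pdivrMr//.
by rewrite [leRHS]mulrAC; exact: ln1D_expand2.
Qed.

Lemma ratio_gt : - 1 < q.
Proof.
rewrite /q ltr_pdivlMr// mulN1r -subr_gt0 opprK addrCA.
by rewrite ltr_pwDl// addrC.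
Qed.

Lemma ratioE : 1 + (L + ln (1 + y)) = (1 + L) * (1 + q).
Proof. by rewrite /q; field; rewrite gt_eqF. Qed.

End log_ratio.

(** Expand [ln (1 + q)] to second order, then [q] and [q ^+ 2] in [y]; the three errors are 8, 8 / 2
    and 8 times [|y| ^ 3]. *)
Lemma lnln_increment L y : 0 <= L -> -1 < y -> 0 <= L + ln (1 + y) ->
  ln (1 + (L + ln (1 + y))) <=
  ln (1 + L) + (y - y ^+ 2 / 2) / (1 + L) - y ^+ 2 / (1 + L) ^+ 2 / 2 +
    20 * `|y| ^+ 3.
Proof.
move=> L0 y1 Ly; have q1 := ratio_gt L0 Ly; have L1 : 0 < 1 + L by lra.
have := ratio_expand1 L0 y1 Ly; have := ratio_expand2 L0 y1 Ly.
have := ratio_abs L0 y1 Ly; have := ln1D_upper q1.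
rewrite (ratioE y L0) lnM ?posrE//; last by lra.
move: (ln (1 + y) / (1 + L)) ((y - y ^+ 2 / 2) / (1 + L)) => q a.
move: (y ^+ 2 / (1 + L) ^+ 2) (`|y| ^+ 3) (`|q| ^+ 3) (ln (1 + q)) => b c d l.
rewrite !ler_norml => h1 h0 /andP[h2 h3] /andP[h4 h5]; lra.
Qed.

Lemma invln_increment L y : 0 <= L -> -1 < y -> 0 <= L + ln (1 + y) ->
  (1 + (L + ln (1 + y)))^-1 <=
  (1 + L)^-1 * (1 - (y - y ^+ 2 / 2) / (1 + L) + y ^+ 2 / (1 + L) ^+ 2 +
    24 * (1 + L) * `|y| ^+ 3).
Proof.
move=> L0 y1 Ly; have q1 := ratio_gt L0 Ly; have L1 : 0 < 1 + L by lra.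
have h1 := ratio_expand1 L0 y1 Ly; have h2 := ratio_expand2 L0 y1 Ly.
have h3 := ratio_abs L0 y1 Ly; have qE := ratioE y L0.
rewrite qE invfM ler_wpM2l ?invr_ge0 ?(ltW L1)//.
have {Ly}Ly : 1 <= 1 + (L + ln (1 + y)) by lra.
rewrite {}qE in Ly.
have : 0 <= `|y| ^+ 3 by rewrite exprn_ge0.
move: (ln (1 + y) / (1 + L)) ((y - y ^+ 2 / 2) / (1 + L))
  (y ^+ 2 / (1 + L) ^+ 2) (`|y| ^+ 3) Ly h1 h2 h3 q1 =>
    q a b c qL h1 h2 h3 q1 c0; have q10 : 0 < 1 + q by lra.
have -> : (1 + q)^-1 = 1 - q + q ^+ 2 - q ^+ 3 / (1 + q).
  by field; rewrite gt_eqF.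
have Lc : 0 <= L * c by rewrite mulr_ge0.
(* The new logarithm is nonnegative, so [(1 + q)^-1 <= 1 + L]; this is the source of the factor
   [1 + L] in the error. *)
have : - (q ^+ 3 / (1 + q)) <= 8 * c * (1 + L).
  apply: (@le_trans _ _ (`|q| ^+ 3 / (1 + q))).
    rewrite -mulNr ler_pM2r ?invr_gt0// -normrX.
    by rewrite -[leRHS]normrN ler_norm.
  apply: ler_pM; rewrite ?exprn_ge0 ?invr_ge0 ?(ltW q10)//.
  by rewrite -[leLHS]mul1r ler_pdivrMr.
move: h1 h2; rewrite !ler_norml => /andP[h4 h5] /andP[h6 h7].
move: (q ^+ 3 / (1 + q)) => z; lra.
Qed.

(** With [r = expR (L / 8)], the left side is at most [64 * r ^+ 2] and the right side is
    [a * r ^+ 4]. It makes errors of relative size [expR (- L / 2)] negligible against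
    [(1 + L) ^- 2]. *)
Lemma ln_growth a : 0 < a -> exists L0, forall L, L0 <= L ->
  (1 + L) ^+ 2 <= a * expR (L / 2).
Proof.
move=> a0; exists (8 * (64 / a) + 8) => L LL.
have a64 : 0 < 64 / a by rewrite divr_gt0.
pose r := expR (L / 8).
have rL : 1 + L / 8 <= r by exact: expR_ge1Dx.
have -> : expR (L / 2) = r ^+ 4.
  by rewrite /r -expRM_natl; congr expR; field.
have r1 : 1 <= r by lra.
have ra : 64 <= a * r.
  have : 64 / a <= r by lra.
  by rewrite ler_pdivrMr// mulrC.
apply: (@le_trans _ _ ((8 * r) ^+ 2)).
  by apply: lerXn2r; rewrite ?nnegrE; lra.
have -> : (8 * r) ^+ 2 = 64 * r ^+ 2 by ring.
have -> : a * r ^+ 4 = a * r * r * r ^+ 2 by ring.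
rewrite ler_wpM2r ?sqr_ge0//; nra.
Qed.

End logarithm_estimates.

(** * Increments of the squared norm and second-order expansions *)

Section quadratic_increment.
Context {R : realType} {k : nat}.
Implicit Types v w : site k.
Local Notation coord := (@coord R k).

Definition sqn v : R := \sum_i coord i v ^+ 2.
Definition dot v w : R := \sum_i coord i v * coord i w.
Definition lg v : R := ln (1 + sqn v).
(** The square root of [1 + sqn v] (see [scale_sqr]), in the form that [ln_growth] handles. *)
Definition scale v : R := expR (lg v / 2).

Lemma sqn_ge0 v : 0 <= sqn v.
Proof. by apply: sumr_ge0 => i _; exact: sqr_ge0. Qed.

Lemma lg_ge0 v : 0 <= lg v.
Proof. by rewrite ln_ge0// lerDl sqn_ge0. Qed.

Lemma scale_sqr v : scale v ^+ 2 = 1 + sqn v.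
Proof.
rewrite /scale -expRM_natl mulrC divfK// lnK// posrE.
by rewrite ltr_pwDl// sqn_ge0.
Qed.

Lemma scale_ge1 v : 1 <= scale v.
Proof. by rewrite /scale -expR0 ler_expR divr_ge0// lg_ge0. Qed.

Lemma sqnD v w : sqn (v + w) = sqn v + 2 * dot v w + sqn w.
Proof.
rewrite /sqn /dot mulr_sumr -!big_split/=; apply: eq_bigr => i _.
by rewrite /coord ffunE intrD; ring.
Qed.

Lemma coord_le_scale i v : `|coord i v| <= scale v.
Proof.
rewrite -(@ler_pXn2r _ 2)// ?nnegrE ?(le_trans ler01 (scale_ge1 v))//.
rewrite scale_sqr real_normK ?num_real// /sqn (bigD1 i)//=.
rewrite addrCA lerDl addr_ge0// sumr_ge0// => j _; exact: sqr_ge0.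
Qed.

Lemma sum_coord v : \sum_i `|coord i v| = (l1 v)%:R.
Proof.
rewrite /l1 natr_sum; apply: eq_bigr => i _.
by rewrite /coord -intr_norm -abszE -pmulrn.
Qed.

Lemma dot_le v w : `|dot v w| <= scale v * (l1 w)%:R.
Proof.
rewrite -sum_coord mulr_sumr; apply: (le_trans (ler_norm_sum _ _ _)).
by apply: ler_sum => i _; rewrite normrM ler_wpM2r// coord_le_scale.
Qed.

Lemma sqn_le v : sqn v <= (l1 v)%:R ^+ 2.
Proof.
rewrite expr2 -{1}sum_coord mulr_suml; apply: ler_sum => i _.
by rewrite -real_normK ?num_real// expr2 ler_wpM2l// coord_le.
Qed.

Lemma l1_le_sqn v : (l1 v)%:R <= sqn v.
Proof.
rewrite -sum_coord; apply: ler_sum => i _.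
rewrite /coord -intr_norm -rmorphXn ler_int /=; nia.
Qed.

Lemma scale_le_l1 v : v != 0 -> scale v <= 2 * (l1 v)%:R.
Proof.
move=> v0; have v1 : 1 <= (l1 v)%:R :> R.
  by rewrite ler1n lt0n; apply: contra_neq v0; exact: l1_eq0.
rewrite -(@ler_pXn2r _ 2)// ?nnegrE ?mulr_ge0 ?(le_trans ler01 (scale_ge1 v))//.
rewrite scale_sqr; have := sqn_le v.
move: (sqn v) ((l1 v)%:R : R) v1 => s n n1; rewrite exprMn !expr2; nra.
Qed.

Lemma pow6_add (a b : R) : 0 <= a -> 0 <= b ->
  (1 + (a + b)) ^+ 6 <= 64 * ((1 + a) ^+ 6 + (1 + b) ^+ 6).
Proof.
move=> a0 b0.
have h c : 0 <= c -> a <= c -> b <= c ->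
  (1 + (a + b)) ^+ 6 <= 64 * (1 + c) ^+ 6.
  move=> c0 ac bc.
  have -> : 64 * (1 + c) ^+ 6 = (2 * (1 + c)) ^+ 6 by ring.
  by apply: lerXn2r; rewrite ?nnegrE; lra.
have a6 : 0 <= (1 + a) ^+ 6 by rewrite exprn_ge0// addr_ge0.
have b6 : 0 <= (1 + b) ^+ 6 by rewrite exprn_ge0// addr_ge0.
have [ab|/ltW ba] := leP a b.
  by have := h b b0 ab (lexx _); move: (_ ^+ 6) (_ ^+ 6) (_ ^+ 6) a6 b6 => *;
    lra.
by have := h a a0 (lexx _) ba; move: (_ ^+ 6) (_ ^+ 6) (_ ^+ 6) a6 b6 => *; lra.
Qed.

Definition moments v v' : R := (1 + (l1 v)%:R) ^+ 6 + (1 + (l1 v')%:R) ^+ 6.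

Section increment.
Variables w v v' : site k.
Let z := v - v'.
(** The relative increment of [1 + sqn w] when [z] is added to [w], as [lgD] uses it. *)
Let y := (2 * dot w z + sqn z) / scale w ^+ 2.

Let sg0 : 0 < scale w. Proof. exact: lt_le_trans (scale_ge1 w). Qed.

Let n := 1 + ((l1 v)%:R + (l1 v')%:R) : R.

Let z_le : (l1 z)%:R <= n - 1.
Proof.
rewrite /n addrAC subrr add0r -natrD ler_nat.
by have := l1D v (- v'); rewrite l1N.
Qed.

Lemma increment_gt : -1 < y.
Proof.
rewrite /y ltr_pdivlMr ?exprn_gt0// scale_sqr mulN1r ltrNl -subr_gt0.
have := sqn_ge0 (w + z); rewrite sqnD; lra.
Qed.

Lemma lgD : lg (w + z) = lg w + ln (1 + y).
Proof.
have y1 := increment_gt.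
rewrite /lg -lnM ?posrE; first last.
- by rewrite -ltrBlDl sub0r.
- by rewrite ltr_pwDl// sqn_ge0.
congr ln; rewrite -[in RHS](scale_sqr w).
transitivity (scale w ^+ 2 + (2 * dot w z + sqn z)).
  by rewrite scale_sqr sqnD; ring.
by rewrite /y; field; rewrite gt_eqF.
Qed.

Let n1 : 1 <= n. Proof. by rewrite lerDl addr_ge0. Qed.

Let n6 : n ^+ 6 <= 64 * moments v v'.
Proof. by apply: pow6_add. Qed.

Let dotn : `|dot w z| <= scale w * (n - 1).
Proof. by apply: le_trans (dot_le _ _) _; rewrite ler_wpM2l// ltW. Qed.

Let sqnn : sqn z <= (n - 1) ^+ 2.
Proof.
apply: le_trans (sqn_le _) _; rewrite lerXn2r// nnegrE//.
exact: le_trans z_le.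
Qed.

(** Since [dot w z] is at most [scale w * (n - 1)] and [sqn z] at most [(n - 1) ^+ 2], [|y|] is at
    most [n ^+ 2 / scale w]. Its cube explains the sixth moments. *)
Lemma increment_cube : `|y| ^+ 3 <= 64 * moments v v' / scale w ^+ 3.
Proof.
apply: (@le_trans _ _ ((n ^+ 2 / scale w) ^+ 3)); last first.
  by rewrite exprMn exprVn -exprM ler_pM2r ?invr_gt0 ?exprn_gt0.
apply: lerXn2r; rewrite ?nnegrE ?divr_ge0 ?sqr_ge0 ?(ltW sg0)//.
rewrite /y normrM normfV [`|scale w ^+ 2|]ger0_norm ?sqr_ge0//.
rewrite ler_pdivrMr ?exprn_gt0//.
have -> : n ^+ 2 / scale w * scale w ^+ 2 = n ^+ 2 * scale w.
  by field; rewrite gt_eqF.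
apply: le_trans (ler_normD _ _) _.
rewrite normrM [`|2|]ger0_norm// [`|sqn z|]ger0_norm ?sqn_ge0//.
have := dotn; have := sqnn; have := scale_ge1 w; have := n1.
move: (`|dot w z| : R) (sqn z) (scale w) (n) => a b c m h1 h2 h3 h4.
have : (m - 1) ^+ 2 <= c * (m - 1) ^+ 2.
  by rewrite -[leLHS]mul1r ler_wpM2r// sqr_ge0.
lra.
Qed.

(** Only the square of the scalar product is of order [scale w ^- 2]; the other terms of the square
    have total size at most [5 * n ^+ 6 / scale w ^+ 3]. *)
Lemma increment_sqr :
  `|y ^+ 2 - 4 * dot w z ^+ 2 / scale w ^+ 4| <= 320 * moments v v' / scale w
    ^+ 3.
Proof.
have -> : y ^+ 2 - 4 * dot w z ^+ 2 / scale w ^+ 4 =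
    (4 * dot w z * sqn z + sqn z ^+ 2) / scale w ^+ 4.
  by rewrite /y; field; rewrite gt_eqF.
rewrite normrM normfV [`|scale w ^+ 4|]ger0_norm ?exprn_ge0 ?(ltW sg0)//.
rewrite ler_pdivrMr ?exprn_gt0//.
have -> : 320 * moments v v' / scale w ^+ 3 * scale w ^+ 4 =
    5 * (64 * moments v v') * scale w.
  by field; rewrite gt_eqF.
apply: (@le_trans _ _ (5 * n ^+ 6 * scale w)); last first.
  by rewrite ler_wpM2r ?(ltW sg0)// ler_wpM2l.
apply: le_trans (ler_normD _ _) _.
rewrite [`|sqn z ^+ 2|]ger0_norm ?sqr_ge0// normrM [`|4 * _|]normrM.
rewrite [`|4|]ger0_norm// [`|sqn z|]ger0_norm ?sqn_ge0//.
have h0 := sqn_ge0 z.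
have := dotn; have := sqnn; have := scale_ge1 w; have := n1.
have := normr_ge0 (dot w z).
move: (`|dot w z| : R) (sqn z) h0 (scale w) (n) => a b b0 c m a0 h1 h2 h3 h4.
have m4 : m ^+ 4 <= m ^+ 6 by apply: ler_weXn2l.
have m3 : m ^+ 3 <= m ^+ 6 by apply: ler_weXn2l.
have m10 : 0 <= m - 1 by lra.
have b2 : b ^+ 2 <= m ^+ 4.
  apply: (@le_trans _ _ (((m - 1) ^+ 2) ^+ 2));
    first by rewrite lerXn2r ?nnegrE ?sqr_ge0.
  by rewrite -exprM; apply: lerXn2r; rewrite ?nnegrE; lra.
have ab : a * b <= c * m ^+ 3.
  apply: (@le_trans _ _ (c * (m - 1) * (m - 1) ^+ 2)); first exact: ler_pM.
  rewrite -mulrA ler_wpM2l; [|lra|].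
    lra.
  by rewrite -exprS; apply: lerXn2r; rewrite ?nnegrE; lra.
have m60 : 0 <= m ^+ 6 by rewrite exprn_ge0//; lra.
have : c * m ^+ 3 <= c * m ^+ 6 by rewrite ler_wpM2l//; lra.
have : m ^+ 6 <= c * m ^+ 6 by rewrite -[leLHS]mul1r ler_wpM2r.
move: (m ^+ 6) (m ^+ 4) (m ^+ 3) (b ^+ 2) m4 m3 b2 ab m60 => m6 m4 m3 bb *; lra.
Qed.

End increment.

(** [X] is the leading part of [Y2 / 4] and [K] the size of the errors. The constant 2100 covers
    [20 * 64 + 160 + 160] here and [24 * 64 + 160 + 320] in [invln_arith]. *)
Lemma lnln_arith (V V' y Y2 c X K m : R) : 0 <= m -> m <= 1 -> 0 <= K ->
  V' <= V + (y - Y2 / 2) * m - Y2 * m ^+ 2 / 2 + 20 * c ->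
  c <= 64 * K -> `|Y2 - 4 * X| <= 320 * K ->
  V' <= V + (y - 2 * X) * m - 2 * X * m ^+ 2 + 2100 * K.
Proof.
move=> m0 m1 K0 h c64; rewrite ler_norml => /andP[h1 _].
have {}h1 : 0 <= Y2 - 4 * X + 320 * K by rewrite -lerBlDr sub0r.
have : 0 <= (Y2 - 4 * X + 320 * K) * m by rewrite mulr_ge0.
have : 0 <= (Y2 - 4 * X + 320 * K) * m ^+ 2 by rewrite mulr_ge0 ?sqr_ge0.
have : K * m <= K by rewrite -[leRHS]mulr1 ler_wpM2l.
have : K * m ^+ 2 <= K by rewrite -[leRHS]mulr1 ler_wpM2l// exprn_ile1.
lra.
Qed.

Lemma invln_arith (V' y Y2 c X K m l : R) : 0 <= m -> m <= 1 -> 1 <= l ->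
  0 <= K ->
  V' <= m * (1 - (y - Y2 / 2) * m + Y2 * m ^+ 2 + 24 * l * c) ->
  c <= 64 * K -> `|Y2 - 4 * X| <= 320 * K ->
  V' <= m * (1 - (y - 2 * X) * m + 4 * X * m ^+ 2 + 2100 * (l * K)).
Proof.
move=> m0 m1 l1 K0 h c64; rewrite ler_norml => /andP[_ h1].
apply: (le_trans h); rewrite ler_wpM2l//.
have {}h1 : 0 <= 320 * K - (Y2 - 4 * X) by rewrite subr_ge0.
have : 0 <= (320 * K - (Y2 - 4 * X)) * m by rewrite mulr_ge0.
have : 0 <= (320 * K - (Y2 - 4 * X)) * m ^+ 2 by rewrite mulr_ge0 ?sqr_ge0.
have : K * m <= K by rewrite -[leRHS]mulr1 ler_wpM2l.
have : K * m ^+ 2 <= K by rewrite -[leRHS]mulr1 ler_wpM2l// exprn_ile1.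
have : K <= l * K by rewrite -[leLHS]mul1r ler_wpM2r.
have : l * c <= l * (64 * K) by rewrite ler_wpM2l//; lra.
lra.
Qed.

(* Kept folded, since [lra] is slow on numerals of this size. *)
Definition taylor_cst : R := 2100.

Lemma taylor_cst_ge0 : 0 <= taylor_cst.
Proof. exact: ler0n. Qed.

Section pointwise.
Variables w v v' : site k.
Let z := v - v'.
Let u := (scale w)^-1.
Let m := (1 + lg w)^-1.
Let y := (2 * dot w z + sqn z) / scale w ^+ 2.

Let L0 := lg_ge0 w.

Let ylg : 0 <= lg w + ln (1 + y).
Proof. by rewrite -lgD lg_ge0. Qed.

Let M0 : 0 <= moments v v'.
Proof. by rewrite addr_ge0// exprn_ge0// addr_ge0. Qed.

Let u0 : 0 <= u.
Proof. by rewrite invr_ge0 (le_trans ler01 (scale_ge1 w)). Qed.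

Let l1 : 1 <= 1 + lg w. Proof. by rewrite lerDl. Qed.

Let m0 : 0 <= m. Proof. by rewrite invr_ge0 (le_trans ler01 l1). Qed.

Let m1 : m <= 1. Proof. by rewrite invf_le1 ?(lt_le_trans ltr01 l1). Qed.

Let cube : `|y| ^+ 3 <= 64 * (moments v v' * u ^+ 3).
Proof. by rewrite /u exprVn [64 * _]mulrA increment_cube. Qed.

Let sqr : `|y ^+ 2 - 4 * (dot w z ^+ 2 * u ^+ 4)| <= 320 * (moments v v' * u ^+
  3).
Proof.
by rewrite /u !exprVn [4 * (_ * _)]mulrA [320 * (_ * _)]mulrA increment_sqr.
Qed.

Let yE : y = (2 * dot w z + sqn z) * u ^+ 2.
Proof. by rewrite /u exprVn. Qed.

Lemma lnln_pointwise : ln (1 + lg (w + z)) <= ln (1 + lg w) +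
  ((2 * dot w z + sqn z) * u ^+ 2 - 2 * (dot w z ^+ 2 * u ^+ 4)) * m -
  2 * (dot w z ^+ 2 * u ^+ 4) * m ^+ 2 + taylor_cst * (moments v v' * u ^+ 3).
Proof.
rewrite -yE; apply: lnln_arith m0 m1 _ _ cube sqr.
  by rewrite mulr_ge0// exprn_ge0.
by rewrite /m exprVn lgD; apply: lnln_increment => //; exact: increment_gt.
Qed.

Lemma invln_pointwise : (1 + lg (w + z))^-1 <=
  m * (1 - ((2 * dot w z + sqn z) * u ^+ 2 - 2 * (dot w z ^+ 2 * u ^+ 4)) * m +
  4 * (dot w z ^+ 2 * u ^+ 4) * m ^+ 2 +
  taylor_cst * ((1 + lg w) * (moments v v' * u ^+ 3))).
Proof.
rewrite -yE; apply: invln_arith m0 m1 l1 _ _ cube sqr.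
  by rewrite mulr_ge0// exprn_ge0.
by rewrite /m exprVn lgD; apply: invln_increment => //; exact: increment_gt.
Qed.

End pointwise.

(* The hypotheses are the moments of the increment: [kappa] is the dimension, *)
(* [q] the mean of [sqn], [s2] that of [dot ^+ 2] and [m6] that of [moments]. *)
Lemma recurrent_arith (C D v0 tau s2 q m6 m u : R) : 0 <= C -> 0 <= D ->
  0 < v0 ->
  v0 <= tau -> tau <= C -> 0 < m -> m <= 1 -> 0 < u -> u <= 1 -> m6 <= C ->
  q <= 2 * tau + C * u ->
  tau * (u^-1 ^+ 2 - 1) - C / u <= s2 ->
  (9 * C + D * C) * u <= 2 * v0 * m ^+ 2 ->
  (q * u ^+ 2 - 2 * (s2 * u ^+ 4)) * m - 2 * (s2 * u ^+ 4) * m ^+ 2 +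
    D * (m6 * u ^+ 3) <= 0.
Proof.
move=> C0 D0 v00 tau0 tauC m0 m1 u0 u1 m6C qle s2ge small.
have u3 : 0 < u ^+ 3 by rewrite exprn_gt0.
have u2 : 0 < u ^+ 2 by rewrite exprn_gt0.
have u43 : u ^+ 4 <= u ^+ 3 by rewrite exprS ler_piMl// ltW.
have s2u : tau * u ^+ 2 - 2 * C * u ^+ 3 <= s2 * u ^+ 4.
  have : (tau * (u^-1 ^+ 2 - 1) - C / u) * u ^+ 4 <= s2 * u ^+ 4.
    by rewrite ler_wpM2r// exprn_ge0// ltW.
  have -> : (tau * (u^-1 ^+ 2 - 1) - C / u) * u ^+ 4 =
      tau * u ^+ 2 - tau * u ^+ 4 - C * u ^+ 3.
    by field; rewrite gt_eqF.
  have : tau * u ^+ 4 <= C * u ^+ 3.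
    by apply: ler_pM => //; [lra|rewrite exprn_ge0// ltW].
  lra.
have qu : q * u ^+ 2 <= 2 * tau * u ^+ 2 + C * u ^+ 3.
  have -> : 2 * tau * u ^+ 2 + C * u ^+ 3 = (2 * tau + C * u) * u ^+ 2 by ring.
  by rewrite ler_wpM2r// ltW.
(* The terms [2 * tau * u ^+ 2] cancel: this is the critical dimension 2. What remains negative is
   [- 2 * tau * u ^+ 2 * m ^+ 2], against errors of order [u ^+ 3]. *)
have A : (q * u ^+ 2 - 2 * (s2 * u ^+ 4)) * m <= 5 * C * u ^+ 3.
  apply: (@le_trans _ _ (5 * C * u ^+ 3 * m)).
    by rewrite ler_wpM2r ?(ltW m0)//; lra.
  by rewrite -[leRHS]mulr1 ler_wpM2l// mulr_ge0 ?(ltW u3)//; lra.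
have B : (v0 * u ^+ 2 - 2 * C * u ^+ 3) * m ^+ 2 <= s2 * u ^+ 4 * m ^+ 2.
  rewrite ler_wpM2r ?sqr_ge0//; apply: le_trans s2u.
  by rewrite lerD2r ler_wpM2r// ltW.
have G2 : C * u ^+ 3 * m ^+ 2 <= C * u ^+ 3.
  by apply: ler_piMr; [rewrite mulr_ge0// ltW|rewrite exprn_ile1// ltW].
have E : D * (m6 * u ^+ 3) <= D * (C * u ^+ 3).
  by rewrite ler_wpM2l// ler_wpM2r// ltW.
have F : (9 * C + D * C) * u * u ^+ 2 <= 2 * v0 * m ^+ 2 * u ^+ 2.
  by rewrite ler_wpM2r// ltW.
have FE : (9 * C + D * C) * u * u ^+ 2 =
  9 * (C * u ^+ 3) + D * (C * u ^+ 3) by ring.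
rewrite FE in F.
have BE : (v0 * u ^+ 2 - 2 * C * u ^+ 3) * m ^+ 2 =
  v0 * m ^+ 2 * u ^+ 2 - 2 * (C * u ^+ 3 * m ^+ 2) by ring.
rewrite BE in B; lra.
Qed.

(** Now [q] exceeds twice [s2 * u ^+ 2] by about [tau], which leaves [- tau * u ^+ 2 * m]. Half of
    it absorbs the second-order term, as [m <= 1 / 8], and the other half the errors of order
    [u ^+ 3 / m]. *)
Lemma transient_arith (C D v0 tau s2 q m6 m u : R) : 0 <= C -> 0 <= D ->
  0 < v0 ->
  v0 <= tau -> tau <= C -> 0 < m -> m <= 1 -> 0 < u -> u <= 1 -> m6 <= C ->
  3 * tau - C * u <= q ->
  s2 <= tau * (u^-1 ^+ 2 - 1) + C / u ->
  m <= 8^-1 -> (7 * C + D * C) * u <= v0 / 2 * m ^+ 2 ->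
  - (q * u ^+ 2 - 2 * (s2 * u ^+ 4)) * m + 4 * (s2 * u ^+ 4) * m ^+ 2 +
    D * (m^-1 * (m6 * u ^+ 3)) <= 0.
Proof.
move=> C0 D0 v00 tau0 tauC m0 m1 u0 u1 m6C qge s2le m8 small.
have u3 : 0 < u ^+ 3 by rewrite exprn_gt0.
have u2 : 0 < u ^+ 2 by rewrite exprn_gt0.
have Cu3 : 0 <= C * u ^+ 3 by rewrite mulr_ge0// ltW.
have s2u : s2 * u ^+ 4 <= tau * u ^+ 2 + C * u ^+ 3.
  have : s2 * u ^+ 4 <= (tau * (u^-1 ^+ 2 - 1) + C / u) * u ^+ 4.
    by rewrite ler_wpM2r// exprn_ge0// ltW.
  have -> : (tau * (u^-1 ^+ 2 - 1) + C / u) * u ^+ 4 =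
      tau * u ^+ 2 - tau * u ^+ 4 + C * u ^+ 3.
    by field; rewrite gt_eqF.
  have : 0 <= tau * u ^+ 4 by rewrite mulr_ge0// ?exprn_ge0//; lra.
  lra.
have qu : 3 * tau * u ^+ 2 - C * u ^+ 3 <= q * u ^+ 2.
  have -> : 3 * tau * u ^+ 2 - C * u ^+ 3 = (3 * tau - C * u) * u ^+ 2 by ring.
  by rewrite ler_wpM2r// ltW.
have A : (tau * u ^+ 2 - 3 * C * u ^+ 3) * m <=
    (q * u ^+ 2 - 2 * (s2 * u ^+ 4)) * m.
  by rewrite ler_wpM2r ?(ltW m0)//; lra.
have B : s2 * u ^+ 4 * m ^+ 2 <= (tau * u ^+ 2 + C * u ^+ 3) * m ^+ 2.
  by rewrite ler_wpM2r ?sqr_ge0.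
have G1 : C * u ^+ 3 * m <= C * u ^+ 3 by apply: ler_piMr.
have G2 : C * u ^+ 3 * m ^+ 2 <= C * u ^+ 3.
  by apply: ler_piMr => //; rewrite exprn_ile1// ltW.
have m8' : tau * u ^+ 2 * m ^+ 2 <= tau * u ^+ 2 * m / 8.
  have -> : tau * u ^+ 2 * m ^+ 2 = tau * u ^+ 2 * m * m by ring.
  apply: ler_wpM2l => //; rewrite mulr_ge0 ?(ltW m0)// mulr_ge0 ?(ltW u2)//.
  exact: le_trans (ltW v00) tau0.
have mV : 1 <= m^-1 by rewrite invf_ge1.
have E : D * (m^-1 * (m6 * u ^+ 3)) <= D * (m^-1 * (C * u ^+ 3)).
  by rewrite ler_wpM2l// ler_wpM2l ?invr_ge0 ?(ltW m0)// ler_wpM2r// ltW.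
have G3 : C * u ^+ 3 <= m^-1 * (C * u ^+ 3) by rewrite -[leLHS]mul1r ler_wpM2r.
have F : (7 * C + D * C) * u * u ^+ 2 / m <= v0 / 2 * m ^+ 2 * u ^+ 2 / m.
  by rewrite ler_pM2r ?invr_gt0// ler_wpM2r// ltW.
have FE : (7 * C + D * C) * u * u ^+ 2 / m =
    7 * (m^-1 * (C * u ^+ 3)) + D * (m^-1 * (C * u ^+ 3)).
  by field; rewrite gt_eqF.
have GE : v0 / 2 * m ^+ 2 * u ^+ 2 / m = v0 * u ^+ 2 * m / 2.
  by field; rewrite gt_eqF.
have G : v0 * u ^+ 2 * m <= tau * u ^+ 2 * m.
  by rewrite ler_wpM2r ?(ltW m0)// ler_wpM2r// ltW.
rewrite FE GE in F.
have AE : (tau * u ^+ 2 - 3 * C * u ^+ 3) * m =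
  tau * u ^+ 2 * m - 3 * (C * u ^+ 3 * m) by ring.
have BE : (tau * u ^+ 2 + C * u ^+ 3) * m ^+ 2 =
  tau * u ^+ 2 * m ^+ 2 + C * u ^+ 3 * m ^+ 2 by ring.
rewrite AE in A; rewrite BE in B; rewrite mulNr; lra.
Qed.

End quadratic_increment.

(** * Drift of the Lyapunov functions *)

Section drift.
Context {R : realType} {k : nat}.
Notation env := (@realfam R (key k)).
Context {p : R} {nu : probability env R}.
Hypothesis law : drainage_law p nu.
Variable i0 : 'I_k.
Implicit Types (e : env) (t : int) (x y z v : site k) (i j : 'I_k).
Local Notation coord := (@coord R k).

Definition spread t x x' e : site k := jump t x e - jump t x' e.

Lemma spreadE t x x' e : hop e t x - hop e t x' = (x - x') + spread t x x' e.
Proof.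
by rewrite /spread /jump opprB addrA [x - x' + _]addrC !addrA !subrK.
Qed.

Lemma intg_spread t x x' (f : site k -> R) (c : R) :
  (forall v v', `|f (v - v')| <= c * moments v v') ->
  intg nu (fun e => f (spread t x x' e)).
Proof.
move=> fc; exact: (@intg_jumps _ _ _ _ law i0 t x x' (fun v v' =>
  f (v - v')) c).
Qed.

Lemma intg_moments t x x' :
  intg nu (fun e => moments (jump t x e) (jump t x' e)).
Proof.
apply: (@intg_jumps _ _ _ _ law i0 t x x' _ 1) => v v'.
by rewrite mul1r ger0_norm// addr_ge0// exprn_ge0// addr_ge0.
Qed.

Lemma intg_coord_spread i t x x' : intg nu (fun e => coord i (spread t x x' e)).
Proof.
rewrite (_ : (fun e => _) =
    fun e => coord i (jump t x e) + -1 * coord i (jump t x' e)).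
  apply: intgD; first exact: (intg_coord law).
  by apply: intgZ; exact: (intg_coord law).
by apply/funext => e; rewrite /spread coordB mulN1r.
Qed.

Lemma coord_spread_mul i j t x x' e :
  coord i (spread t x x' e) * coord j (spread t x x' e) =
  coord i (jump t x e) * coord j (jump t x e) +
  (coord i (jump t x' e) * coord j (jump t x' e) +
   (-1 * (coord i (jump t x e) * coord j (jump t x' e)) +
    -1 * (coord i (jump t x' e) * coord j (jump t x e)))).
Proof. by rewrite /spread !coordB; ring. Qed.

Lemma intg_coord_spread_mul i j t x x' :
  intg nu (fun e => coord i (spread t x x' e) * coord j (spread t x x' e)).
Proof.
rewrite (_ : (fun e => _) = fun e =>
  coord i (jump t x e) * coord j (jump t x e) +
  (coord i (jump t x' e) * coord j (jump t x' e) +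
   (-1 * (coord i (jump t x e) * coord j (jump t x' e)) +
    -1 * (coord i (jump t x' e) * coord j (jump t x e))))).
  by do 2![apply: intgD; first exact: (intg_coord_mul law)];
    apply: intgD; apply: intgZ; exact: (intg_coord_mul law).
by apply/funext => e; exact: coord_spread_mul.
Qed.

Lemma expect_coord_spread i t x x' :
  expect nu (fun e => coord i (spread t x x' e)) = 0.
Proof.
under eq_expect do rewrite /spread coordB -mulN1r.
rewrite expectD; [|exact: (intg_coord law)|by apply: intgZ;
  exact: (intg_coord law)].
rewrite expectZ; last exact: (intg_coord law).
by rewrite !(expect_coord law) mulr0 addr0.
Qed.

Lemma expect_coord_spread_mul i j t x x' :
  expect nu (fun e => coord i (spread t x x' e) * coord j (spread t x x' e)) =
  expect nu (fun e => coord i (jump t x e) * coord j (jump t x e)) +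
  expect nu (fun e => coord i (jump t x' e) * coord j (jump t x' e)) -
  expect nu (fun e => coord i (jump t x e) * coord j (jump t x' e)) -
  expect nu (fun e => coord i (jump t x' e) * coord j (jump t x e)).
Proof.
under eq_expect do rewrite coord_spread_mul.
have I l m y z := @intg_coord_mul _ _ _ _ law l m t y z.
rewrite !expectD//; try by [exact: intgZ|do ?[apply: intgD => //];
  exact: intgZ].
by rewrite !expectZ//; ring.
Qed.

(** [tau] is the sum of the variances of the two jumps, common to all coordinates by symmetry; it is
    chosen for each pair of sites, within uniform bounds. The two cross terms are each at most
    [2 * |D| / scale (x - x')] in absolute value. *)
Lemma spread_covariance : exists B : R, exists C v0 : R,
  [/\ 0 <= B, 0 < v0 &
  forall t x x', x <> x' -> exists tau, [/\ v0 <= tau, tau <= C &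
    forall i j, `|expect nu (fun e => coord i (spread t x x' e) *
      coord j (spread t x x' e)) - (i == j)%:R * tau| <= B / scale (x - x')]].
Proof.
have [D cross] := @expect_coord_cross _ _ _ _ law.
have [C sqrC] := @expect_coord_sqr_ub _ _ _ _ law.
pose v0 := p * (1 - p) ^+ size (@l1_ball k 1).
have v00 : 0 < v0.
  by rewrite mulr_gt0 ?exprn_gt0 ?subr_gt0 ?(law_gt0 law) ?(law_lt1 law).
exists (4 * `|D|), (2 * C), v0; split => //.
move=> t x x' xx'.
pose V y := expect nu (fun e => coord i0 (jump t y e) * coord i0 (jump t y e)).
have Vlb y : v0 <= V y by exact: (expect_coord_sqr_lb law).
have Vub y : V y <= C by exact: sqrC.
exists (V x + V x'); split.
- by have := Vlb x; have := Vlb x'; lra.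
- by have := Vub x; have := Vub x'; lra.
move=> i j; rewrite expect_coord_spread_mul.
have c1 := cross i j t x x' xx'; have c2 := cross i j t x' x (nesym xx').
rewrite [l1 (x' - x)]l1B in c2.
have w0 : x - x' != 0 by rewrite subr_eq0; apply/eqP.
have sg0 : (0 : R) < scale (x - x') by exact: lt_le_trans (scale_ge1 _).
have n0 : 0 < (l1 (x - x'))%:R :> R.
  by rewrite ltr0n lt0n; apply: contra_neq w0; exact: l1_eq0.
have bnd : D / (l1 (x - x'))%:R <= 2 * `|D| / scale (x - x').
  rewrite ler_pdivrMr// mulrAC ler_pdivlMr// -mulrA mulrCA.
  apply: (@le_trans _ _ (`|D| * scale (x - x'))).
    by rewrite ler_wpM2r ?ler_norm// ltW.
  by rewrite ler_wpM2l// scale_le_l1.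
move: c1 c2; rewrite !ler_norml => /andP[c1 c1'] /andP[c2 c2'].
have diag : i != j -> forall y,
    expect nu (fun e => coord i (jump t y e) * coord j (jump t y e)) = 0.
  by move=> ij y; exact: (expect_coord_mul law).
have dia y : expect nu (fun e =>
  coord i (jump t y e) * coord i (jump t y e)) = V y.
  exact: (expect_coord_sqr law).
have -> : expect nu (fun e => coord i (jump t x e) * coord j (jump t x e)) +
    expect nu (fun e => coord i (jump t x' e) * coord j (jump t x' e)) =
    (i == j)%:R * (V x + V x').
  have [<-|ij] := eqVneq i j; first by rewrite !dia mul1r.
  by rewrite !diag// addr0 mul0r.
set a := expect _ _ in c1 c1' *; set b := expect _ _ in c2 c2' *.
have -> : 4 * `|D| / scale (x - x') = 2 * (2 * `|D| / scale (x - x')) by ring.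
apply/andP; split; lra.
Qed.

Lemma expect_sqn_spread t x x' : expect nu (fun e => sqn (spread t x x' e)) =
  \sum_i expect nu (fun e => coord i (spread t x x' e) * coord i (spread t x x'
    e)).
Proof.
rewrite -expect_sum; last by move=> i; exact: intg_coord_spread_mul.
by apply: eq_expect => e; apply: eq_bigr => i _; rewrite expr2.
Qed.

Lemma intg_sqn_spread t x x' : intg nu (fun e => sqn (spread t x x' e)).
Proof.
rewrite (_ : (fun e => _) = fun e => \sum_i
    coord i (spread t x x' e) * coord i (spread t x x' e)).
  by apply: intg_sum => i; exact: intg_coord_spread_mul.
by apply/funext => e; apply: eq_bigr => i _; rewrite expr2.
Qed.

Lemma dot_sqrE w t x x' e : dot w (spread t x x' e) ^+ 2 =
  \sum_i \sum_j (coord i w * coord j w) *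
    (coord i (spread t x x' e) * coord j (spread t x x' e)).
Proof.
rewrite expr2 /dot mulr_suml; apply: eq_bigr => i _.
by rewrite mulr_sumr; apply: eq_bigr => j _; rewrite mulrACA.
Qed.

Lemma intg_dot w t x x' : intg nu (fun e => dot w (spread t x x' e)).
Proof. by apply: intg_sum => i; apply: intgZ; exact: intg_coord_spread. Qed.

Lemma expect_dot w t x x' : expect nu (fun e => dot w (spread t x x' e)) = 0.
Proof.
rewrite expect_sum; last by move=> i; apply: intgZ; exact: intg_coord_spread.
apply: big1 => i _; rewrite expectZ; last exact: intg_coord_spread.
by rewrite expect_coord_spread mulr0.
Qed.

Lemma intg_dot_sqr w t x x' : intg nu (fun e => dot w (spread t x x' e) ^+ 2).
Proof.
rewrite (_ : (fun e => _) = fun e => \sum_i \sum_j (coord i w * coord j w) *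
    (coord i (spread t x x' e) * coord j (spread t x x' e))).
  apply: intg_sum => i; apply: intg_sum => j; apply: intgZ.
  exact: intg_coord_spread_mul.
by apply/funext => e; exact: dot_sqrE.
Qed.

Lemma expect_dot_sqr w t x x' : expect nu (fun e =>
  dot w (spread t x x' e) ^+ 2) =
  \sum_i \sum_j (coord i w * coord j w) *
    expect nu (fun e => coord i (spread t x x' e) * coord j (spread t x x' e)).
Proof.
have I i j := @intg_coord_spread_mul i j t x x'.
under eq_expect do rewrite dot_sqrE.
rewrite expect_sum; last by move=> i; apply: intg_sum => j; exact: intgZ.
apply: eq_bigr => i _; rewrite expect_sum; last by move=> j; exact: intgZ.
by apply: eq_bigr => j _; rewrite expectZ.
Qed.

(** The trace of a covariance close to [tau] times the identity is about [k * tau], and its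
    quadratic form at [w] about [tau * sqn w], where [sqn w = u^-1 ^+ 2 - 1]. *)
Lemma spread_moments : exists C v0 : R, [/\ 0 <= C, 0 < v0 &
  forall t x x', x <> x' -> let u := (scale (x - x'))^-1 in exists tau,
    [/\ v0 <= tau, tau <= C,
      `|expect nu (fun e => sqn (spread t x x' e)) - k%:R * tau| <= C * u,
      `|expect nu (fun e => dot (x - x') (spread t x x' e) ^+ 2) -
        tau * (u^-1 ^+ 2 - 1)| <= C / u &
      expect nu (fun e => moments (jump t x e) (jump t x' e)) <= C]].
Proof.
have [B [C [v0 [B0 v00 cov]]]] := spread_covariance.
have [C6 C61 mom] := jump_moments law i0.
exists (`|C| + k%:R * B + k%:R ^+ 2 * B + 2 * C6), v0.
have kB : 0 <= k%:R * B by rewrite mulr_ge0.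
have k2B : 0 <= k%:R ^+ 2 * B by rewrite mulr_ge0// exprn_ge0.
have Cn : C <= `|C| by exact: ler_norm.
have C0 : 0 <= `|C| by [].
split=> [|//|t x x' xx' u]; first by rewrite !addr_ge0// mulr_ge0//; lra.
have [tau [tau0 tauC c]] := cov t x x' xx'.
have sg0 : (0 : R) < scale (x - x') by exact: lt_le_trans (scale_ge1 _).
have u0 : 0 < u by rewrite invr_gt0.
exists tau; split=> //.
- by lra.
- rewrite expect_sqn_spread.
  have -> : k%:R * tau = \sum_(i < k) tau.
    by rewrite sumr_const card_ord mulr_natl.
  rewrite -sumrB; apply: le_trans (ler_norm_sum _ _ _) _.
  apply: (@le_trans _ _ (\sum_(i < k) B * u)).
    by apply: ler_sum => i _; have := c i i; rewrite eqxx mul1r.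
  rewrite sumr_const card_ord -[leLHS]mulr_natl mulrA ler_wpM2r ?(ltW u0)//;
    lra.
- rewrite expect_dot_sqr /u invrK scale_sqr addrAC subrr add0r.
  have -> : tau * sqn (x - x') = \sum_i \sum_j (coord i (x - x') *
      coord j (x - x')) * ((i == j)%:R * tau).
    rewrite /sqn mulr_sumr; apply: eq_bigr => i _.
    rewrite (bigD1 i)//= eqxx mul1r big1 ?addr0 => [|j ji]; first by ring.
    by rewrite eq_sym (negPf ji) mul0r mulr0.
  rewrite -sumrB; apply: le_trans (ler_norm_sum _ _ _) _.
  apply: (@le_trans _ _ (\sum_(i < k) \sum_(j < k) B * scale (x - x'))).
    apply: ler_sum => i _; rewrite -sumrB;
      apply: le_trans (ler_norm_sum _ _ _) _.
    apply: ler_sum => j _; rewrite -mulrBr !normrM.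
    have -> : B * scale (x - x') =
        scale (x - x') * scale (x - x') * (B / scale (x - x')).
      by field; rewrite gt_eqF.
    by apply: ler_pM; rewrite ?mulr_ge0//; apply: ler_pM;
      rewrite // coord_le_scale.
  rewrite !sumr_const !card_ord -mulrnA -[leLHS]mulr_natr mulrAC natrM -expr2.
  rewrite ler_wpM2r ?(ltW sg0)// mulrC; lra.
have [int6 e6] := mom t x; have [int6' e6'] := mom t x'.
rewrite /moments expectD//.
by rewrite /moment6 in e6 e6'; lra.
Qed.

Definition lnln v : R := ln (1 + lg v).
Definition invln v : R := (1 + lg v)^-1.

Lemma lnln_ge0 v : 0 <= lnln v.
Proof. by rewrite ln_ge0// lerDl lg_ge0. Qed.

Lemma invln_gt0 v : 0 < invln v.
Proof. by rewrite invr_gt0 ltr_pwDl// lg_ge0. Qed.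

Lemma invln_le1 v : invln v <= 1.
Proof. by rewrite invf_le1 ?lerDl ?lg_ge0// ltr_pwDl// lg_ge0. Qed.

Lemma lnln_le_sqn v : lnln v <= sqn v.
Proof.
have h : (-1 : R) < sqn v by apply: lt_le_trans (sqn_ge0 v); exact: ltrN10.
apply: le_trans (le_ln1Dx h); apply: le_ln1Dx.
by apply: lt_le_trans (lg_ge0 v); exact: ltrN10.
Qed.

Lemma hop_intg t x x' (f : site k -> R) (c : R) :
  (forall v v', `|f ((x - x') + (v - v'))| <= c * moments v v') ->
  intg nu (fun e => f (hop e t x - hop e t x')).
Proof.
move=> fc; rewrite (_ : (fun e => _) = fun e => f ((x - x') + spread t x x' e)).
  exact: (@intg_spread t x x' (fun v => f ((x - x') + v)) c).
by apply/funext => e; rewrite spreadE.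
Qed.

Lemma intg_lnln t x x' : intg nu (fun e => lnln (hop e t x - hop e t x')).
Proof.
apply: (@hop_intg t x x' lnln ((1 + (l1 (x - x'))%:R) ^+ 2 * 64)) => v v'.
rewrite ger0_norm ?lnln_ge0//; apply: le_trans (lnln_le_sqn _) _.
apply: le_trans (sqn_le _) _.
pose a := (l1 v)%:R : R; pose b := (l1 v')%:R : R;
  pose c := (l1 (x - x'))%:R : R.
have a0 : 0 <= a by []. have b0 : 0 <= b by []. have c0 : 0 <= c by [].
apply: (@le_trans _ _ (((1 + c) * (1 + (a + b))) ^+ 2)).
  apply: lerXn2r; rewrite ?nnegrE ?mulr_ge0 ?addr_ge0//.
  apply: (@le_trans _ _ (c + (a + b))); last by nra.
  rewrite -!natrD ler_nat; apply: leq_trans (l1D _ _) _; rewrite leq_add2l.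
  by have := l1D v (- v'); rewrite l1N.
rewrite exprMn -mulrA ler_wpM2l ?sqr_ge0//.
apply: le_trans (pow6_add a0 b0).
by apply: ler_weXn2l => //; rewrite lerDl addr_ge0.
Qed.

Lemma intg_invln t x x' : intg nu (fun e => invln (hop e t x - hop e t x')).
Proof.
apply: (@hop_intg t x x' invln 1) => v v'.
rewrite ger0_norm ?(ltW (invln_gt0 _))// mul1r; apply: le_trans (invln_le1 _) _.
rewrite /moments -[leLHS]addr0; apply: lerD;
  last by rewrite exprn_ge0// addr_ge0.
by apply: exprn_ege1; rewrite lerDl.
Qed.

(** The linear term drops out of the mean because the spread is centred. *)
Lemma expect_quadratic w t x x' (c0 c1 c2 c3 c4 : R) :
  let f e := c0 + (c1 * dot w (spread t x x' e) +
    (c2 * sqn (spread t x x' e) + (c3 * dot w (spread t x x' e) ^+ 2 +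
     c4 * moments (jump t x e) (jump t x' e)))) in
  intg nu f /\ expect nu f = c0 + c2 * expect nu (fun e =>
    sqn (spread t x x' e)) +
    c3 * expect nu (fun e => dot w (spread t x x' e) ^+ 2) +
    c4 * expect nu (fun e => moments (jump t x e) (jump t x' e)).
Proof.
move=> f.
have I1 := @intgZ _ _ _ nu c1 _ (intg_dot w t x x').
have I2 := @intgZ _ _ _ nu c2 _ (intg_sqn_spread t x x').
have I3 := @intgZ _ _ _ nu c3 _ (intg_dot_sqr w t x x').
have I4 := @intgZ _ _ _ nu c4 _ (intg_moments t x x').
have I34 := intgD I3 I4; have I234 := intgD I2 I34; have I1234 := intgD I1 I234.
split; first by apply: intgD => //; exact: intg_cst.
rewrite expectD//; last exact: intg_cst.
rewrite expect_cst expectD// expectD// expectD//.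
rewrite (expectZ c1 (intg_dot w t x x')) expect_dot mulr0 add0r.
rewrite (expectZ c2 (intg_sqn_spread t x x')).
rewrite (expectZ c3 (intg_dot_sqr w t x x')).
by rewrite (expectZ c4 (intg_moments t x x')) !addrA.
Qed.

Lemma small_scale (a : R) : 0 < a ->
  exists L0 : R, forall v : site k, L0 <= lg v ->
  (scale v)^-1 <= a * (1 + lg v)^-1 ^+ 2.
Proof.
move=> a0; have [L0 gr] := ln_growth a0; exists L0 => v /gr.
rewrite -/(scale v) exprVn => h.
have sg0 : (0 : R) < scale v by exact: lt_le_trans (scale_ge1 _).
have l0 : (0 : R) < (1 + lg v) ^+ 2 by rewrite exprn_gt0// ltr_pwDl// lg_ge0.
by rewrite -[leLHS]mul1r ler_pdivrMr// mulrAC ler_pdivlMr// mul1r.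
Qed.

(** Average [lnln_pointwise]: the mean is that of a quadratic polynomial in the spread plus an
    error, and [recurrent_arith] gives its sign once [small_scale] makes [u] small against
    [m ^+ 2]. *)
Lemma lnln_drift : (k <= 2)%N -> exists M : R, forall t x x', x <> x' ->
  M <= lg (x - x') ->
  expect nu (fun e => lnln (hop e t x - hop e t x')) <= lnln (x - x').
Proof.
move=> k2; have [C [v0 [C0 v00 mom]]] := spread_moments.
pose D := @taylor_cst R; have D0 : 0 <= D by exact: taylor_cst_ge0.
have D1 : 0 < 9 * C + D * C + 1 by rewrite ltr_wpDl// addr_ge0// mulr_ge0.
have a0 : 0 < 2 * v0 / (9 * C + D * C + 1) by rewrite divr_gt0// mulr_gt0.
have [M smallM] := small_scale a0; exists M => t x x' xx' /smallM small.
have [tau [tau0 tauC q s2 m6]] := mom t x x' xx'.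
set w := x - x' in small q s2 *; set u : R := (scale w)^-1 in small q s2.
set m : R := (1 + lg w)^-1 in small.
have m0 : 0 < m by exact: invln_gt0.
have m1 : m <= 1 by exact: invln_le1.
have sg1 : 1 <= (scale w : R) by exact: scale_ge1.
have u0 : 0 < u by rewrite invr_gt0 (lt_le_trans ltr01).
have u1 : u <= 1 by rewrite invf_le1// (lt_le_trans ltr01).
pose f e := lnln w + (2 * u ^+ 2 * m * dot w (spread t x x' e) +
  (u ^+ 2 * m * sqn (spread t x x' e) +
  ((- 2 * u ^+ 4 * m - 2 * u ^+ 4 * m ^+ 2) * dot w (spread t x x' e) ^+ 2 +
   D * u ^+ 3 * moments (jump t x e) (jump t x' e)))).
have [intf Ef] := @expect_quadratic w t x x' (lnln w) (2 * u ^+ 2 * m) (u ^+ 2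
  * m)
  (- 2 * u ^+ 4 * m - 2 * u ^+ 4 * m ^+ 2) (D * u ^+ 3).
apply: (@le_trans _ _ (expect nu f)).
  apply: expect_le => //; first exact: intg_lnln.
  move=> e; rewrite spreadE -/w /spread.
  apply: le_trans (@lnln_pointwise R k _ _ _) _;
    rewrite -/D -/u -/m /f /spread -/(lnln w).
  by rewrite le_eqVlt; apply/orP; left; apply/eqP; ring.
rewrite Ef -!addrA gerDl.
set Q := expect _ _ in q *; set S := expect _ _ in s2 *;
  set M6 := expect _ _ in m6 *.
have := @recurrent_arith R C D v0 tau S Q M6 m u C0 D0 v00 tau0 tauC m0 m1 u0
  u1 m6.
move=> h; apply: (@le_trans _ _ ((Q * u ^+ 2 - 2 * (S * u ^+ 4)) * m -
    2 * (S * u ^+ 4) * m ^+ 2 + D * (M6 * u ^+ 3))).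
  by rewrite le_eqVlt; apply/orP; left; apply/eqP; ring.
apply: h.
- move: q; rewrite ler_norml => /andP[_ q].
  have kt : k%:R * tau <= 2 * tau.
    by apply: ler_wpM2r; [lra|rewrite ler_nat].
  lra.
- by move: s2; rewrite ler_norml => /andP[s2 _]; lra.
- have := small; rewrite mulrAC ler_pdivlMr//.
  have : 0 <= u by exact: ltW.
  by move: (m ^+ 2) => mm; rewrite mulrDr; lra.
Qed.

Lemma invln_drift : (3 <= k)%N -> exists M : R, forall t x x', x <> x' ->
  M <= lg (x - x') ->
  expect nu (fun e => invln (hop e t x - hop e t x')) <= invln (x - x').
Proof.
move=> k3; have [C [v0 [C0 v00 mom]]] := spread_moments.
pose D := @taylor_cst R; have D0 : 0 <= D by exact: taylor_cst_ge0.
have D1 : 0 < 7 * C + D * C + 1 by rewrite ltr_wpDl// addr_ge0// mulr_ge0.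
(* The threshold 7 serves to make [m = (1 + lg w)^-1] at most 1 / 8. *)
have a0 : 0 < v0 / 2 / (7 * C + D * C + 1) by rewrite !divr_gt0.
have [M smallM] := small_scale a0; exists (Num.max M 7) => t x x' xx'.
rewrite ge_max => /andP[/smallM small lg7].
have [tau [tau0 tauC q s2 m6]] := mom t x x' xx'.
set w := x - x' in small lg7 q s2 *; set u : R := (scale w)^-1 in small q s2.
set m : R := (1 + lg w)^-1 in small.
have m0 : 0 < m by exact: invln_gt0.
have m1 : m <= 1 by exact: invln_le1.
have sg1 : 1 <= (scale w : R) by exact: scale_ge1.
have u0 : 0 < u by rewrite invr_gt0 (lt_le_trans ltr01).
have u1 : u <= 1 by rewrite invf_le1// (lt_le_trans ltr01).
have m8 : m <= 8^-1.
  rewrite lef_pV2 ?posrE//; first by lra.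
  by rewrite ltr_pwDl// lg_ge0.
have mV : m^-1 = 1 + lg w by rewrite /m invrK.
(* The factor [m * m^-1], equal to 1, stays unsimplified so that [ring] can match the bound of
   [invln_pointwise]. *)
pose f e := m + (- 2 * u ^+ 2 * m ^+ 2 * dot w (spread t x x' e) +
  (- u ^+ 2 * m ^+ 2 * sqn (spread t x x' e) +
  ((2 * u ^+ 4 * m ^+ 2 + 4 * u ^+ 4 * m ^+ 3) * dot w (spread t x x' e) ^+ 2 +
   D * (m * m^-1) * u ^+ 3 * moments (jump t x e) (jump t x' e)))).
have [intf Ef] := @expect_quadratic w t x x' m (- 2 * u ^+ 2 * m ^+ 2)
  (- u ^+ 2 * m ^+ 2)
  (2 * u ^+ 4 * m ^+ 2 + 4 * u ^+ 4 * m ^+ 3) (D * (m * m^-1) * u ^+ 3).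
apply: (@le_trans _ _ (expect nu f)).
  apply: expect_le => //; first exact: intg_invln.
  move=> e; rewrite spreadE -/w /spread.
  apply: le_trans (@invln_pointwise R k _ _ _) _;
    rewrite -/D -/u -/m -mV /f /spread.
  by rewrite le_eqVlt; apply/orP; left; apply/eqP; ring.
rewrite Ef -!addrA /invln -/m gerDl.
set Q := expect _ _ in q *; set S := expect _ _ in s2 *;
  set M6 := expect _ _ in m6 *.
have := @transient_arith R C D v0 tau S Q M6 m u C0 D0 v00 tau0 tauC m0 m1 u0
  u1 m6.
move=> /(_ _ _ m8 _) h.
apply: (@le_trans _ _ (m * (- (Q * u ^+ 2 - 2 * (S * u ^+ 4)) * m +
  4 * (S * u ^+ 4) * m ^+ 2 + D * (m^-1 * (M6 * u ^+ 3))))).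
  by rewrite le_eqVlt; apply/orP; left; apply/eqP; ring.
rewrite pmulr_rle0//; apply: h.
- move: q; rewrite ler_norml => /andP[q _].
  have kt : 3 * tau <= k%:R * tau.
    by apply: ler_wpM2r; [lra|rewrite ler_nat].
  lra.
- by move: s2; rewrite ler_norml => /andP[_ s2]; lra.
- have := small; rewrite mulrAC ler_pdivlMr//.
  have : 0 <= u by exact: ltW.
  by move: (m ^+ 2) => mm; rewrite mulrDr; lra.
Qed.

End drift.

(** * Meeting probabilities *)

(** A positive supremum could be used as [b], and would then be at most [1 - delta] times itself. *)
Lemma contraction_le0 {R : realType} (I : Type) (f : I -> R) (delta : R) :
  0 < delta -> (exists b, forall i, f i <= b) ->
  (forall b, 0 <= b -> (forall i, f i <= b) ->
    forall i, f i <= (1 - delta) * b) ->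
  forall i, f i <= 0.
Proof.
move=> d0 [b fb] contr i.
pose s := sup (range f).
have hs : has_sup (range f).
  by split; [exists (f i), i|exists b => _ [j _ <-]].
have fs j : f j <= s by apply: sup_upper_bound => //; exists j.
have [s0|s0] := leP s 0; first exact: le_trans (fs i) s0.
have : s <= (1 - delta) * s.
  apply: ge_sup; first by exists (f i), i.
  by move=> _ [j _ <-]; apply: contr => //; exact: ltW.
have : 0 < delta * s by rewrite mulr_gt0.
lra.
Qed.

Section walks.
Context {R : realType} {k : nat}.
Notation env := (@realfam R (key k)).
Context {p : R} {nu : probability env R}.
Hypothesis law : drainage_law p nu.
Variable i0 : 'I_k.
Implicit Types (e : env) (t : int) (x y z v : site k) (n : nat).

Fixpoint walk e t n x : site k :=
  if n is n'.+1 then walk e (t - 1) n' (hop e t x) else x.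

Lemma walkS e t n x : walk e t n.+1 x = walk e (t - 1) n (hop e t x).
Proof. by []. Qed.

Lemma walkD e t m n x : walk e t (m + n) x = walk e (t - m%:Z) n (walk e t m x).
Proof.
elim: m t x => [|m IH] t x; first by rewrite subr0.
by rewrite addSn !walkS IH; congr (walk _ _ _ _); lia.
Qed.

Lemma discrete_walk t n x : discrete (fun e => walk e t n x).
Proof.
elim: n t x => [|n IH] t x y; first exact: (measurable_const (x = y)).
apply: (discrete_bind (F := fun z => [set e | walk e (t - 1) n z = y])
  (@discrete_hop _ _ t x)) => z; exact: IH.
Qed.

Lemma hop_local e e' t x : (forall q, e (t, q) = e' (t, q)) ->
  hop e t x = hop e' t x.
Proof.
have sub f f' y : (forall q, f (t, q) = f' (t, q)) -> wins f t x y ->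
  wins f' t x y.
  move=> ff' [oy wy]; split; first by rewrite /openat -ff'.
  by move=> z zy; rewrite /openat /beats -!ff'; exact: wy.
move=> ee'; rewrite /hop; congr (xget _ _); apply/seteqP.
by split=> y; apply: sub => // q; rewrite ee'.
Qed.

Lemma walk_local e e' t n x : (forall t' q, t' <= t ->
  e (t', q) = e' (t', q)) ->
  walk e t n x = walk e' t n x.
Proof.
elim: n t x => [//|n IH] t x ee'; rewrite !walkS (@hop_local e e'); last first.
  by move=> q; exact: ee'.
by apply: IH => t' q t't; apply: ee'; lia.
Qed.

Definition prob (A : set env) : R := fine (nu A).

Lemma prob_ge0 A : 0 <= prob A.
Proof. by rewrite fine_ge0. Qed.

Lemma prob_le1 A : measurable A -> prob A <= 1.
Proof.
move=> mA; rewrite -lee_fin fineK ?fin_num_measure//; exact: probability_le1.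
Qed.

Lemma probE A : measurable A -> nu A = (prob A)%:E.
Proof. by move=> mA; rewrite fineK// fin_num_measure. Qed.

(* The environment at level [t] is independent of that at the levels below, *)
(* so a first step may be averaged out.                                     *)
Lemma first_step t x x' (B : site k -> site k -> set env) :
  (forall y y', measurable (B y y')) ->
  (forall y y' e e', (forall t' q, t' <= t - 1 -> e (t', q) = e' (t', q)) ->
     B y y' e -> B y y' e') ->
  prob [set e | B (hop e t x) (hop e t x') e] =
  expect nu (fun e => prob (B (hop e t x) (hop e t x'))).
Proof.
move=> mB locB.
have mA : measurable [set e | B (hop e t x) (hop e t x') e].
  apply: (discrete_bind (F := fun v : site k * site k => B v.1 v.2)
    (discrete_pair (@discrete_hop _ _ t x) (@discrete_hop _ _ t x'))) => v.
  exact: mB.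
(* The two hops read only the keys of [J], and the event [B] only keys of lower levels. *)
pose J : {pred key k} := [pred q | q.1 == t].
rewrite {1}/prob (resample (law_ind law) J mA) /expect /Rintegral; congr fine.
apply: eq_integral => f _; rewrite -probE//; congr (nu _).
have hopf g y : hop (mix J f g) t y = hop f t y.
  by apply: hop_local => q; rewrite /mix inE eqxx.
apply/seteqP; split=> g /=; rewrite !hopf; apply: locB => t' q t't;
  rewrite /mix inE ifF//=; apply/eqP => tt; move: t't; rewrite tt; lia.
Qed.

Lemma measurable_neq (X Y : env -> site k) : discrete X -> discrete Y ->
  measurable [set e | X e <> Y e].
Proof.
move=> dX dY; have dXY := discrete_pair dX dY.
exact: (@discrete_pred _ _ _ _ [set v : site k * site k | v.1 <> v.2] dXY).
Qed.

Definition apart t x x' : set env :=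
  [set e | forall n, walk e t n x <> walk e t n x'].

Definition met n t x x' : set env := [set e | walk e t n x = walk e t n x'].

Lemma measurable_apart t x x' : measurable (apart t x x').
Proof.
apply: measurable_forall => n.
by apply: measurable_neq; exact: discrete_walk.
Qed.

Lemma measurable_met n t x x' : measurable (met n t x x').
Proof.
have dXY := discrete_pair (@discrete_walk t n x) (@discrete_walk t n x').
exact: (@discrete_pred _ _ _ _ [set v : site k * site k | v.1 = v.2] dXY).
Qed.

Lemma apart_step t x x' : x <> x' ->
  prob (apart t x x') =
  expect nu (fun e => prob (apart (t - 1) (hop e t x) (hop e t x'))).
Proof.
move=> xx'; rewrite -(@first_step t x x' (apart (t - 1))).
- congr prob; apply/seteqP; split=> e /= a n; first exact: (a n.+1).
  by case: n => [//|n]; exact: a.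
- exact: measurable_apart.
- move=> y y' e e' ee' a n.
  by rewrite -!(@walk_local e e')//; exact: a.
Qed.

Lemma met_step n t x x' :
  prob (met n.+1 t x x') =
  expect nu (fun e => prob (met n (t - 1) (hop e t x) (hop e t x'))).
Proof.
rewrite -(@first_step t x x' (met n (t - 1)))//.
- exact: measurable_met.
- by move=> y y' e e' ee' a; rewrite /met/= -!(@walk_local e e').
Qed.

Lemma apart_refl t x : prob (apart t x x) = 0.
Proof.
rewrite /prob (_ : apart t x x = set0) ?measure0//.
by apply/seteqP; split=> // e /(_ 0%N).
Qed.

Lemma intg_hops t x x' (f : site k -> site k -> R) (c : R) :
  (forall v v', `|f v v'| <= c) ->
    intg nu (fun e => f (hop e t x) (hop e t x')).
Proof.
move=> fc; apply: intg_bounded (fun e => fc _ _).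
have dXY := discrete_pair (@discrete_hop R _ t x) (@discrete_hop R _ t x').
exact: (discrete_measurable_fun (fun v : site k * site k => f v.1 v.2) dXY).
Qed.

Lemma prob_neq t x x' : prob [set e | hop e t x <> hop e t x'] =
  expect nu (fun e => (hop e t x != hop e t x')%:R).
Proof.
rewrite /prob -expect_indic; last by apply: measurable_neq; exact: discrete_hop.
apply: eq_expect => e; rewrite indicE; congr (_%:R).
by case: eqP => /= h; [rewrite memNset//=; exact|rewrite mem_set].
Qed.

(** If [x] is the only open site of a large cube around [x'], both walks step to [x]. *)
Lemma coalescence_lb (M : R) : exists2 delta : R, 0 < delta <= 1 &
  forall t x x', lg (x - x') <= M ->
    prob [set e | hop e t x <> hop e t x'] <= 1 - delta.
Proof.
pose r := (Num.truncn (expR M : R)).+1.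
have p0 := law_gt0 law; have p1 := law_lt1 law.
have q0 : 0 < 1 - p by rewrite subr_gt0.
exists (p * (1 - p) ^+ size (@l1_ball k r)).
  rewrite mulr_gt0 ?exprn_gt0//=; apply: mulr_ile1;
    rewrite ?(ltW p0) ?(ltW p1)//.
    by rewrite exprn_ge0// ltW.
  by apply: exprn_ile1; [exact: ltW|rewrite gerBl ltW].
move=> t x x' wM.
have wr : (l1 (x - x') <= r)%N.
  rewrite -(ler_nat R); apply: le_trans (l1_le_sqn _) _.
  apply: (@le_trans _ _ (expR M)); last exact/ltW/truncnS_gt.
  apply: (@le_trans _ _ (1 + sqn (x - x'))); first by rewrite lerDr.
  by rewrite -[leLHS]lnK ?posrE ?ler_expR// ltr_pwDl// sqn_ge0.
have h := hop_eq_prob law t wr.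
have mA : measurable [set e : env | hop e t x' = x /\ hop e t x = x].
  by apply: measurableI; exact: discrete_hop.
have mB : measurable [set e : env | hop e t x <> hop e t x'].
  by apply: measurable_neq; exact: discrete_hop.
rewrite probE// lee_fin in h.
suff : prob [set e : env | hop e t x' = x /\ hop e t x = x] +
       prob [set e | hop e t x <> hop e t x'] <= 1.
  by move=> h1; rewrite lerBrDl (le_trans _ h1)// lerD2r.
rewrite -lee_fin EFinD -!probE// -measureU//.
- by apply: probability_le1; exact: measurableU.
- by apply/seteqP; split=> // e [/= [-> ->]].
Qed.

Lemma lnln_le (M : R) x : lnln x <= M -> lg x <= expR M :> R.
Proof.
rewrite /lnln => h; have l0 := lg_ge0 x : 0 <= lg x :> R.
apply: (@le_trans _ _ (1 + lg x)); first by rewrite lerDr.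
by rewrite -[leLHS]lnK ?posrE ?ler_expR// ltr_pwDl.
Qed.

(* For [s] an upper bound of the probabilities, the maximum principle is *)
(* applied to [a - eps * lnln], which is negative far away: it gives     *)
(* [a <= (1 - dF) * s + eps * lnln], and [eps] tends to 0.               *)
Lemma apart_null : (k <= 2)%N -> forall t x x', prob (apart t x x') = 0.
Proof.
move=> k2; have [M drift] := lnln_drift law i0 k2.
have [dF /andP[dF0 dF1] coalF] := coalescence_lb M.
pose a (q : int * site k * site k) : R := prob (apart q.1.1 q.1.2 q.2).
have a0 q : 0 <= a q by exact: prob_ge0.
have a1 q : a q <= 1 by apply: prob_le1; exact: measurable_apart.
have step t x x' : x <> x' ->
    a (t, x, x') = expect nu (fun e => a (t - 1, hop e t x, hop e t x')).
  exact: apart_step.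
have intga t x x' : intg nu (fun e => a (t - 1, hop e t x, hop e t x')).
  apply: (@intg_hops t x x' (fun v v' => a (t - 1, v, v')) 1) => v v'.
  by rewrite ger0_norm.
have intg1 t x x' : intg nu (fun e => (hop e t x != hop e t x')%:R).
  apply: (@intg_hops t x x' (fun v v' => (v != v')%:R) 1) => v v'.
  by case: (v != v'); rewrite ?normr1 ?normr0.
have intgn (c : R) t x x' : intg nu (fun e => c * (hop e t x != hop e t x')%:R).
  exact: intgZ.
suff ale0 q : a q <= 0.
  by move=> t x x'; apply/eqP; rewrite eq_le prob_ge0 andbT (ale0 (t, x, x')).
move: q; apply: (contraction_le0 dF0); first by exists 1.
move=> s s0 as_.
(* Inside the ball, one step merges the walks with probability at least [dF]; otherwise [s] is still
   a bound. *)
have near t x x' : lg (x - x') <= M -> a (t, x, x') <= (1 - dF) * s.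
  move=> wM; have [<-|xx'] := pselect (x = x').
    by rewrite /a apart_refl mulr_ge0// subr_ge0.
  rewrite step//; apply: (@le_trans _ _ (expect nu (fun e =>
    s * (hop e t x != hop e t x')%:R))).
    apply: expect_le => // e; case: eqP => [<-|_]; last by rewrite mulr1.
    by rewrite /a apart_refl mulr0.
  by rewrite expectZ// -prob_neq mulrC ler_wpM2r// coalF.
suff eps_bound (eps : R) : 0 < eps -> forall q,
    a q - eps * lnln (q.1.2 - q.2) - (1 - dF) * s <= 0.
  move=> q; apply/ler_addgt0Pr => eps eps0.
  have l0 : 0 < 1 + lnln (q.1.2 - q.2) :> R by rewrite ltr_pwDl// lnln_ge0.
  have := eps_bound (eps / (1 + lnln (q.1.2 - q.2))) (divr_gt0 eps0 l0) q.
  have : eps / (1 + lnln (q.1.2 - q.2)) * lnln (q.1.2 - q.2) <= eps.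
    rewrite mulrAC ler_pdivrMr// ler_wpM2l ?(ltW eps0)//; lra.
  lra.
move=> eps0.
(* Where [lnln] exceeds [eps^-1] the function [a - eps * lnln] is negative; on the remaining bounded
   region, mergers have probability at least [dG], which yields the inner contraction. *)
have [dG /andP[dG0 dG1] coalG] := coalescence_lb (expR eps^-1).
have m0 : 0 <= (1 - dF) * s by rewrite mulr_ge0// subr_ge0.
apply: (contraction_le0 dG0).
  exists 1 => q; have := a1 q.
  have : 0 <= eps * lnln (q.1.2 - q.2) by rewrite mulr_ge0 ?(ltW eps0)//
    lnln_ge0.
  lra.
move=> b b0 fb [[t x] x'] /=.
have db0 : 0 <= (1 - dG) * b by rewrite mulr_ge0// subr_ge0.
have V0 v : 0 <= eps * lnln v by rewrite mulr_ge0 ?(ltW eps0)// lnln_ge0.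
have [wM|wM] := leP (lg (x - x') : R) M.
  by have := near t x x' wM; have := V0 (x - x'); lra.
have [xx'|xx'] := pselect (x = x').
  by rewrite /a/= xx' apart_refl; have := V0 (x' - x'); lra.
have [wG|wG] := leP (lnln (x - x') : R) eps^-1; last first.
  have : 1 <= eps * lnln (x - x') by rewrite -ler_pdivrMl// mulr1 ltW.
  by have := a1 (t, x, x'); lra.
have dr := drift t x x' xx' (ltW wM).
have intV := intg_lnln law i0 t x x'.
have intV' : intg nu (fun e =>
  - eps * lnln (hop e t x - hop e t x')) by exact: intgZ.
have intaV := intgD (intga t x x') intV'.
(* On a merger [a] vanishes; otherwise the bound [b] on the whole function applies to the new
   pair. *)
have bn : expect nu (fun e => a (t - 1, hop e t x, hop e t x') +
    - eps * lnln (hop e t x - hop e t x')) <=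
    expect nu (fun e => (1 - dF) * s + b * (hop e t x != hop e t x')%:R).
  apply: expect_le => //; first by apply: intgD => //; exact: intg_cst.
  move=> e; case: eqP => [<-|_].
    by rewrite /a apart_refl mulr0; have := V0 (hop e t x - hop e t x); lra.
  by have := fb (t - 1, hop e t x, hop e t x'); rewrite /= mulr1; lra.
have en : expect nu (fun e => b * (hop e t x != hop e t x')%:R) <= (1 - dG) * b.
  by rewrite expectZ// -prob_neq mulrC ler_wpM2r// coalG// lnln_le.
have eV : eps * expect nu (fun e => lnln (hop e t x - hop e t x')) <=
    eps * lnln (x - x') by rewrite ler_wpM2l ?(ltW eps0).
have intm : intg nu (fun=> (1 - dF) * s) by exact: intg_cst.
rewrite !expectD// expect_cst -step// expectZ// in bn.
move: bn en eV; clear; lra.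
Qed.

Lemma met_mono n t x x' : met n t x x' `<=` met n.+1 t x x'.
Proof.
move=> e h; have : walk e t (n + 1) x = walk e t (n + 1) x' by rewrite !walkD h.
by rewrite addn1.
Qed.

(** With [C = 1 + M], [C * invln] is at least 1 on the ball where [lg <= M], and outside it does not
    increase in mean. Induction on the number of steps follows. *)
Lemma met_bound : (3 <= k)%N -> exists C : R, forall n t x x',
  prob (met n t x x') <= C * invln (x - x').
Proof.
move=> k3; have [M0 drift] := invln_drift law i0 k3.
(* Nonnegativity of [M] puts the case [x = x'], where [lg] is 0, inside the ball. *)
pose M := Num.max M0 0.
have M_ge0 : 0 <= M by rewrite le_max lexx orbT.
exists (1 + M); elim => [|n IH] t x x'.
  have [wM|wM] := leP (lg (x - x') : R) M.
    apply: (@le_trans _ _ 1); first by apply: prob_le1; exact: measurable_met.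
    rewrite -ler_pdivrMr ?invln_gt0// /invln invrK mul1r lerD2l//.
  rewrite /prob (_ : met 0 t x x' = set0); last first.
    apply/seteqP; split=> // e; rewrite /met/= => xx'; move: wM.
    by rewrite xx' subrr ltNge; move/negP; apply;
      rewrite /lg /sqn big1 ?addr0 ?ln1// =>
      i _; rewrite coord0 expr0n.
  by rewrite measure0 mulr_ge0 ?(ltW (invln_gt0 _))// addr_ge0.
have [wM|wM] := leP (lg (x - x') : R) M.
  apply: (@le_trans _ _ 1); first by apply: prob_le1; exact: measurable_met.
  rewrite -ler_pdivrMr ?invln_gt0// /invln invrK mul1r lerD2l//.
have xx' : x <> x'.
  move=> xx'; move: wM; rewrite xx' subrr ltNge; move/negP; apply.
  by rewrite /lg /sqn big1 ?addr0 ?ln1// => i _; rewrite coord0 expr0n.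
rewrite met_step; apply: (@le_trans _ _ (expect nu (fun e =>
    (1 + M) * invln (hop e t x - hop e t x')))).
  apply: expect_le => //.
    apply: (@intg_hops t x x' (fun v v' => prob (met n (t - 1) v v')) 1) =>
      v v'.
    by rewrite ger0_norm ?prob_ge0// prob_le1//; exact: measurable_met.
  by apply: intgZ; exact: (intg_invln law).
rewrite expectZ; last exact: (intg_invln law).
rewrite ler_wpM2l ?addr_ge0// drift//.
by apply: le_trans (ltW wM); rewrite le_max lexx.
Qed.

Definition meet t x x' : set env := [set e | exists n,
  walk e t n x = walk e t n x'].

(** Walks that have met stay together, so the events [met n] increase to [meet] and the uniform
    bound passes to the limit. *)
Lemma meet_bound : (3 <= k)%N -> exists C : R, forall t x x',
  (nu (meet t x x') <= (C * invln (x - x'))%:E)%E.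
Proof.
move=> k3; have [C bound] := met_bound k3; exists C => t x x'.
have -> : meet t x x' = \bigcup_n met n t x x'.
  by apply/seteqP; split=> e [n]; exists n.
have mmet : measurable (\bigcup_n met n t x x').
  by apply: bigcupT_measurable => n; exact: measurable_met.
have nd : {homo (fun n => met n t x x') : m n / (m <= n)%N >-> (m <= n)%O}.
  by apply/nondecreasing_seqP => n; apply/subsetPset; exact: met_mono.
have cv : (nu \o (fun n => met n t x x')) @ \oo --> nu (\bigcup_n met n t x x').
  by apply: nondecreasing_cvg_mu => // n; exact: measurable_met.
rewrite -(cvg_lim _ cv)//; apply: lime_le; first exact: cvgP cv.
apply: nearW => n /=; rewrite probE; last exact: measurable_met.
by rewrite lee_fin.
Qed.

End walks.

(** * Almost sure properties of the environment *)

Lemma ae_forall_countable {d} {T : measurableType d} {R : realType}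
    (mu : {measure set T -> \bar R}) (K : countType) (P : K -> T -> Prop) :
  (forall i, {ae mu, forall x, P i x}) -> {ae mu, forall x, forall i, P i x}.
Proof.
move=> aeP; rewrite /almost_everywhere/=.
pose F n := if unpickle n is Some i then ~` [set x | P i x] else set0.
apply: (@negligibleS _ _ _ mu (\bigcup_n F n)).
  move=> x /= /existsNP[i nPi]; exists (pickle i) => //.
  by rewrite /F pickleK.
apply: negligible_bigcup => n; rewrite /F; case: unpickle => [i|].
  exact: aeP.
exact: negligible_set0.
Qed.

Section exists_seq.
Context {d} {T : measurableType d} {I : eqType}.
Implicit Types (s : seq I) (F : I -> set T).

Lemma exists_seq_cons i s F : [set x | exists2 j, j \in i :: s & F j x] =
  F i `|` [set x | exists2 j, j \in s & F j x].
Proof.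
apply/seteqP; split=> x /=.
  by move=> [j]; rewrite inE => /predU1P[->|js Fj]; [left|right; exists j].
by move=> [Fi|[j js Fj]]; [exists i|exists j]; rewrite ?inE ?eqxx ?js ?orbT.
Qed.

Lemma measurable_exists_seq s F : (forall i, measurable (F i)) ->
  measurable [set x | exists2 i, i \in s & F i x].
Proof.
move=> mF; elim: s => [|i s IH].
  rewrite (_ : [set _ | _] = set0); first exact: measurable0.
  by apply/seteqP; split=> // x [].
by rewrite exists_seq_cons; exact: measurableU.
Qed.

Lemma measure_exists_seq {R : realType} (mu : {measure set T ->
  \bar R}) s F (b : R) :
  (forall i, measurable (F i)) -> (forall i, i \in s -> (mu (F i) <= b%:E)%E) ->
  (mu [set x | exists2 i, i \in s & F i x] <= ((size s)%:R * b)%:E)%E.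
Proof.
move=> mF; elim: s => [_|i s IH Fb].
  rewrite (_ : [set _ | _] = set0) ?measure0 ?mul0r//.
  by apply/seteqP; split=> // x [].
rewrite exists_seq_cons.
apply: (le_trans (measureU2 mu (mF i) (measurable_exists_seq s mF))).
have -> : ((size (i :: s))%:R * b)%:E = (b%:E + ((size s)%:R * b)%:E)%E.
  by rewrite -EFinD /= -natr1 mulrDl mul1r addrC.
apply: leeD.
  by apply: Fb; rewrite inE eqxx.
by apply: IH => j js; apply: Fb; rewrite inE js orbT.
Qed.

End exists_seq.

Lemma ae_null {d} {T : measurableType d} {R : realType}
    (mu : {measure set T -> \bar R}) (P : T -> Prop) :
  measurable [set x | ~ P x] -> mu [set x | ~ P x] = 0%E ->
  {ae mu, forall x, P x}.
Proof. by move=> mP P0; exists [set x | ~ P x]; split. Qed.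

Lemma seq_argmin d (O : orderType d) (T : eqType) (f : T -> O) (s : seq T) :
  s != [::] -> exists2 x, x \in s & forall y, y \in s -> (f x <= f y)%O.
Proof.
elim: s => [//|a s IH] _; have [->|/IH[x xs fx]] := eqVneq s [::].
  by exists a; rewrite ?inE// => y; rewrite inE => /eqP ->.
have [fax|fxa] := leP (f a) (f x).
  exists a; rewrite ?inE ?eqxx// => y; rewrite inE => /predU1P[->//|/fx].
  exact: le_trans.
exists x; rewrite ?inE ?xs ?orbT// => y; rewrite inE => /predU1P[->|/fx//].
exact: ltW.
Qed.

Section almost_sure.
Context {R : realType} {k : nat}.
Notation env := (@realfam R (key k)).
Context {p : R} {nu : probability env R}.
Hypothesis law : drainage_law p nu.
Variable i0 : 'I_k.
Implicit Types (e : env) (t : int) (x y z v : site k) (n : nat).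

(** Finitely many open sites realise the least distance, and among them the least label is strict
    when there are no ties. *)
Lemma wins_exists e t x z0 : openat e t z0 ->
  (forall z z', z != z' -> e (t, inr (x, z)) != e (t, inr (x, z'))) ->
  exists y, wins e t x y.
Proof.
move=> oz0 noties.
pose P n := `[< exists2 z, openat e t z & l1 (z - x) = n >].
have exP : exists n, P n by exists (l1 (z0 - x)); apply/asboolP; exists z0.
have [n Pn minn] := ex_minnP exP.
pose s := [seq z <- [seq x + v | v <- l1_ball n] | `[< openat e t z >] && (l1
  (z - x) == n)].
have ms z : (z \in s) = `[< openat e t z >] && (l1 (z - x) == n).
  rewrite mem_filter andb_idr// => /andP[_ /eqP zn]; apply/mapP.
  by exists (z - x); rewrite ?mem_l1_ball ?zn// addrC subrK.
have s0 : s != [::].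
  move/asboolP: Pn => [z oz zn]; suff : z \in s by case: s {ms}.
  by rewrite ms zn eqxx andbT; apply/asboolP.
have [y] := seq_argmin (fun z => e (t, inr (x, z))) s0.
rewrite ms => /andP[/asboolP oy /eqP yn] miny.
exists y; split=> // z zy oz; rewrite /beats yn.
have nz : (n <= l1 (z - x))%N by apply: minn; apply/asboolP; exists z.
move: nz; rewrite leq_eqVlt => /predU1P[nz|]; [right|by left].
split=> //; rewrite lt_neqAle miny ?andbT; last by rewrite ms -nz eqxx andbT;
  apply/asboolP.
by apply: noties; apply/eqP => /esym.
Qed.

Lemma measurable_coord_eq (q q' : key k) : measurable [set e :
  env | e q = e q'].
Proof.
have := @measurable_fun_eqr _ _ _ setT _ _ (@measurable_coord R _ q)
  (@measurable_coord R _ q') measurableT [set true] I.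
rewrite setTI; congr measurable; apply/seteqP; split=> e /=; first by move/eqP.
by move=> ->; rewrite eqxx.
Qed.

(** Given one label, the other is independent of it and has no atoms. *)
Lemma tie_null t x z z' : z != z' ->
  nu [set e | e (t, inr (x, z)) = e (t, inr (x, z'))] = 0%E.
Proof.
move=> zz'; pose q : key k := (t, inr (x, z));
  pose q' : key k := (t, inr (x, z')).
have mA := measurable_coord_eq q q'.
rewrite (resample (law_ind law) (pred1 q) mA).
rewrite -[RHS](@integral0 _ _ _ nu setT); apply: eq_integral => f _.
rewrite -[RHS](law_atomless law t (x, z') (f q)) /marginal; congr (nu _).
have q'q : (q' \in pred1 q) = false.
  by rewrite inE; apply/eqP => -[] /eqP; rewrite eq_sym (negPf zz').
by apply/seteqP; split=> g /=; rewrite /mix inE eqxx q'q => ->.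
Qed.

Lemma no_open_null t : nu [set e | forall z, ~ openat e t z] = 0%E.
Proof.
have p0 := law_gt0 law; have p1 := law_lt1 law.
have mA : measurable [set e : env | forall z, ~ openat e t z].
  by apply: measurable_forall => z; apply: measurableC;
    exact: measurable_openat.
have bound n : (nu [set e | forall z, ~ openat e t z] <= ((1 - p) ^+ n)%:E)%E.
  have us : uniq [seq axis i0 i | i <- iota 0 n].
    by rewrite map_inj_uniq ?iota_uniq//; exact: axis_inj.
  rewrite -(size_iota 0 n) -(size_map (axis i0)) -(closed_prob law t us).
  apply: le_measure; rewrite ?inE//; last by move=> e eA z _; exact: eA.
  apply: measurable_forall => z.
  apply: (@measurable_imply _ _ [set e | z \in _] (~` [set e | openat e t z])).
    exact: measurable_const.
  by apply: measurableC; exact: measurable_openat.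
apply/eqP; rewrite eq_le measure_ge0 andbT.
rewrite probE// lee_fin; apply/ler_addgt0Pr => eps eps0; rewrite add0r.
have q1 : `|1 - p| < 1 by rewrite ger0_norm ?subr_ge0 ?(ltW p1)// gtrBl.
have /cvgrPdist_lt/(_ _ eps0)[N _ small] := cvg_geometric 1 q1.
have := bound N; rewrite probE// lee_fin => /le_trans; apply.
have := small N (leqnn N); rewrite /= mul1r sub0r normrN => /ltW.
exact/le_trans/ler_norm.
Qed.

Lemma ae_wins : {ae nu, forall e, forall q :
  int * site k, exists y, wins e q.1 q.2 y}.
Proof.
have op : {ae nu, forall e, forall t, exists z, openat e t z}.
  apply: ae_forall_countable => t.
  have E : [set e : env | ~ exists z, openat e t z] = [set e | forall z,
    ~ openat e t z].
    apply/seteqP; split=> e /=; first by move=> ne z oz; apply: ne; exists z.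
    by move=> ne [z oz]; exact: (ne z).
  apply: ae_null; rewrite E; last exact: no_open_null.
  by apply: measurable_forall => z; apply: measurableC;
    exact: measurable_openat.
have ties : {ae nu, forall e, forall q : int * site k * site k * site k,
    q.1.2 != q.2 -> e (q.1.1.1, inr (q.1.1.2, q.1.2)) != e (q.1.1.1,
      inr (q.1.1.2, q.2))}.
  apply: ae_forall_countable => -[[[t x] z] z'] /=.
  have [->|zz'] := eqVneq z z'; first exact: aeW.
  have E : [set e : env | ~ (~~ false ->
    e (t, inr (x, z)) != e (t, inr (x, z')))] =
      [set e : env | e (t, inr (x, z)) = e (t, inr (x, z'))].
    apply/seteqP; split=> e /=.
      by move=> ne; apply/eqP; apply: contra_notT ne.
    by move=> -> /(_ isT); rewrite eqxx.
  apply: ae_null; rewrite E; last exact: tie_null.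
  exact: measurable_coord_eq.
apply: filterS2 op ties => e op ties [t x].
have [z oz] := op t; apply: (wins_exists oz) => y y' yy'.
exact: (ties (t, x, y, y')).
Qed.

Lemma ae_meet : (k <= 2)%N ->
  {ae nu, forall e, forall q : int * site k * site k, meet q.1.1 q.1.2 q.2 e}.
Proof.
move=> k2; apply: ae_forall_countable => -[[t x] x'] /=.
have E : [set e : env | ~ meet t x x' e] = apart t x x'.
  apply/seteqP; split=> e /=; first by move=> ne n en; apply: ne; exists n.
  by move=> ap [n]; exact: ap.
have mA := @measurable_apart R _ t x x'.
have nA : nu (apart t x x') = 0%E.
  by rewrite (@probE _ _ nu _ mA) (apart_null law i0).
by apply: ae_null; rewrite E.
Qed.

Lemma invln_axis_small (eps : R) : 0 < eps -> exists r : nat,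
  forall n, (r <= n)%N -> invln (axis i0 n) <= eps.
Proof.
move=> eps0; exists (Num.truncn (expR eps^-1 : R)).+1 => n rn.
have lgn : eps^-1 <= lg (axis i0 n).
  rewrite -ler_expR /lg lnK ?posrE; last by rewrite ltr_pwDl// sqn_ge0.
  apply: (@le_trans _ _ n%:R).
    by apply/ltW/(lt_le_trans (truncnS_gt _)); rewrite ler_nat.
  by have := l1_le_sqn (axis i0 n) : _ <= _ :> R; rewrite l1_axis; lra.
rewrite /invln -[leRHS]invrK lef_pV2 ?posrE ?invr_gt0//; first by lra.
by rewrite ltr_pwDl// lg_ge0.
Qed.

Lemma axisB m n : (m <= n)%N -> axis i0 n - axis i0 m = axis i0 (n - m).
Proof.
move=> mn; apply/ffunP => i; rewrite siteB !ffunE; case: eqP => _;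
  last by rewrite subrr.
by rewrite subzn.
Qed.

(** For fixed [n], a union bound over pairs makes the probability that spacing [r] fails tend to 0
    as [r] grows, so that almost surely some spacing, depending on the environment, works. *)
Lemma ae_apart : (3 <= k)%N -> {ae nu, forall e, forall n, exists r : nat,
  forall i j, (i < j < n)%N -> ~ meet 0 (axis i0 (j * r)) (axis i0 (i * r)) e}.
Proof.
move=> k3; have [C bound] := meet_bound law i0 k3.
have mmeet x y : measurable [set e : env | meet 0 x y e].
  by apply: measurable_exists => m; exact: measurable_met.
apply: ae_forall_countable => n.
pose s := [seq (i, j) | i <- iota 0 n, j <- iota 0 n].
pose F r (ij : nat * nat) := if (ij.1 < ij.2)%N
  then meet 0 (axis i0 (ij.2 * r)) (axis i0 (ij.1 * r)) else set0 : set env.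
have mF r ij : measurable (F r ij).
  by rewrite /F; case: ifP => _; [exact: mmeet|exact: measurable0].
pose bad r : set env := [set e | exists2 ij, ij \in s & F r ij e].
have badP r e : ~ bad r e -> forall i j, (i < j < n)%N ->
    ~ meet 0 (axis i0 (j * r)) (axis i0 (i * r)) e.
  move=> nb i j /andP[ij jn] m; apply: nb; exists (i, j);
    last by rewrite /F/= ij.
  by apply/allpairsP; exists (i, j);
    rewrite /= !mem_iota/= add0n jn (ltn_trans ij jn).
have mbad r : measurable (bad r) by exact: measurable_exists_seq.
have E : [set e | ~ exists r, ~ bad r e] = [set e | forall r, bad r e].
  apply/seteqP; split=> e /=; first by move=> ne r; apply: contrapT => nb;
    apply: ne; exists r.
  by move=> eb [r]; exact.
suff : {ae nu, forall e, exists r, ~ bad r e}.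
  by apply: filterS => e [r /badP]; exists r.
have mall : measurable [set e | forall r, bad r e] by exact: measurable_forall.
suff nall : nu [set e | forall r, bad r e] = 0%E by apply: ae_null; rewrite E.
have C0 : 0 <= C.
  have : 0 <= C * invln (0 - 0 : site k).
    by rewrite -lee_fin; apply: le_trans (bound 0 0 0); exact: measure_ge0.
  by rewrite pmulr_lge0// invln_gt0.
apply/eqP; rewrite eq_le measure_ge0 andbT probE// lee_fin.
apply/ler_addgt0Pr => eps eps0; rewrite add0r.
(* Adding 1 keeps the denominator positive when there are no pairs or [C] is 0. *)
have c0 : 0 < (size s)%:R * C + 1 by rewrite ltr_wpDl// mulr_ge0.
have [r small] := invln_axis_small (divr_gt0 eps0 c0).
rewrite -lee_fin -probE//.
apply: (@le_trans _ _ (nu (bad r))).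
  by apply: le_measure; rewrite ?inE// => e; exact.
apply: (@le_trans _ _ ((size s)%:R * (C * (eps / ((size s)%:R * C + 1))))%:E).
  apply: measure_exists_seq => // -[i j] _; rewrite /F/=; case: ifPn => ij;
    last first.
    by rewrite measure0 lee_fin mulr_ge0// divr_ge0// ltW.
  apply: le_trans (bound _ _ _) _; rewrite lee_fin ler_wpM2l//.
  rewrite axisB ?leq_mul2r ?(ltnW ij) ?orbT// -mulnBl; apply: small.
  by rewrite leq_pmull// subn_gt0.
rewrite lee_fin mulrA [_ * (eps / _)]mulrA ler_pdivrMr// mulrC.
by rewrite ler_wpM2l ?(ltW eps0)// lerDl.
Qed.

End almost_sure.

(** * The graph *)

Section undirected_graphs.
Context {T : eqType}.
Variable e : rel T.
Hypothesis e_sym : symmetric e.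

Lemma component_refl x : component e x x.
Proof. by exists [::]. Qed.

Lemma component_trans y x z : component e x y -> component e y z ->
  component e x z.
Proof.
move=> [c pc <-] [c' pc' <-]; exists (c ++ c'); last by rewrite last_cat.
by rewrite cat_path pc.
Qed.

Lemma component_edge x y : e x y -> component e x y.
Proof. by move=> xy; exists [:: y]; rewrite //= xy. Qed.

Lemma component_sym x y : component e x y -> component e y x.
Proof.
move=> [c pc <-] {y}; elim: c x pc => [x _|z c IH x /= /andP[xz pc]].
  exact: component_refl.
apply: component_trans (IH z pc) _.
by apply: component_edge; rewrite e_sym.
Qed.

Lemma component_eq x y : component e x y -> component e x = component e y.
Proof.
move=> xy; apply/seteqP; split=> z; apply: component_trans => //.
exact: component_sym.
Qed.

End undirected_graphs.

Section level_graph.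
Context {T : eqType}.
Variables (V : set T) (g : T -> T) (level : T -> int).
Hypotheses (level_g : forall x, level (g x) = level x - 1) (g_V :
  forall x, V (g x)).

Let e : rel T := fun x y => `[< V x /\ y = g x \/ V y /\ x = g y >].

Lemma level_graph_sym : symmetric e.
Proof. by move=> x y; apply/asboolP/asboolP => -[]; tauto. Qed.

(* Both neighbours in a cycle of a vertex [x] of maximal level are [g x]. *)
Lemma level_graph_forest : forest e.
Proof.
have below x y : e x y -> level y <= level x -> y = g x.
  move=> /asboolP[[_ //]|[_ ->]]; rewrite level_g; lia.
split=> [x|c]; first by apply/asboolP =>
  -[[_ /(congr1 level)]|[_ /(congr1 level)]];
  rewrite level_g; lia.
move=> ucc; rewrite leqNgt; apply/negP => c3.
have c0 : c != [::] by case: (c) c3.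
have [x xc xmax] := seq_argmin (fun x => - level x) c0.
have [i c' ci] := rot_to xc.
have max y : y \in x :: c' -> level y <= level x.
  by rewrite -ci mem_rot => /xmax; rewrite lerN2.
move: ucc c3; rewrite -(rot_ucycle i) -(size_rot i) ci => ucc c3.
case: c' c3 max ucc {ci} => [//|y [//|z s]] _ max /andP[cyc].
have : path e x (rcons [:: y, z & s] x) := cyc.
rewrite rcons_path => /andP[/= /andP[exy _] elast].
move=> /and3P[_ + _]; apply/negP/negPn.
have -> : y = last z s; last by rewrite mem_last.
rewrite (_ : last z s = g x); last first.
  apply: below; first by rewrite level_graph_sym.
  by apply: max; rewrite in_cons in_cons mem_last !orbT.
by apply: below exy _; apply: max; rewrite !inE eqxx orbT.
Qed.

Lemma iter_g_V n x : V x -> V (iter n g x).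
Proof. by case: n => [//|n] _; exact: g_V. Qed.

Lemma component_iter n x : V x -> component e x (iter n g x).
Proof.
move=> Vx; elim: n => [|n IH]; first exact: component_refl.
apply: component_trans IH _; apply: component_edge; apply/asboolP; left.
by split; [exact: iter_g_V|].
Qed.

Lemma level_iter n x : level (iter n g x) = level x - n%:Z.
Proof. by elim: n => [|n IH] /=; rewrite ?subr0// level_g IH; lia. Qed.

(** Each edge joins a vertex to its image under [g], so having a common iterate propagates along a
    path. *)
Lemma component_merge x y : component e x y ->
  exists m n, iter m g x = iter n g y.
Proof.
move=> [c pc <-] {y}; elim: c x pc =>
  [x _|z c IH x /= /andP[exz /IH[m [n mn]]]].
  by exists 0%N, 0%N.
case/asboolP: exz mn => [[_ ->]|[_ ->]] mn; first by exists m.+1, n;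
  rewrite iterSr.
by exists m, n.+1; rewrite -iterSr !iterS mn.
Qed.

End level_graph.

(** * Sites as pairs of a height and a slice; the graph in terms of walks *)

Section lattice.
Context {R : realType} {k : nat}.
Implicit Types (x y z : site k) (t : int) (u v : site k.+1).

Definition emb t x : site k.+1 :=
  [ffun i => if unlift ord_max i is Some j then x j else t].
Definition slice u : site k := [ffun j => u (lift ord_max j)].
Definition level u : int := u ord_max.

Lemma level_emb t x : level (emb t x) = t.
Proof. by rewrite /level ffunE unlift_none. Qed.

Lemma slice_emb t x : slice (emb t x) = x.
Proof. by apply/ffunP => j; rewrite !ffunE liftK. Qed.

Lemma emb_slice u : emb (level u) (slice u) = u.
Proof.
by apply/ffunP => i; rewrite ffunE; case: unliftP => [j ->|->//]; rewrite ffunE.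
Qed.

Lemma emb_inj t t' x x' : emb t x = emb t' x' -> t = t' /\ x = x'.
Proof.
move=> E; split; first by rewrite -(level_emb t x) E level_emb.
by rewrite -(slice_emb t x) E slice_emb.
Qed.

Lemma belowP u v : below u v <-> level v = level u - 1.
Proof.
split=> [|E i ik]; first exact.
by have -> : i = ord_max by apply/val_inj; case: ik.
Qed.

(** The vertical coordinate contributes exactly 1, so nearest vertices below are nearest slices. *)
Lemma dist1_slice u v : below u v -> dist1 v u = (l1 (slice v - slice u)).+1%:Z.
Proof.
move=> /belowP uv; rewrite /dist1 big_ord_recr /= -/(level v) -/(level u) uv.
have -> : `|level u - 1 - level u| = 1 by lia.
rewrite -[(l1 _).+1]addn1 PoszD; congr (_ + _).
rewrite /l1 (big_morph _ PoszD (erefl _)); apply: eq_bigr => i _.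
rewrite siteB !ffunE abszE.
by have -> : widen_ord (leqnSn k) i = lift ord_max i
  by apply/val_inj; rewrite /= /bump leqNgt ltn_ord.
Qed.

Variables (w : config k.+1) (U : site k.+1 * site k.+1 -> R).

Definition environment : @realfam R (key k) := fun q =>
  match q with
  | (t, inl z) => (w (emb (t - 1) z))%:R
  | (t, inr (x, z)) => U (emb t x, emb (t - 1) z)
  end.

Lemma openat_environment t z :
  openat environment t z <-> open_sites w (emb (t - 1) z).
Proof.
rewrite /openat /open_sites/=; case: (w _); split=> //=.
by move=> /esym/eqP; rewrite oner_eq0.
Qed.

Hypothesis winners : forall t x, exists y, wins environment t x y.

(** The strict winner is a nearest open site, and every other nearest one has a larger label: the
    choice made in [h] is forced. *)
Lemma hE u : h w U u = emb (level u - 1) (hop environment (level u) (slice u)).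
Proof.
set t := level u; set x := slice u; have uE : u = emb t x by rewrite emb_slice.
have [y wy] := winners t x; rewrite (wins_hop wy); have [oy by_] := wy.
have below_emb z : below u (emb (t - 1) z) by apply/belowP; rewrite level_emb.
have emb_below v : below u v -> v = emb (t - 1) (slice v).
  by move=> /belowP vt; rewrite -[LHS]emb_slice vt.
have distE z : dist1 (emb (t - 1) z) u = (l1 (z - x)).+1%:Z.
  by rewrite dist1_slice// slice_emb.
have ow : open_sites w (emb (t - 1) y) by apply/openat_environment.
have ny : nearest w u (emb (t - 1) y).
  split=> // z oz uz; rewrite (emb_below z uz) !distE lez_nat ltnS.
  have [->//|zy] := pselect (slice z = y).
  have [|/ltnW//|[-> _]//] := by_ _ zy.
  by apply/openat_environment; rewrite -emb_below.
apply: xget_unique.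
  split=> // z nz; have [oz uz minz] := nz.
  have [<-|zy] := pselect (slice z = y); first by rewrite -emb_below.
  have oz' : openat environment t (slice z).
    by apply/openat_environment; rewrite -emb_below.
  have := minz _ ow (below_emb y);
    rewrite {1}(emb_below z uz) !distE lez_nat ltnS.
  have [zfar|[_ lab]] := by_ _ zy oz'; [by rewrite leqNgt zfar|move=> _].
  by apply/ltW; rewrite uE [X in _ < U (_, X)](emb_below z uz).
move=> z [[oz uz minz] labz].
have [<-|zy] := pselect (slice z = y); first by rewrite -emb_below.
have oz' : openat environment t (slice z).
  by apply/openat_environment; rewrite -emb_below.
have := minz _ ow (below_emb y);
  rewrite {1}(emb_below z uz) !distE lez_nat ltnS.
have [zfar|[_ lab]] := by_ _ zy oz'; [by rewrite leqNgt zfar|move=> _].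
have := labz _ ny; rewrite leNgt => /negP[].
by rewrite uE [X in _ < U (_, X)](emb_below z uz).
Qed.

Lemma level_h u : level (h w U u) = level u - 1.
Proof. by rewrite hE level_emb. Qed.

Lemma open_h u : open_sites w (h w U u).
Proof.
rewrite hE; apply/openat_environment.
have [y wy] := winners (level u) (slice u); rewrite (wins_hop wy).
by case: wy.
Qed.

Lemma iter_h n t x : iter n (h w U) (emb t x) =
  emb (t - n%:Z) (walk environment t n x).
Proof.
elim: n t x => [|n IH] t x; first by rewrite subr0.
rewrite iterSr hE level_emb slice_emb IH walkS; congr emb; lia.
Qed.

(** Connected vertices have a common iterate, and since both start from the same level, comparing
    levels forces equal numbers of steps. *)
Lemma component_merge_walk m t x y :
  component (edge w U) (iter m (h w U) (emb t x)) (iter m (h w U) (emb t y)) ->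
  meet t x y environment.
Proof.
move=> /(@component_merge _ (open_sites w) (h w U))[a [b]].
rewrite -!iterD => ab.
have := congr1 level ab; rewrite !(level_iter level_h) !level_emb => l.
have {}l : (a + m = b + m)%N by lia.
by exists (a + m)%N; move: ab; rewrite -l !iter_h => /emb_inj[].
Qed.

(** Two vertices of the same level are joined through the meeting point of their walks; in general,
    the higher one is first brought down. *)
Lemma single_tree_of_meet : (forall t x y, meet t x y environment) ->
  single_tree (open_sites w) (edge w U).
Proof.
move=> allmeet; split; first exact:
  (@level_graph_forest _ (open_sites w) _ _ level_h).
pose u0 := h w U 0; have o0 : open_sites w u0 by exact: open_h.
exists (component (edge w U) u0).
have sym := @level_graph_sym _ (open_sites w) (h w U).
have same t x y : open_sites w (emb t x) -> open_sites w (emb t y) ->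
    component (edge w U) (emb t x) (emb t y).
  move=> ox oy; have [n xy] := allmeet t x y.
  apply: (component_trans (component_iter open_h n ox)).
  rewrite iter_h xy -iter_h; apply: component_sym => //.
  exact: (@component_iter _ (open_sites w) (h w U) open_h n _ oy).
have conn n u v : open_sites w u -> open_sites w v ->
  level u = level v + n%:Z ->
    component (edge w U) u v.
  move=> ou ov uv; apply: (component_trans (component_iter open_h n ou)).
  have : level (iter n (h w U) u) = level v by rewrite (level_iter level_h) uv
    addrK.
  have : open_sites w (iter n (h w U) u) by exact: iter_g_V open_h n _ ou.
  move: (iter _ _ _) => u' ou' l; rewrite -(emb_slice u') -(emb_slice v) l.
  by apply: same; rewrite ?emb_slice// -l emb_slice.
have all u v : open_sites w u -> open_sites w v -> component (edge w U) u v.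
  move=> ou ov; have [vu|/ltW uv] := leP (level v) (level u).
    by apply: (conn `|level u - level v|%N) => //; lia.
  by apply: component_sym => //; apply: (conn `|level v - level u|%N) => //;
    lia.
apply/seteqP; split=> C /=.
  by move=> [u ou <-]; apply: component_eq => //; exact: all.
by move=> ->; exists u0.
Qed.

(** If there were only [n] components, [n.+1] walks that never meet would give one too many. *)
Lemma infinitely_many_trees_of_apart (i0 : 'I_k) :
  (forall n, exists r : nat, forall i j, (i < j < n)%N ->
    ~ meet 0 (axis i0 (j * r)) (axis i0 (i * r)) environment) ->
  infinitely_many_trees (open_sites w) (edge w U).
Proof.
move=> far; split; first exact:
  (@level_graph_forest _ (open_sites w) _ _ level_h).
move=> /finite_setP[n cn]; have [r sep] := far n.+1.
have sym := @level_graph_sym _ (open_sites w) (h w U).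
(* The starting point on the axis may be closed, but its image under [h] is a vertex: hence one
   iteration. *)
pose f i := component (edge w U) (iter 1 (h w U) (emb 0 (axis i0 (i * r)))).
have finj i j : (i < j < n.+1)%N -> f j <> f i.
  move=> ij fij; apply: (sep i j ij); apply: (@component_merge_walk 1).
  by rewrite -/(f j) -[X in X _]/(f j) fij; exact: component_refl.
have fI : {in `I_n.+1 &, injective f}.
  move=> i j; rewrite !inE/= => ni nj fij.
  case: (ltngtP i j) => // ij.
    by have := @finj i j; rewrite ij nj fij => /(_ isT).
  by have := @finj j i; rewrite ij ni fij => /(_ isT).
have fsub : f @` `I_n.+1 `<=` components (open_sites w) (edge w U).
  move=> _ [i _ <-]; exists (h w U (emb 0 (axis i0 (i * r)))) => //.
  exact: open_h.
have := subset_card_le fsub; have := inj_card_eq fI.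
rewrite card_eq_le => /andP[_ h1] h2; move: cn;
  rewrite card_eq_le => /andP[h3 _].
by have := card_le_trans h1 (card_le_trans h2 h3); rewrite card_le_II ltnn.
Qed.

End lattice.

(** * The law of the environment built from states and labels *)

Section environment_law.
Context {R : realType} {k : nat} {p : R}.
Hypotheses (p_gt0 : 0 < p) (p_lt1 : p < 1).
Context {Pp : probability (config k.+1) R} (hPp : bernoulli_config p Pp).
Context {dX : measure_display} {Xi : measurableType dX} {mu : probability Xi R}.
Context {U : site k.+1 * site k.+1 -> Xi -> R} (hU : uniform_labels mu U).
Implicit Types (t : int) (x z : site k) (q : key k).

Definition envof (a : config k.+1 * Xi) : @realfam R (key k) :=
  environment a.1 (fun uv => U uv a.2).

Lemma below_emb t x z : below (emb t x) (emb (t - 1) z).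
Proof. by apply/belowP; rewrite !level_emb. Qed.

Lemma measurable_site u (B : set bool) :
  measurable [set w : config k.+1 | B (w u)].
Proof.
have [mw _ _] := hPp; have := mw u I measurableT B I.
by rewrite setTI.
Qed.

Lemma measurable_labels uv (A : set R) : below uv.1 uv.2 -> measurable A ->
  measurable [set xi : Xi | A (U uv xi)].
Proof.
move=> uvb mA; have [mU _ _] := hU; have := mU uv uvb measurableT A mA.
by rewrite setTI.
Qed.

Lemma measurable_envof : measurable_fun setT envof.
Proof.
apply: measurable_to_realfam => -[t [z|[x z]]] /=.
  move=> _ A mA; rewrite setTI.
  rewrite (_ : _ @^-1` _ = [set w : config k.+1 | [set b : bool | A b%:R]
    (w (emb (t - 1) z))] `*` setT); first by apply: measurableX => //;
      exact: measurable_site.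
  by apply/seteqP; split=> -[w xi] //= [].
move=> _ A mA; rewrite setTI.
rewrite (_ : _ @^-1` _ = setT `*` [set xi | A (U (emb t x, emb (t - 1) z) xi)]).
  apply: measurableX => //; apply: measurable_labels => //; exact: below_emb.
by apply/seteqP; split=> -[w xi] //= [].
Qed.

Definition envof_mfun : {mfun (config k.+1 * Xi)%type >-> @realfam R (key k)} :=
  HB.pack envof (isMeasurableFun.Build _ _ _ _ _ measurable_envof).

Definition env_law : probability (@realfam R (key k)) R :=
  distribution (Pp \x mu)%E envof_mfun.

Lemma env_lawE A : env_law A = (Pp \x mu)%E (envof @^-1` A).
Proof. by []. Qed.

Lemma marginal_site t z A : measurable A ->
  marginal env_law (t, inl z) A = bernoulli_prob p [set b : bool | A b%:R].
Proof.
move=> mA; have [_ lw _] := hPp; rewrite -(lw (emb (t - 1) z) I)//.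
rewrite /marginal env_lawE (_ : _ @^-1` _ = [set w : config k.+1 |
    [set b : bool | A b%:R] (w (emb (t - 1) z))] `*` setT).
  rewrite product_measure1E//; last exact: measurable_site.
  by rewrite [X in (_ * X)%E]probability_setT mule1.
by apply/seteqP; split=> -[w xi] //= [].
Qed.

Lemma marginal_label t (q : site k * site k) A : measurable A ->
  marginal env_law (t, inr q) A = uniform_prob (@ltr01 R) A.
Proof.
case: q => x z mA; have [_ lU _] := hU.
rewrite -(lU (emb t x, emb (t - 1) z) (below_emb t x z) A mA).
rewrite /marginal env_lawE (_ : _ @^-1` _ =
    setT `*` [set xi | A (U (emb t x, emb (t - 1) z) xi)]).
  rewrite product_measure1E//; last first.
    by apply: measurable_labels => //; exact: below_emb.
  by rewrite [X in (X * _)%E]probability_setT mul1e.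
by apply/seteqP; split=> -[w xi] //= [].
Qed.

Let is_site q := if q.2 is inl _ then true else false.

Let site_of q : site k.+1 := if q is (t, inl z) then emb (t - 1) z else 0.

(** The shift by 1 is there because the key of head [t] carries the state of a vertex at height
    [t - 1]. *)
Let key_of_site (u : site k.+1) : key k := (level u + 1, inl (slice u)).

Let pair_of q : site k.+1 * site k.+1 :=
  if q is (t, inr (x, z)) then (emb t x, emb (t - 1) z) else (0, 0).

Let key_of_pair (uv : site k.+1 * site k.+1) : key k :=
  (level uv.1, inr (slice uv.1, slice uv.2)).

Let site_ofK q : is_site q -> key_of_site (site_of q) = q.
Proof.
by case: q => t [z|//] _; rewrite /key_of_site /= level_emb slice_emb subrK.
Qed.

Let pair_ofK q : ~~ is_site q -> key_of_pair (pair_of q) = q.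
Proof.
by case: q => t [//|[x z]] _; rewrite /key_of_pair /= level_emb !slice_emb.
Qed.

(** State keys and label keys correspond injectively to sites and to pairs one level apart. A box is
    thus the product of an event on states and an event on labels, each of which factorises. *)
Lemma env_law_independent : independent_coords env_law.
Proof.
move=> s A us mA.
pose s1 := [seq site_of q | q <- s & is_site q].
pose s2 := [seq pair_of q | q <- s & ~~ is_site q].
pose B1 u := [set b : bool | A (key_of_site u) b%:R].
pose B2 uv := A (key_of_pair uv).
have us1 : uniq s1.
  rewrite map_inj_in_uniq ?filter_uniq// => q q'.
  rewrite !mem_filter => /andP[sq _] /andP[sq' _] E.
  by rewrite -(site_ofK sq) E site_ofK.
have us2 : uniq s2.
  rewrite map_inj_in_uniq ?filter_uniq// => q q'.
  rewrite !mem_filter => /andP[sq _] /andP[sq' _] E.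
  by rewrite -(pair_ofK sq) E pair_ofK.
have sub2 : [set` s2] `<=` [set uv | below uv.1 uv.2].
  move=> uv /= /mapP[[t [z|[x z]]]]; rewrite mem_filter => /andP[//= _ _] ->.
  exact: below_emb.
have [_ _ ind1] := hPp; have [_ _ ind2] := hU.
have I1 := ind1 s1 B1 us1 (fun _ _ => I) (fun _ => I).
have I2 := ind2 s2 B2 us2 sub2 (fun uv => mA _).
rewrite env_lawE (_ : _ @^-1` _ =
  (\bigcap_(u in [set` s1]) [set w : config k.+1 | B1 u (w u)]) `*`
  (\bigcap_(uv in [set` s2]) [set xi : Xi | B2 uv (U uv xi)])); last first.
  apply/seteqP; split=> -[w xi] /=.
    move=> fA; split=> [u /= /mapP[q]|uv /= /mapP[q]];
      rewrite mem_filter => /andP[sq qs] ->.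
      rewrite /B1/= site_ofK//; have := fA q qs.
      by case: q sq qs => t [z|].
    rewrite /B2 pair_ofK//; have := fA q qs.
    by case: q sq qs => t [|[x z]].
  move=> [f1 f2] [t [z|[x z]]] qs.
    have := f1 (emb (t - 1) z);
      rewrite /B1/= /key_of_site level_emb slice_emb subrK.
    by apply; apply/mapP; exists (t, inl z); rewrite // mem_filter.
  have := f2 (emb t x, emb (t - 1) z).
  rewrite /B2/= /key_of_pair/= level_emb !slice_emb.
  by apply; apply/mapP; exists (t, inr (x, z)); rewrite // mem_filter.
rewrite product_measure1E; first last.
- apply: fin_bigcap_measurable => // uv /sub2 uvb;
  exact: (@measurable_labels uv (B2 uv) uvb (mA _)).
- by apply: fin_bigcap_measurable => // u _; exact: (@measurable_site u (B1 u)).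
rewrite [X in (X * _)%E]I1 [X in (_ * X)%E]I2.
rewrite (bigID is_site)/= -[X in (_ = X * _)%E]big_filter.
rewrite -[X in (_ = _ * X)%E]big_filter /s1 /s2 !big_map; congr (_ * _)%E.
  apply: eq_big_seq => q; rewrite mem_filter => /andP[sq _].
  case: q sq => t [z _|//]; rewrite [RHS](marginal_site t z (mA _)).
  have [_ lw _] := hPp; rewrite lw//.
  by rewrite /B1 /key_of_site level_emb slice_emb subrK.
apply: eq_big_seq => q; rewrite mem_filter => /andP[sq _].
case: q sq => t [//|[x z] _]; rewrite [RHS](marginal_label t (x, z) (mA _)).
have [_ lU _] := hU; rewrite (lU (emb t x,
  emb (t - 1) z) (below_emb t x z) (B2 _) (mA _)).
by rewrite /B2 /key_of_pair/= level_emb !slice_emb.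
Qed.

Lemma env_law_drainage : drainage_law p env_law.
Proof.
split=> //; first exact: env_law_independent.
- move=> t z; rewrite marginal_site//.
  rewrite (_ : [set _ | _] = [set true]); last first.
    apply/seteqP; split=> -[] //= /eqP; rewrite eq_sym.
    by rewrite oner_eq0.
  rewrite bernoulli_probE ?ltW// !diracE mem_set//= memNset//=.
  by rewrite mule1 mule0 adde0.
- by move=> t z t' z' A mA; rewrite !marginal_site.
- by move=> t q t' q' A mA; rewrite !marginal_label.
- move=> t q a; rewrite marginal_label//.
  have /null_content_dominatesP := @dominates_uniform_prob R 0 1 ltr01.
  by apply=> //; exact: lebesgue_measure_set1.
Qed.

Lemma ae_envof (Q : @realfam R (key k) -> Prop) :
  {ae env_law, forall e, Q e} -> {ae (Pp \x mu)%E, forall a, Q (envof a)}.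
Proof.
move=> [N [mN N0 QN]]; exists (envof @^-1` N); split.
- by rewrite -[X in measurable X]setTI; exact: measurable_envof.
- exact: N0.
- by move=> a /= nQ; apply: QN.
Qed.

End environment_law.

Theorem theorem2p1 (R : realType) (d : nat) (p : R) (p_gt0 : 0 < p)
  (p_lt1 : p < 1)
  (Pp : probability (config d) R) (hPp : bernoulli_config p Pp)
  (dX : measure_display) (Xi : measurableType dX) (mu : probability Xi R)
  (U : site d * site d -> Xi -> R) (hU : uniform_labels mu U) :
  (d = 2%N \/ d = 3%N ->
     {ae (Pp \x mu)%E, forall x : config d * Xi,
        single_tree (open_sites x.1) (edge x.1 (fun uv => U uv x.2))}) /\
  ((4 <= d)%N ->
     {ae (Pp \x mu)%E, forall x : config d * Xi,
        infinitely_many_trees (open_sites x.1)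
          (edge x.1 (fun uv => U uv x.2))}).
Proof.
(* Both claims exclude [d = 0] and [d = 1]. From here the dimension is [k.+2], the walks live in
   dimension [k.+1], and an axis [i0] exists. *)
case: d Pp hPp U hU => [|[|k]] Pp hPp U hU;
  [by split=> [[]|]|by split=> [[]|]|].
pose i0 : 'I_k.+1 := ord0.
have law := env_law_drainage p_gt0 p_lt1 hPp hU.
have win := ae_envof (ae_wins law i0).
split=> [d23|k4].
  have k2 : (k.+1 <= 2)%N by lia.
  have meets := ae_envof (ae_meet law i0 k2).
  apply: filterS2 win meets => a win meets; apply: single_tree_of_meet.
    by move=> t x; exact: (win (t, x)).
  by move=> t x y; exact: (meets (t, x, y)).
have aparts := ae_envof (ae_apart law i0 k4).
apply: filterS2 win aparts => a win aparts.
apply: (infinitely_many_trees_of_apart _ (i0 := i0)) => //.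
by move=> t x; exact: (win (t, x)).
Qed.
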